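(* Let $e_1,e_2,e_3$ be nonzero integers with $e_1+e_2+e_3=0$, $2\,\|\,e_1$, $2\,\|\,e_2$, $4\mid e_3$ (so $\gcd(e_1,e_2,e_3)=2$). Let $n=p_1\cdots p_k$ be an odd positive square-free integer coprime with $e_1e_2e_3$, whose prime factors are quadratic residues modulo each odd prime factor of $e_1e_2e_3$. Assume that - neither $E$ nor $E^{(n)}$ has a rational point of order $4$; - $e_2>0$ and $e_3<0$, or all $p_i\equiv 1\pmod 4$; - $\left(\frac{p^*}{q}\right)=1$ for all odd primes $p\mid n$, $q\mid e_2e_3$. If $\mathrm{Sel}_2(E/\mathbb{Q})\cong(\mathbb{Z}/2\mathbb{Z})^2$, then every class of $\mathrm{Sel}_2'(E^{(n)})$ has a unique representative $(d_1,d_2,d_3)$ with $d_i$ (possibly negative) divisors of $n$, $d_1>0$ and $d_3\equiv1\pmod 4$, and the map $(d_1,d_2,d_3)\mapsto\begin{pmatrix}\mathbf{x}\\ \mathbf{z}\end{pmatrix}$, where $\mathbf{x}=(v_{p_i}(d_1))_i^{\mathrm T}$, $\mathbf{z}=(v_{p_i}(d_3))_i^{\mathrm T}\in\mathbb{F}_2^k$, induces an isomorphism $$\mathrm{Sel}_2'(E^{(n)})\xrightarrow{\sim}\ker\begin{pmatrix}\mathbf{A}+\mathbf{D}_{e_2}&\mathbf{D}_{-e_2e_3}\\ \mathbf{D}_{-e_1e_2}&\mathbf{A}^{\mathrm T}+\mathbf{D}_{e_2}\end{pmatrix}.$$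
   Context: For a nonzero integer $m$, $E^{(m)}$ is $y^2=x(x-e_1m)(x+e_2m)$, $E=E^{(1)}$. For $\Lambda=(d_1,d_2,d_3)$ of nonzero square-free integers with $d_1d_2d_3$ a square, $D^{(m)}_\Lambda\subset\mathbb{P}^3$ is defined by $e_1mt^2+d_2u_2^2-d_3u_3^2=0$, $e_2mt^2+d_3u_3^2-d_1u_1^2=0$, $e_3mt^2+d_1u_1^2-d_2u_2^2=0$. $\mathrm{Sel}_2(E^{(m)}/\mathbb{Q})$ is identified with the group (componentwise multiplication) of $\Lambda\in(\mathbb{Q}^\times/\mathbb{Q}^{\times2})^3$ with $d_1d_2d_3\in\mathbb{Q}^{\times2}$ and $D^{(m)}_\Lambda(\mathbb{A}_{\mathbb{Q}})\ne\emptyset$; rational 2-torsion points correspond to $(1,1,1)$, $(-e_3m,-e_1e_3,e_1m)$, $(-e_2e_3,e_3m,-e_2m)$, $(e_2m,-e_1m,-e_1e_2)$. $\mathrm{Sel}_2'(E^{(m)})=\mathrm{Sel}_2(E^{(m)}/\mathbb{Q})/(E^{(m)}(\mathbb{Q})_{\rm tors}/2E^{(m)}(\mathbb{Q})_{\rm tors})$. $[\alpha,\beta]_v$ is the additive Hilbert symbol, $(\alpha,\beta)_v=(-1)^{[\alpha,\beta]_v}$. $\mathbf{A}=([p_j,-n]_{p_i})_{i,j}\in M_k(\mathbb{F}_2)$. For $u$ coprime to $n$, $\mathbf{D}_u=\mathrm{diag}([u/p_1],\dots,[u/p_k])$, with $[u/p]\in\mathbb{F}_2$ equal to $0$ if $u$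 is a quadratic residue mod $p$ and $1$ otherwise. For an odd integer $m$, $m^*=(-1)^{(m-1)/2}m\equiv1\pmod 4$. $2\,\|\,m$ means $2\mid m$, $4\nmid m$. *)

(* Defs.v *)
From HB Require Import structures.
From mathcomp Require Import all_boot all_order all_algebra.
From mathcomp Require Import boolp.
From Stdlib Require Reals ZArith.
Set Implicit Arguments. Unset Strict Implicit. Unset Printing Implicit Defensive.
Import Order.TTheory GRing.Theory Num.Theory.
Local Open Scope ring_scope.

Definition sqfree (a : int) : Prop :=
  a != 0 /\ forall p : nat, prime p -> ~ (((p ^ 2)%N)%:Z %| a)%Z.

Definition is_square (a : int) : Prop := exists c : int, a = c ^+ 2.

(* square-free part of a nonzero integer: the square-free representative of
   its class in Q^x / Q^x2 *)
Definition sqfpart (a : int) : int :=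
  Num.sg a * (\prod_(p <- primes `|a|%N) (p ^ (logn p `|a|%N %% 2))%N)%:Z.

Definition triple := (int * int * int)%type.

(* componentwise multiplication in (Q^x/Q^x2)^3, on square-free representatives *)
Definition tmul (L L' : triple) : triple :=
  (sqfpart (L.1.1 * L'.1.1), sqfpart (L.1.2 * L'.1.2), sqfpart (L.2 * L'.2)).

Definition qr (u : int) (q : nat) : bool :=
  ~~ (q%:Z %| u)%Z && [exists x : 'I_q, (q%:Z %| (x%:Z) ^+ 2 - u)%Z].

Definition qr_bit (u : int) (p : nat) : 'F_2 := if qr u p then 0 else 1.

Definition pstar (m : nat) : int := (-1) ^+ ((m.-1)./2) * m%:Z.

(* A homogeneous system of integral forms has a nontrivial Q_p-point iff it has
   a primitive Z_p-point iff (compactness of Z_p) for every e it has an integral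
   solution modulo p^e that is primitive (not all coordinates divisible by p). *)
Definition Qp_solvable3 (p : nat) (F : int -> int -> int -> seq int) : Prop :=
  forall e : nat, exists x y z : int,
    ~~ [&& (p%:Z %| x)%Z, (p%:Z %| y)%Z & (p%:Z %| z)%Z] /\
    all (fun v => ((p%:Z) ^+ e %| v)%Z) (F x y z).

Definition Qp_solvable4 (p : nat) (F : int -> int -> int -> int -> seq int) : Prop :=
  forall e : nat, exists t u1 u2 u3 : int,
    ~~ [&& (p%:Z %| t)%Z, (p%:Z %| u1)%Z, (p%:Z %| u2)%Z & (p%:Z %| u3)%Z] /\
    all (fun v => ((p%:Z) ^+ e %| v)%Z) (F t u1 u2 u3).

Definition hilb (a b : int) (p : nat) : 'F_2 :=
  if pselect (Qp_solvable3 p (fun x y z => [:: z ^+ 2 - a * x ^+ 2 - b * y ^+ 2]))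
  then 0 else 1.

Definition int_to_Z (z : int) : BinNums.Z :=
  match z with
  | Posz n => BinInt.Z.of_nat n
  | Negz n => BinInt.Z.opp (BinInt.Z.of_nat n.+1)
  end.
Definition IR (z : int) : Reals.Rdefinitions.R :=
  Reals.Rdefinitions.IZR (int_to_Z z).

Section Curves.
Variables e1 e2 e3 : int.

Definition D_eqs (m d1 d2 d3 : int) (t u1 u2 u3 : int) : seq int :=
  [:: e1 * m * t ^+ 2 + d2 * u2 ^+ 2 - d3 * u3 ^+ 2;
      e2 * m * t ^+ 2 + d3 * u3 ^+ 2 - d1 * u1 ^+ 2;
      e3 * m * t ^+ 2 + d1 * u1 ^+ 2 - d2 * u2 ^+ 2].

Definition D_real_solvable (m d1 d2 d3 : int) : Prop :=
  let R0 := Reals.Rdefinitions.IZR BinNums.Z0 in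
  let Rp := Reals.Rdefinitions.Rplus in
  let Rm := Reals.Rdefinitions.Rmult in
  let Rs := Reals.Rdefinitions.Rminus in
  exists t u1 u2 u3 : Reals.Rdefinitions.R,
    ~ (t = R0 /\ u1 = R0 /\ u2 = R0 /\ u3 = R0) /\
    Rs (Rp (Rm (IR (e1 * m)) (Rm t t)) (Rm (IR d2) (Rm u2 u2))) (Rm (IR d3) (Rm u3 u3)) = R0 /\
    Rs (Rp (Rm (IR (e2 * m)) (Rm t t)) (Rm (IR d3) (Rm u3 u3))) (Rm (IR d1) (Rm u1 u1)) = R0 /\
    Rs (Rp (Rm (IR (e3 * m)) (Rm t t)) (Rm (IR d1) (Rm u1 u1))) (Rm (IR d2) (Rm u2 u2)) = R0.

Definition D_adelic (m : int) (L : triple) : Prop :=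
  D_real_solvable m L.1.1 L.1.2 L.2 /\
  forall p : nat, prime p -> Qp_solvable4 p (D_eqs m L.1.1 L.1.2 L.2).

(* Sel_2(E^(m)/Q), elements of (Q^x/Q^x2)^3 represented by their
   square-free integer representatives *)
Definition inSel (m : int) (L : triple) : Prop :=
  [/\ sqfree L.1.1, sqfree L.1.2, sqfree L.2,
      is_square (L.1.1 * L.1.2 * L.2) & D_adelic m L].

(* images of the rational 2-torsion points *)
Definition sqf3 (a b c : int) : triple := (sqfpart a, sqfpart b, sqfpart c).
Definition tors (m : int) : seq triple :=
  [:: (1, 1, 1); sqf3 (- e3 * m) (- e1 * e3) (e1 * m);
      sqf3 (- e2 * e3) (e3 * m) (- e2 * m); sqf3 (e2 * m) (- e1 * m) (- e1 * e2)].

Definition sel'_eq (m : int) (L L' : triple) : Prop :=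
  exists2 tau, tau \in tors m & L' = tmul L tau.

(* E^(m) : y^2 = x (x - e1 m)(x + e2 m) = x^3 + a x^2 + b x *)
Definition Ea (m : int) : rat := ((e2 - e1) * m)%:~R.
Definition Eb (m : int) : rat := (- e1 * e2 * m ^+ 2)%:~R.
Definition on_curve (m : int) (x y : rat) : bool :=
  y ^+ 2 == x * (x - (e1 * m)%:~R) * (x + (e2 * m)%:~R).

(* a rational point P = (x,y) of order 4: 2P <> O (i.e. y <> 0) and 4P = O,
   i.e. 2P (computed by the tangent doubling formula) is a 2-torsion point,
   i.e. its y-coordinate vanishes *)
Definition has_point_order4 (m : int) : Prop :=
  exists x y : rat, [/\ on_curve m x y, y != 0 &
    let lam := (3%:R * x ^+ 2 + 2%:R * Ea m * x + Eb m) / (2%:R * y) in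
    let x2 := lam ^+ 2 - Ea m - 2%:R * x in
    - (lam * (x2 - x) + y) = 0].

End Curves.

Definition Amat (k : nat) (p : 'I_k -> nat) (n : nat) : 'M['F_2]_k :=
  \matrix_(i, j) hilb (p j)%:Z (- n%:Z) (p i).

Definition Dmat (k : nat) (p : 'I_k -> nat) (u : int) : 'M['F_2]_k :=
  diag_mx (\row_i qr_bit u (p i)).

Definition bigM (e1 e2 e3 : int) (k : nat) (p : 'I_k -> nat) (n : nat)
  : 'M['F_2]_(k + k) :=
  block_mx (Amat p n + Dmat p e2) (Dmat p (- e2 * e3))
           (Dmat p (- e1 * e2)) ((Amat p n)^T + Dmat p e2).

Definition xz (k : nat) (p : 'I_k -> nat) (L : triple) : 'cV['F_2]_(k + k) :=
  col_mx (\col_i (logn (p i) `|L.1.1|%N)%:R) (\col_i (logn (p i) `|L.2|%N)%:R).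

Definition is_rep (n : nat) (L : triple) : Prop :=
  [/\ (L.1.1 %| n%:Z)%Z, (L.1.2 %| n%:Z)%Z, (L.2 %| n%:Z)%Z,
      0 < L.1.1 & (L.2 %% 4)%Z = 1].

(* Main.v *)
(* A class (d1,d2,d3) of Sel_2(E^(n)) can be made odd by exactly one 2-torsion class,
   because the 2-torsion classes have distinct parities at 2.  For an odd class, let
   S = (s1,s2,s3) be its part supported on n, normalized by s1 > 0 and s3 = 1 mod 4.
   The residue conditions make n and the s_i local squares at the bad odd primes
   dividing e2 e3, and at the primes dividing only e1 multiplying (d2,d3) by a unit
   does not affect solvability (a norm argument), so the quotient by S is solvable for E
   at all odd primes and at infinity.  At 2, an odd class is solvable iff d3 = 1 mod 4
   and the conics containing the covering are isotropic, and the latter follows from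
   the product formula for Hilbert symbols.  Hence the quotient lies in Sel_2(E), is odd,
   and is therefore trivial: the class is its own representative S.

   The same local analysis shows that a triple S lies in Sel_2(E^(n)) iff it is solvable
   at the p_i, which amounts to two linear relations between Hilbert symbols,
     (d1, -e1 e2 n^2) = (d3, e2 n)  and  (d1, -e2 n) = (d3, -e2 e3 n^2)  at p_i.
   Quadratic reciprocity, in the form (p_j^*, n)_(p_i) = (p_i, -n)_(p_j), identifies
   them with the rows of the matrix. *)
Require Import Defs.
From HB Require Import structures.
From mathcomp Require Import all_boot all_order all_algebra all_solvable all_field.
From mathcomp Require Import boolp zify ring.
From Stdlib Require Reals Lra.
Set Implicit Arguments. Unset Strict Implicit. Unset Printing Implicit Defensive.
Import Order.TTheory GRing.Theory Num.Theory.
Local Open Scope ring_scope.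

(** * Quadratic characters of finite fields *)

(** The obstacle is the place 2. At odd primes dividing the e's the residue conditions make [n] a
    local square, so [E] and its twist can be compared there, but [n] need not be a 2-adic square.
    Hence 2 is always treated last: the conic symbols at 2 are computed from the other places, and a
    finite check modulo 8 turns their vanishing into a 2-adic point. The relations at the p_i say
    that the class is orthogonal, for the local pairing (d1, d3') + (d3, d1'), to the 2-torsion
    classes. They suffice because all three coefficients of the twist have valuation 1 there, so
    that the torsion alone fills the local image. At primes of good reduction no Hasse bound enters:
    the trivial class has a point with t = 0, and for the others the trivial bound on a cubic
    character sum is enough. Q_p-points are encoded by congruences to every precision whose
    solutions have uniformly bounded valuation, so coordinates may be rescaled by non-units. The
    symbols [hs], [hs2], [hsoo] are explicit formulas, for which bilinearity is a computation; they
    meet solvability through conics. *)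

Section QuadraticCharacter.
Variable F : finFieldType.
Hypothesis two_neq0 : (2%:R : F) != 0.

Definition quadchar (x : F) : int :=
  if x == 0 then 0 else if [exists y, y ^+ 2 == x] then 1 else -1.

Lemma quadchar0 : quadchar 0 = 0.
Proof. by rewrite /quadchar eqxx. Qed.

Lemma finField_primitive_root (G : finFieldType) :
  exists z : G, (#|G|.-1).-primitive_root z.
Proof.
have card1 : (1 < #|G|)%N := finNzRing_gt1 G.
have: has (#|G|.-1).-primitive_root [seq x <- enum G | x != 0].
  apply: has_prim_root.
  - by rewrite -subn1 subn_gt0.
  - apply/allP => x; rewrite mem_filter => /andP[nx _].
    rewrite unity_rootE; apply/eqP; apply: (mulfI nx).
    by rewrite mulr1 -exprS prednK ?expf_card // ltnW.
  - by apply: filter_uniq; apply: enum_uniq.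
  - have /card_uniqP <- : uniq [seq x <- enum G | x != 0].
      by apply: filter_uniq; apply: enum_uniq.
    rewrite -(cardC1 (0 : G)); apply: subset_leq_card.
    by apply/subsetP => x hx; rewrite mem_filter mem_enum andbT.
by case/hasP => z _ hz; exists z.
Qed.

(** Otherwise [(-1) ^+ #|F|.-1] would be both 1 and -1. *)
Lemma half_card : (#|F|.-1 = (#|F|.-1)./2 + (#|F|.-1)./2)%N.
Proof.
rewrite -[LHS]odd_double_half addnn.
suff -> : odd #|F|.-1 = false by [].
apply/negP => ho.
have h1 : (-1 : F) ^+ #|F|.-1 = 1.
  have n0 : (-1 : F) != 0 by rewrite oppr_eq0 oner_eq0.
  apply: (mulfI n0); rewrite mulr1 -exprS prednK ?expf_card //.
  by apply: ltnW; apply: finNzRing_gt1.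
move: h1; rewrite -signr_odd ho expr1 => h1.
move: two_neq0; rewrite (_ : 2%:R = 1 + 1) // -{1}h1 addNr eqxx //.
Qed.

Lemma oneN1 : (1 : F) != -1.
Proof.
by rewrite -subr_eq0 opprK -(natrD _ 1 1).
Qed.

(** With a primitive root [z], [z ^+ h = -1]; a nonzero nonsquare is an odd power of [z], so its
    [h]-th power is -1. *)
Lemma euler_criterion (x : F) : (quadchar x)%:~R = x ^+ (#|F|.-1)./2.
Proof.
have [z hz] := finField_primitive_root F.
have hc := half_card; set h := (#|F|.-1)./2 in hc *.
have c1 : (0 < #|F|.-1)%N by rewrite -subn1 subn_gt0; apply: finNzRing_gt1.
have h0 : (0 < h)%N by lia.
rewrite /quadchar; case: eqP => [->|/eqP nx].
  by rewrite expr0n gtn_eqF.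
have fx (y : F) : y != 0 -> y ^+ #|F|.-1 = 1.
  move=> ny; apply: (mulfI ny); rewrite mulr1 -exprS prednK ?expf_card //.
  by apply: ltnW; apply: finNzRing_gt1.
have zh : z ^+ h = -1.
  have /eqP : (z ^+ h) ^+ 2 = 1.
    by rewrite -exprM muln2 -addnn -hc (prim_expr_order hz).
  rewrite sqrf_eq1 => /orP[/eqP e|/eqP //].
  have := prim_order_dvd hz h; rewrite e eqxx => /dvdn_leq; lia.
case: existsP => [[y /eqP hy]|hn].
  rewrite -hy -exprM mul2n -addnn -hc fx //.
  by apply: contraNneq nx => y0; rewrite -hy y0 expr0n.
have [i xz] := prim_rootP hz (fx _ nx).
have oi : odd i.
  apply/negPn/negP => ei; apply: hn; exists (z ^+ (i./2)).
  by rewrite -exprM muln2 even_halfK // xz.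
by rewrite xz exprAC zh -signr_odd oi expr1.
Qed.

Lemma quadchar_val x : x != 0 -> quadchar x = 1 \/ quadchar x = -1.
Proof. by rewrite /quadchar => /negbTE ->; case: ifP; [left|right]. Qed.

(** Euler's criterion is multiplicative, and 0, 1, -1 stay distinct in [F]. *)
Lemma quadcharM x y : quadchar (x * y) = quadchar x * quadchar y.
Proof.
have e : (quadchar (x * y))%:~R = (quadchar x * quadchar y)%:~R :> F.
  by rewrite rmorphM /= !euler_criterion exprMn.
have [x0|nx] := eqVneq x 0; first by rewrite x0 mul0r quadchar0 mul0r.
have [y0|ny] := eqVneq y 0; first by rewrite y0 mulr0 quadchar0 mulr0.
have nxy : x * y != 0 by rewrite mulf_neq0.
have n1 := oneN1.
move: e; case: (quadchar_val nx) => ->; case: (quadchar_val ny) => ->;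
  case: (quadchar_val nxy) => -> //; rewrite ?mulr1 ?mul1r ?mulrNN ?mulN1r;
  rewrite ?rmorphN ?rmorph1 => /eqP; rewrite ?(negbTE n1) 1?eq_sym ?(negbTE n1) //.
Qed.

Lemma quadchar_sqr x : x != 0 -> quadchar (x ^+ 2) = 1.
Proof.
by move=> nx; rewrite expr2 quadcharM; case: (quadchar_val nx) => ->.
Qed.

Lemma quadchar1 : quadchar 1 = 1.
Proof. by rewrite -(expr1n _ 2) quadchar_sqr // oner_neq0. Qed.

Lemma quadcharP x : quadchar x = 1 -> exists2 y, y != 0 & y ^+ 2 = x.
Proof.
rewrite /quadchar; case: eqP => // /eqP nx; case: existsP => // [[y /eqP hy]] _.
by exists y => //; apply: contraNneq nx => y0; rewrite -hy y0 expr0n.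
Qed.

Lemma quadchar_nonresidue : exists x, quadchar x = -1.
Proof.
have [z hz] := finField_primitive_root F.
have hc := half_card; set h := (#|F|.-1)./2 in hc *.
have c1 : (0 < #|F|.-1)%N by rewrite -subn1 subn_gt0; apply: finNzRing_gt1.
exists z; have nz : z != 0.
  by apply/eqP => z0; move: (prim_expr_order hz); rewrite z0 expr0n gtn_eqF //;
     apply/eqP; rewrite eq_sym oner_neq0.
case: (quadchar_val nz) => // q1.
have := euler_criterion z; rewrite q1 -/h => e.
have := prim_order_dvd hz h; rewrite -e eqxx => /dvdn_leq; lia.
Qed.

(** Multiplication by a nonresidue permutes [F] and changes the sign of every term. *)
Lemma sum_quadchar : \sum_x quadchar x = 0.
Proof.
have [g hg] := quadchar_nonresidue.
have ng : g != 0 by apply: contra_eq_neq hg => ->; rewrite quadchar0.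
have : \sum_x quadchar x = - \sum_x quadchar x.
  rewrite {1}(reindex (fun x => g * x)) /=; last first.
    by exists (fun x => g^-1 * x) => x _; rewrite mulrA ?mulVf ?mulfV ?mul1r.
  by rewrite -sumrN; apply: eq_bigr => x _; rewrite quadcharM hg mulN1r.
lia.
Qed.

(** For nonzero [x] the term is the character of [1 + a / x], which takes every value except 1 once;
    since the full character sum is 0, what remains is [- quadchar 1]. *)
Lemma sum_quadchar_shift a : a != 0 -> \sum_x quadchar (x * (x + a)) = -1.
Proof.
move=> na; rewrite (bigD1 0) //= mul0r quadchar0 add0r.
rewrite (eq_bigr (fun x => quadchar (1 + a / x))); last first.
  move=> x nx; rewrite (_ : x * (x + a) = x ^+ 2 * (1 + a / x)); last by field.
  by rewrite quadcharM quadchar_sqr // mul1r.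
rewrite (reindex_onto (fun y => a / (y - 1)) (fun x => 1 + a / x)) /=; last first.
  by move=> x nx; rewrite addrC addKr invf_div mulrCA divff // mulr1.
rewrite (eq_bigl (fun y => y != 1)); last first.
  move=> y; have [->|ny] := eqVneq y 1; first by rewrite subrr invr0 mulr0 eqxx.
  have ny1 : y - 1 != 0 by rewrite subr_eq0.
  rewrite mulf_neq0 ?invr_eq0 //=; apply/eqP.
  by rewrite invf_div mulrCA divff // mulr1 addrC subrK.
rewrite (eq_bigr quadchar); last first.
  move=> y ny; have ny1 : y - 1 != 0 by rewrite subr_eq0.
  by congr quadchar; rewrite invf_div mulrCA divff // mulr1 addrC subrK.
have := sum_quadchar; rewrite (bigD1 1) //= quadchar1; move=> /eqP; rewrite addrC addr_eq0 => /eqP <-; apply: eq_bigl => y //.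
Qed.

Lemma sum_quadchar_affine c a : \sum_x quadchar (c * (x + a)) = 0.
Proof.
rewrite (reindex (fun x => x - a)) /=; last first.
  by exists (fun x => x + a) => x _; rewrite ?subrK ?addrK.
rewrite (eq_bigr (fun x => quadchar c * quadchar x)); last first.
  by move=> x _; rewrite subrK quadcharM.
by rewrite -mulr_sumr sum_quadchar mulr0.
Qed.

Lemma sum_quadchar2 c d a b : a != b ->
  \sum_x quadchar (c * (x + a)) * quadchar (d * (x + b)) = - quadchar (c * d).
Proof.
move=> nab; rewrite (reindex (fun x => x - a)) /=; last first.
  by exists (fun x => x + a) => x _; rewrite ?subrK ?addrK.
rewrite (eq_bigr (fun x => quadchar (c * d) * quadchar (x * (x + (b - a))))); last first.
  by move=> x _; rewrite -!quadcharM; congr quadchar; ring.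
by rewrite -mulr_sumr sum_quadchar_shift ?mulrN1 // subr_eq0 eq_sym.
Qed.

(* Expanding the product over the characters, the count of [x] is
   [q - (sum of the three pairwise products) + S] where [S] is the sum of a
   cubic character, so already [S >= - q] makes it positive once the pairwise
   products sum to [-1]. *)
Lemma three_quadchar (c1 c2 c3 a1 a2 a3 : F) :
  a1 != a2 -> a2 != a3 -> a1 != a3 ->
  c1 != 0 -> c2 != 0 -> quadchar (c1 * c2 * c3) = 1 ->
  ~~ [&& quadchar c1 == 1, quadchar c2 == 1 & quadchar c3 == 1] ->
  exists x, [/\ quadchar (c1 * (x + a1)) != -1, quadchar (c2 * (x + a2)) != -1
    & quadchar (c3 * (x + a3)) != -1].
Proof.
move=> n12 n23 n13 nc1 nc2 hc hn.
(* [f] takes the values 0, 1, 2 and vanishes exactly where the character is -1, so a positive triple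
   product exhibits the required [x]. *)
pose f c a x := 1 + quadchar (c * (x + a)).
have f0 c a x : 0 <= f c a x.
  rewrite /f; have [->|h] := eqVneq (c * (x + a)) 0; first by rewrite quadchar0.
  by case: (quadchar_val h) => ->.
have hsum : 0 < \sum_x f c1 a1 x * f c2 a2 x * f c3 a3 x.
  pose S := \sum_x quadchar (c1 * (x + a1)) * quadchar (c2 * (x + a2)) * quadchar (c3 * (x + a3)).
  have -> : \sum_x f c1 a1 x * f c2 a2 x * f c3 a3 x =
    \sum_(x : F) 1 + \sum_x quadchar (c1 * (x + a1)) + \sum_x quadchar (c2 * (x + a2))
    + \sum_x quadchar (c3 * (x + a3)) +
    \sum_x quadchar (c1 * (x + a1)) * quadchar (c2 * (x + a2)) +
    \sum_x quadchar (c2 * (x + a2)) * quadchar (c3 * (x + a3)) +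
    \sum_x quadchar (c1 * (x + a1)) * quadchar (c3 * (x + a3)) + S.
    by rewrite /S -!big_split; apply: eq_bigr => x _; rewrite /f /=; ring.
  rewrite !sum_quadchar_affine !sum_quadchar2 //.
  have Sle : - \sum_(x : F) 1 <= S.
    rewrite -sumrN; apply: ler_sum => x _; rewrite -!quadcharM.
    set y := _ * _; have [->|h] := eqVneq y 0; first by rewrite quadchar0.
    by case: (quadchar_val h) => ->.
  have nc3 : c3 != 0 by apply: contra_eq_neq hc => ->; rewrite mulr0 quadchar0.
  move: (\sum_(x : F) 1) Sle => q; clearbody S => Sle.
  move: hc hn; rewrite !quadcharM.
  case: (quadchar_val nc1) => ->; case: (quadchar_val nc2) => ->;
    case: (quadchar_val nc3) => -> //= _ _; lia.
have [x hx|hno] := pickP (fun x => 0 < f c1 a1 x * f c2 a2 x * f c3 a3 x).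
  exists x; split; apply: contraTneq hx => h; rewrite /f h subrr ?mulr0 ?mul0r ?ltxx //.
suff : \sum_x f c1 a1 x * f c2 a2 x * f c3 a3 x <= 0 by lia.
by apply: sumr_le0 => x _; have := hno x; lia.
Qed.

End QuadraticCharacter.

(** * Quadratic reciprocity by Gauss sums *)

(** The Legendre symbol, with value 0 when [p] divides [u]. *)
Definition leg (p : nat) (u : int) : int := quadchar (u%:~R : 'F_p).

Lemma Fp_eq0 (p : nat) (u : int) : prime p -> ((u%:~R : 'F_p) == 0) = (p%:Z %| u)%Z.
Proof. by move=> pp; rewrite -(dvdz_pcharf (pchar_Fp pp)). Qed.

Lemma Fp_two (p : nat) : prime p -> odd p -> (2%:R : 'F_p) != 0.
Proof.
move=> pp op; rewrite -[2%:R]/((2 : int)%:~R) Fp_eq0 //.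
by rewrite dvdzE /= dvdn_prime2 //; apply/eqP => p2; rewrite p2 in op.
Qed.

Lemma Fp_int (p : nat) (x : 'F_p) : x = (x : nat)%:Z%:~R.
Proof. by rewrite -pmulrn natr_Zp. Qed.

Lemma qr_leg (p : nat) (u : int) : prime p -> qr u p = (leg p u == 1).
Proof.
move=> pp; rewrite /qr /leg /quadchar -Fp_eq0 //; case: eqP => //= _.
have -> : [exists x : 'I_p, (p%:Z %| x%:Z ^+ 2 - u)%Z] = [exists y : 'F_p, y ^+ 2 == u%:~R].
  apply/existsP/existsP => [[x]|[y]].
    rewrite -Fp_eq0 // rmorphB /= subr_eq0 rmorphXn /= => h.
    by exists (x%:Z%:~R).
  rewrite {1}[y]Fp_int -rmorphXn /= -subr_eq0 -rmorphB /= Fp_eq0 // => h.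
  have hy : (y < p)%N by rewrite -[X in (_ < X)%N](card_Fp pp) card_ord.
  by exists (Ordinal hy).
by case: ifP.
Qed.

Lemma leg_val (p : nat) (u : int) : prime p -> ~~ (p%:Z %| u)%Z -> leg p u = 1 \/ leg p u = -1.
Proof. by move=> pp hu; apply: quadchar_val; rewrite Fp_eq0. Qed.

Lemma legM (p : nat) (u v : int) : prime p -> odd p -> leg p (u * v) = leg p u * leg p v.
Proof. by move=> pp op; rewrite /leg rmorphM /= quadcharM // Fp_two. Qed.

Lemma leg_mod (p : nat) (u v : int) : prime p -> (p%:Z %| u - v)%Z -> leg p u = leg p v.
Proof.
move=> pp; rewrite -Fp_eq0 // rmorphB /= subr_eq0 => /eqP h; rewrite /leg h //.
Qed.

Lemma leg_euler (p : nat) (R : nzRingType) (u : int) : prime p -> odd p -> p \in [pchar R] ->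
  (u%:~R : R) ^+ (p.-1)./2 = (leg p u)%:~R.
Proof.
move=> pp op hR.
have := euler_criterion (Fp_two pp op) (u%:~R); rewrite card_Fp // => /eqP.
rewrite eq_sym -rmorphXn /= -subr_eq0 -rmorphB /= Fp_eq0 // (dvdz_pcharf hR).
by rewrite rmorphB /= subr_eq0 rmorphXn => /eqP.
Qed.

Lemma pchar_oneN1 (p : nat) (R : nzRingType) : prime p -> odd p -> p \in [pchar R] -> (1 : R) != -1.
Proof.
move=> pp op hR; rewrite -subr_eq0 opprK -(natrD _ 1 1) -(dvdn_pcharf hR).
by rewrite dvdn_prime2 //; apply/eqP => p2; rewrite p2 in op.
Qed.

Lemma sign_inj (p : nat) (R : nzRingType) (a b : int) : prime p -> odd p -> p \in [pchar R] ->
  (a = 1 \/ a = -1) -> (b = 1 \/ b = -1) -> a%:~R = b%:~R :> R -> a = b.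
Proof.
move=> pp op hR ha hb; have n1 := pchar_oneN1 pp op hR.
by case: ha => ->; case: hb => -> // /eqP; rewrite ?rmorphN ?rmorph1 1?eq_sym ?(negbTE n1) //
  eq_sym (negbTE n1).
Qed.

(** By Euler's theorem [N] divides [q ^ totient N - 1], so the field with [q ^ totient N] elements
    contains the root. In characteristic [q] the Frobenius acts exactly on Gauss sums. *)
Lemma primitive_root_in_pchar (q N : nat) : prime q -> coprime N q -> (0 < N)%N ->
  exists F : finFieldType, q \in [pchar F] /\ exists z : F, N.-primitive_root z.
Proof.
move=> pq cop N0.
have t0 : (0 < totient N)%N by rewrite totient_gt0.
have [F hF cF] := pPrimePowerField pq t0; exists F; split=> //.
have [z hz] := finField_primitive_root F.
have dN : (N %| #|F|.-1)%N.
  rewrite cF -subn1 -eqn_mod_dvd ?expn_gt0 ?prime_gt0 //.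
  by apply/eqP; apply: Euler_exp_totient; rewrite coprime_sym.
by exists (z ^+ (#|F|.-1 %/ N)); apply: dvdn_prim_root hz _ dN.
Qed.

Section GaussSum.
Variables (p q : nat) (F : finFieldType) (z : F).
Hypotheses (pp : prime p) (op : odd p) (pq : prime q) (oq : odd q) (npq : p != q).
Hypotheses (hF : q \in [pchar F]) (hz : p.-primitive_root z).

Let psi (a : 'F_p) : F := z ^+ (a : nat).

Lemma psi_nat n : psi n%:R = z ^+ n.
Proof. by rewrite /psi val_Fp_nat // (prim_expr_mod hz). Qed.

Lemma psiD a b : psi (a + b) = psi a * psi b.
Proof.
by rewrite -{1}[a]natr_Zp -{1}[b]natr_Zp -natrD psi_nat exprD.
Qed.

Lemma psiM n a : psi (n%:R * a) = psi a ^+ n.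
Proof. by rewrite -{1}[a]natr_Zp -natrM psi_nat mulnC exprM. Qed.

(** For nonzero [c] the sum is fixed under multiplication by [psi 1], which differs from 1. *)
Lemma sum_psi c : \sum_a psi (a * c) = if c == 0 then p%:R else 0.
Proof.
case: eqP => [->|/eqP nc].
  rewrite (eq_bigr (fun _ => 1)); last by move=> a _; rewrite mulr0 /psi expr0.
  by rewrite sumr_const card_Fp.
rewrite (reindex (fun a => a / c)) /=; last first.
  by exists (fun a => a * c) => a _; rewrite ?mulfK ?divfK.
rewrite (eq_bigr psi); last by move=> a _; rewrite divfK.
have h : psi 1 * \sum_a psi a = \sum_a psi a.
  rewrite mulr_sumr [RHS](reindex (fun a => 1 + a)) /=; last first.
    by exists (fun a => a - 1) => a _; [rewrite addrC addKr|rewrite addrC subrK].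
  by apply: eq_bigr => a _; rewrite psiD.
have n1 : psi 1 != 1.
  have -> : psi 1 = z ^+ 1 by rewrite -psi_nat.
  rewrite -(prim_order_dvd hz) dvdn1.
  by apply: contraTneq pp => ->.
apply/eqP; move/eqP: h; rewrite -subr_eq0 -{2}[\sum_a _]mul1r -mulrBl mulf_eq0 subr_eq0.
by rewrite (negbTE n1).
Qed.

Let g := \sum_a (quadchar a)%:~R * psi a.

Lemma gauss_sqr : g ^+ 2 = (leg p (-1) * p%:Z)%:~R.
Proof.
have tp := Fp_two pp op.
rewrite expr2 mulr_suml.
(* Replacing the second index by [a * c] makes the two characters of [a] cancel and leaves only that
   of [c]. *)
rewrite (eq_bigr (fun a => \sum_c (quadchar c)%:~R * (if a == 0 then 0 else psi (a * (1 + c))))); last first.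
  move=> a _; have [->|na] := eqVneq a 0.
    by rewrite quadchar0 !mul0r big1 // => c _; rewrite mulr0.
  rewrite mulr_sumr (reindex (fun c => a * c)) /=; last first.
    by exists (fun x => a^-1 * x) => x _; rewrite mulrA ?mulVf ?mulfV ?mul1r.
  apply: eq_bigr => c _; rewrite mulrDr mulr1 psiD quadcharM // rmorphM /=.
  have e : (quadchar a)%:~R * (quadchar a)%:~R = 1 :> F.
    by rewrite -rmorphM /=; case: (quadchar_val na) => ->; rewrite ?rmorph1.
  transitivity ((quadchar a)%:~R * (quadchar a)%:~R * ((quadchar c)%:~R * (psi a * psi (a * c)))).
    by ring.
  by rewrite e mul1r.
rewrite exchange_big /=.
(* For fixed [c] the sum of [psi (a * (1 + c))] over nonzero [a] is [p] times the indicator of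
   [c = -1], minus 1. *)
rewrite (eq_bigr (fun c => (quadchar c)%:~R * (if c == -1 then p%:R else 0) - (quadchar c)%:~R)); last first.
  move=> c _; rewrite -mulr_sumr -[X in _ = _ - X]mulr1 -mulrBr; congr (_ * _).
  have := sum_psi (1 + c); rewrite (bigD1 0) //= mul0r {1}/psi expr0 addrC [in RHS]addrC addr_eq0 => h.
  rewrite (bigD1 0) //= ?eqxx add0r.
  rewrite (eq_bigr (fun a => psi (a * (1 + c)))); last by move=> a /negbTE ->.
  by apply: (addIr 1); rewrite subrK -h.
rewrite sumrB -[X in _ - X]rmorph_sum /= sum_quadchar // rmorph0 subr0.
rewrite (bigD1 (-1)) //= eqxx big1 ?addr0; last by move=> c /negbTE ->; rewrite mulr0.
by rewrite /leg rmorphM /= rmorphN1 pmulrn.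
Qed.

(** The Frobenius sends [psi a] to [psi (q * a)]; reindexing extracts the character of [q]. *)
Lemma gauss_frob : g ^+ q = (leg p q)%:~R * g.
Proof.
have tp := Fp_two pp op.
rewrite -(pFrobenius_autE hF) rmorph_sum /= mulr_sumr.
have nq : (q%:R : 'F_p) != 0.
  rewrite -(dvdn_pcharf (pchar_Fp pp)) dvdn_prime2 //.
rewrite [RHS](reindex (fun a => q%:R * a)) /=; last first.
  by exists (fun x => q%:R^-1 * x) => x _; rewrite mulrA ?mulVf ?mulfV ?mul1r.
apply: eq_bigr => a _; rewrite rmorphM /= rmorph_int pFrobenius_autE psiM mulrA; congr (_ * _).
by rewrite -rmorphM /= quadcharM // mulrA /leg -pmulrn -quadcharM // -expr2 quadchar_sqr // mul1r.
Qed.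

(** [g ^+ q.-1] is a power of [g ^+ 2], hence by Euler's criterion the left symbol; by the Frobenius
    it is also the right one. Cancelling [g] is allowed because its square is nonzero in
    characteristic [q]. *)
Lemma gauss_reciprocity_aux : leg q (leg p (-1) * p%:Z) = leg p q.
Proof.
have ndp : ~~ (p%:Z %| q%:Z)%Z by rewrite dvdzE /= dvdn_prime2.
have nd1 : ~~ (p%:Z %| -1)%Z by rewrite dvdzE /= dvdn1; apply: contraTneq pp => ->.
have nds : ~~ (q%:Z %| leg p (-1) * p%:Z)%Z.
  rewrite dvdzE abszM (_ : `|leg p (-1)|%N = 1%N) ?mul1n ?dvdn_prime2 ?[q == p]eq_sym //.
  by case: (leg_val pp nd1) => ->.
apply: (sign_inj pq oq hF); [exact: leg_val|exact: leg_val|].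
rewrite -leg_euler // -gauss_sqr -exprM mul2n.
have -> : ((q.-1)./2.*2 = q.-1)%N by rewrite even_halfK //; case: (q) oq pq => //= ? ->.
have ng : g != 0.
  have : g ^+ 2 != 0 by rewrite gauss_sqr -(dvdz_pcharf hF).
  by rewrite expf_eq0.
by apply: (mulIf ng); rewrite -exprSr prednK ?prime_gt0 // gauss_frob.
Qed.

End GaussSum.

Lemma legN1 p : prime p -> odd p -> leg p (-1) = (-1) ^+ (p.-1)./2.
Proof.
move=> pp op; have hF := pchar_Fp pp.
have nd1 : ~~ (p%:Z %| -1)%Z by rewrite dvdzE /= dvdn1; apply: contraTneq pp => ->.
apply: (sign_inj pp op hF); first exact: leg_val.
  by rewrite -signr_odd; case: (odd _); [right|left].
by rewrite -leg_euler // !rmorphXn.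
Qed.

Lemma quadratic_reciprocity p q : prime p -> odd p -> prime q -> odd q -> p != q ->
  leg q (pstar p) = leg p q.
Proof.
move=> pp op pq oq npq.
have cpq : coprime p q by rewrite prime_coprime // dvdn_prime2.
have [F [hF [z hz]]] := primitive_root_in_pchar pq cpq (prime_gt0 pp).
by rewrite -(gauss_reciprocity_aux pp op pq oq npq hF hz) legN1.
Qed.

(** With [z] a primitive eighth root of unity in characteristic [p], [y = z + z^-1] squares to 2,
    and its [p]-th power is [y] or [- y] according to [p] modulo 8. *)
Lemma leg2 p : prime p -> odd p -> leg p 2 = if (p %% 8 == 1)%N || (p %% 8 == 7)%N then 1 else -1.
Proof.
move=> pp op.
have c8 : coprime 8 p by rewrite (_ : 8 = 2 ^ 3)%N // coprimeXl // coprime2n.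
have [F [hF [z hz]]] := primitive_root_in_pchar pp c8 isT.
have nz : z != 0.
  by apply/eqP => z0; move: (prim_expr_order hz); rewrite z0 expr0n => /esym/eqP; rewrite oner_eq0.
have z8 := prim_expr_order hz.
have z4 : z ^+ 4 = -1.
  have /eqP : (z ^+ 4) ^+ 2 = 1 by rewrite -exprM.
  by rewrite sqrf_eq1 -(prim_order_dvd hz) => /eqP.
pose y := z + z^-1.
have y2 : y ^+ 2 = 2%:R.
  rewrite (_ : y ^+ 2 = 2%:R + (z ^+ 4 + 1) / z ^+ 2); last by rewrite /y; field.
  by rewrite z4 addNr mul0r addr0.
have nd2 : ~~ (p%:Z %| 2)%Z.
  by rewrite dvdzE /= dvdn_prime2 //; apply/eqP => p2; rewrite p2 in op.
have ny : y != 0.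
  have : y ^+ 2 != 0 by rewrite y2 -[2%:R]/((2 : int)%:~R) -(dvdz_pcharf hF).
  by rewrite expf_eq0.
apply: (sign_inj pp op hF); [exact: leg_val | by case: ifP; [left|right] |].
rewrite -leg_euler // -[(2 : int)%:~R]/(2%:R) -y2 -exprM mul2n.
have -> : ((p.-1)./2.*2 = p.-1)%N by rewrite even_halfK //; case: (p) op pp => //= ? ->.
apply: (mulIf ny); rewrite -exprSr prednK ?prime_gt0 //.
rewrite -(pFrobenius_autE hF) rmorphD /= fmorphV /= pFrobenius_autE.
rewrite -(prim_expr_mod hz p).
have : (p %% 8 < 8)%N by rewrite ltn_mod.
have : odd (p %% 8) by rewrite odd_mod.
have z3 : z ^+ 3 = - z^-1 by apply: (mulfI nz); rewrite -exprS z4 mulrN mulfV.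
have z5 : z ^+ 5 = - z by rewrite exprS z4 mulrN1.
have z7 : z ^+ 7 = z^-1 by apply: (mulfI nz); rewrite -exprS z8 mulfV.
case: (p %% 8)%N => [|[|[|[|[|[|[|[|]]]]]]]] //= _ _.
- by rewrite expr1 mul1r.
- by rewrite z3 /y invrN invrK mulN1r opprD addrC.
- by rewrite z5 /y invrN mulN1r opprD.
- by rewrite z7 invrK /y mul1r addrC.
Qed.

(** * Hilbert symbols and their product formula *)

Definition nonres (p : nat) (u : int) : bool := leg p u == -1.

Lemma nonresM p u v : prime p -> odd p -> ~~ (p%:Z %| u)%Z -> ~~ (p%:Z %| v)%Z ->
  nonres p (u * v) = nonres p u (+) nonres p v.
Proof.
move=> pp op hu hv; rewrite /nonres legM //.
by case: (leg_val pp hu) => ->; case: (leg_val pp hv) => ->.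
Qed.

Lemma qr_nonres p u : prime p -> ~~ (p%:Z %| u)%Z -> qr u p = ~~ nonres p u.
Proof.
by move=> pp hu; rewrite qr_leg // /nonres; case: (leg_val pp hu) => ->.
Qed.

Lemma nonres1 p : prime p -> odd p -> nonres p 1 = false.
Proof.
move=> pp op; have n1 : ~~ (p%:Z %| 1)%Z.
  by rewrite dvdzE /= dvdn1; apply: contraTneq pp => ->.
by have := nonresM pp op n1 n1; rewrite mulr1; case: (nonres p 1).
Qed.

Lemma Euclid_dvdzM p (u v : int) : prime p -> (p%:Z %| u * v)%Z = (p%:Z %| u)%Z || (p%:Z %| v)%Z.
Proof. by move=> pp; rewrite !dvdzE abszM Euclid_dvdM. Qed.

Definition vodd (p : nat) (a : int) : bool := odd (logn p `|a|%N).
Definition upart (p : nat) (a : int) : int := (a %/ (p ^ logn p `|a|%N)%N%:Z)%Z.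

Lemma upartE p a : prime p -> a != 0 -> a = (p ^ logn p `|a|%N)%N%:Z * upart p a.
Proof.
move=> pp na; rewrite mulrC /upart divzK // dvdzE /=.
by apply: pfactor_dvdnn.
Qed.

Lemma logn_uniq p k u : prime p -> ~~ (p%:Z %| u)%Z -> logn p `|((p ^ k)%N%:Z * u)%R|%N = k.
Proof.
move=> pp hu; rewrite abszM /= lognM ?expn_gt0 ?(prime_gt0 pp) //; last first.
  by rewrite absz_gt0; apply: contraNneq hu => ->; rewrite dvdz0.
by rewrite pfactorK // (@lognE p `|u|%N) -[(p %| `|u|)%N]/(p%:Z %| u)%Z (negbTE hu) !andbF addn0.
Qed.

Lemma upart_uniq p k u : prime p -> ~~ (p%:Z %| u)%Z -> upart p ((p ^ k)%N%:Z * u) = u.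
Proof.
move=> pp hu; rewrite /upart logn_uniq // mulKz //.
by rewrite eqz_nat -lt0n expn_gt0 prime_gt0.
Qed.

Lemma upart_unit p a : prime p -> a != 0 -> ~~ (p%:Z %| upart p a)%Z.
Proof.
move=> pp na; apply/negP; rewrite dvdzE /= => h.
have := upartE pp na => e.
have : (p ^ (logn p `|a|).+1 %| `|a|)%N.
  by rewrite {2}e abszM /= expnSr dvdn_mul.
by rewrite pfactor_dvdn ?absz_gt0 // ltnn.
Qed.

Lemma upart_id p a : prime p -> ~~ (p%:Z %| a)%Z -> upart p a = a /\ vodd p a = false.
Proof.
move=> pp ha; have := upart_uniq 0 pp ha; have := logn_uniq 0 pp ha.
by rewrite expn0 mul1r /vodd => -> ->.
Qed.

Lemma voddM p a b : prime p -> a != 0 -> b != 0 -> vodd p (a * b) = vodd p a (+) vodd p b.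
Proof. by move=> pp na nb; rewrite /vodd abszM lognM ?absz_gt0 // oddD. Qed.

Lemma upartM p a b : prime p -> a != 0 -> b != 0 -> upart p (a * b) = upart p a * upart p b.
Proof.
move=> pp na nb; have ua := upart_unit pp na; have ub := upart_unit pp nb.
have e : a * b = (p ^ (logn p `|a|%N + logn p `|b|%N))%N%:Z * (upart p a * upart p b).
  by rewrite {1}(upartE pp na) {1}(upartE pp nb) expnD PoszM; ring.
by rewrite {1}e upart_uniq // Euclid_dvdzM // negb_or ua.
Qed.

(* Additive Hilbert symbols by the classical explicit formulas at an odd prime,
   at 2 and at infinity. *)
Definition hs (p : nat) (a b : int) : bool :=
  (vodd p b && nonres p (upart p a)) (+) (vodd p a && nonres p (upart p b))
  (+) (vodd p a && vodd p b && nonres p (-1)).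
Definition eps4 (u : int) : bool := (u %% 4)%Z == 3.
Definition omega8 (u : int) : bool := ((u %% 8)%Z == 3) || ((u %% 8)%Z == 5).
Definition hs2 (a b : int) : bool :=
  (eps4 (upart 2 a) && eps4 (upart 2 b)) (+) (vodd 2 a && omega8 (upart 2 b))
  (+) (vodd 2 b && omega8 (upart 2 a)).
Definition hsoo (a b : int) : bool := (a < 0) && (b < 0).

Ltac bcase := repeat match goal with
  | |- context [vodd ?p ?a] => case: (vodd p a)
  | |- context [nonres ?p ?a] => case: (nonres p a)
  | |- context [eps4 ?a] => case: (eps4 a)
  | |- context [omega8 ?a] => case: (omega8 a)
  end.

Lemma hsC p a b : hs p a b = hs p b a.
Proof. by rewrite /hs; bcase. Qed.

Lemma hs2C a b : hs2 a b = hs2 b a.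
Proof. by rewrite /hs2; bcase. Qed.

Lemma hsooC a b : hsoo a b = hsoo b a.
Proof. by rewrite /hsoo andbC. Qed.

Lemma hsMl p a a' b : prime p -> odd p -> a != 0 -> a' != 0 -> b != 0 ->
  hs p (a * a') b = hs p a b (+) hs p a' b.
Proof.
move=> pp op na na' nb; rewrite /hs voddM // upartM // nonresM ?upart_unit //.
by bcase.
Qed.

Lemma hsMr p a b b' : prime p -> odd p -> a != 0 -> b != 0 -> b' != 0 ->
  hs p a (b * b') = hs p a b (+) hs p a b'.
Proof. by move=> *; rewrite hsC hsMl // !(hsC p a). Qed.

Lemma odd_dvd2 (u : int) : ~~ (2 %| u)%Z -> (u %% 8)%Z \in [:: 1; 3; 5; 7].
Proof. by move=> h; rewrite !inE; lia. Qed.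

Lemma eps4M u v : ~~ (2 %| u)%Z -> ~~ (2 %| v)%Z -> eps4 (u * v) = eps4 u (+) eps4 v.
Proof.
move=> hu hv; rewrite /eps4 -modzMml -modzMmr.
have : (u %% 4)%Z \in [:: 1; 3] by rewrite !inE; lia.
have : (v %% 4)%Z \in [:: 1; 3] by rewrite !inE; lia.
by rewrite !inE => /orP[]/eqP -> /orP[]/eqP ->.
Qed.

Lemma omega8M u v : ~~ (2 %| u)%Z -> ~~ (2 %| v)%Z -> omega8 (u * v) = omega8 u (+) omega8 v.
Proof.
move=> hu hv; rewrite /omega8 -modzMml -modzMmr.
have := odd_dvd2 hu; have := odd_dvd2 hv.
by rewrite !inE => /or4P[]/eqP -> /or4P[]/eqP ->.
Qed.

Lemma hs2Ml a a' b : a != 0 -> a' != 0 -> b != 0 -> hs2 (a * a') b = hs2 a b (+) hs2 a' b.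
Proof.
move=> na na' nb; have p2 : prime 2 by [].
rewrite /hs2 voddM // upartM // eps4M ?omega8M; try exact: (upart_unit p2).
by bcase.
Qed.

Lemma lt0_mul (a b : int) : a != 0 -> b != 0 -> (a * b < 0) = (a < 0) (+) (b < 0).
Proof.
move=> na nb; case: (ltgtP a 0) na => // ha _; case: (ltgtP b 0) nb => // hb _ /=;
  by rewrite ?(nmulr_rlt0 _ ha) ?(pmulr_rlt0 _ ha) ?hb // ltNge ltW.
Qed.

Lemma hsooMl a a' b : a != 0 -> a' != 0 -> b != 0 -> hsoo (a * a') b = hsoo a b (+) hsoo a' b.
Proof.
rewrite /hsoo => na na' nb; rewrite lt0_mul //.
by case: (a < 0); case: (a' < 0); case: (b < 0).
Qed.

Lemma hs_unit p a b : prime p -> ~~ (p%:Z %| a)%Z -> ~~ (p%:Z %| b)%Z -> hs p a b = false.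
Proof.
by move=> pp ha hb; rewrite /hs (upart_id pp ha).2 (upart_id pp hb).2.
Qed.

Lemma upart_prime p : prime p -> upart p p = 1 /\ vodd p p = true.
Proof.
move=> pp; have n1 : ~~ (p%:Z %| 1)%Z.
  by rewrite dvdzE /= dvdn1; apply: contraTneq pp => ->.
have := upart_uniq 1 pp n1; have := logn_uniq 1 pp n1.
by rewrite expn1 mulr1 /vodd => -> ->.
Qed.

Lemma hs_prime p b : prime p -> odd p -> ~~ (p%:Z %| b)%Z -> hs p p b = nonres p b.
Proof.
move=> pp op hb; rewrite /hs (upart_id pp hb).1 (upart_id pp hb).2.
by rewrite (upart_prime pp).2 /= addbF.
Qed.

Lemma nonresN1 p : prime p -> odd p -> nonres p (-1) = eps4 p.
Proof.
move=> pp op; rewrite /nonres legN1 // /eps4 -signr_odd.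
have -> : odd (p.-1)./2 = (p %% 4 == 3)%N by lia.
rewrite modz_nat eqz_nat.
by case: (p %% 4 == 3)%N.
Qed.

Lemma nonres2 p : prime p -> odd p -> nonres p 2 = omega8 p.
Proof.
move=> pp op; rewrite /nonres leg2 // /omega8 modz_nat !eqz_nat.
have : odd (p %% 8) by rewrite odd_mod.
by case: (p %% 8)%N (ltn_pmod p (isT : 0 < 8)%N) => [|[|[|[|[|[|[|[|]]]]]]]].
Qed.

Lemma nonres_reciprocity p q : prime p -> odd p -> prime q -> odd q -> p != q ->
  nonres p q = nonres q p (+) (eps4 p && eps4 q).
Proof.
move=> pp op pq oq npq; rewrite /nonres -(quadratic_reciprocity pp op pq oq npq).
rewrite /pstar legM // -nonresN1 // -nonresN1 //.
have nd1 r : prime r -> ~~ (r%:Z %| -1)%Z by move=> pr; rewrite dvdzE /= dvdn1; apply: contraTneq pr => ->.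
have nqp : ~~ (q%:Z %| p%:Z)%Z by rewrite dvdzE /= dvdn_prime2 // eq_sym.
have -> : nonres p (-1) = odd (p.-1)./2.
  by rewrite /nonres legN1 // -signr_odd; case: (odd _).
rewrite -signr_odd; case: (odd _) => /=; rewrite ?expr1 ?expr0.
  by rewrite /nonres; case: (leg_val pq (nd1 _ pq)) => ->; case: (leg_val pq nqp) => ->.
by rewrite /leg rmorph1 quadchar1 ?Fp_two // mul1r addbF.
Qed.

(** The sum over all places: once [N] exceeds both absolute values, the omitted odd primes divide
    neither argument and contribute nothing. *)
Definition hs_total (N : nat) (a b : int) : bool :=
  hsoo a b (+) hs2 a b (+)
  \big[addb/false]_(p <- [seq q <- iota 0 N | prime q && odd q]) hs p a b.

Lemma hs_totalC N a b : hs_total N a b = hs_total N b a.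
Proof.
rewrite /hs_total hsooC hs2C; congr (_ (+) _); apply: eq_bigr => p _; exact: hsC.
Qed.

Lemma hs_totalMl N a a' b : a != 0 -> a' != 0 -> b != 0 ->
  hs_total N (a * a') b = hs_total N a b (+) hs_total N a' b.
Proof.
move=> na na' nb; rewrite /hs_total hsooMl // hs2Ml //.
rewrite (eq_big_seq (fun p => hs p a b (+) hs p a' b)); last first.
  by move=> p; rewrite mem_filter => /andP[/andP[pp op] _]; exact: hsMl.
rewrite big_split /=.
set X := \big[addb/false]_(p <- _) hs p a b; set Y := \big[addb/false]_(p <- _) hs p a' b.
by case: (hsoo a b); case: (hsoo a' b); case: (hs2 a b); case: (hs2 a' b); case: X; case: Y.
Qed.

Lemma hs_total1 N b : b != 0 -> hs_total N 1 b = false.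
Proof. by move=> nb; have := hs_totalMl N (oner_neq0 _) (oner_neq0 _) nb; rewrite mulr1; case: hs_total. Qed.

(** The bound [N] is carried along so that only primes seen by [hs_total N] occur as generators. *)
Lemma int_mul_ind (P : int -> Prop) (N : nat) :
  P 1 -> P (-1) -> (forall p : nat, prime p -> (p < N)%N -> P p) ->
  (forall a b, a != 0 -> b != 0 -> P a -> P b -> P (a * b)) ->
  forall a, a != 0 -> (`|a| < N)%N -> P a.
Proof.
move=> P1 Pm1 Pp PM.
have Pn (n : nat) : (0 < n)%N -> (n < N)%N -> P n.
  elim/ltn_ind: n => n IH n0 nN.
  have [n1|n1] := leqP n 1; first by have -> : n = 1%N by lia.
  have pr := pdiv_prime n1; have le := pdiv_leq n0; have dv := pdiv_dvd n.
  have e : n = (pdiv n * (n %/ pdiv n))%N by rewrite mulnC divnK.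
  have q0 : (0 < n %/ pdiv n)%N by rewrite divn_gt0 // prime_gt0.
  have q1 : (n %/ pdiv n < n)%N by apply: ltn_Pdiv => //; apply: prime_gt1.
  rewrite e PoszM; apply: PM.
  - by rewrite eqz_nat -lt0n prime_gt0.
  - by rewrite eqz_nat -lt0n.
  - by apply: Pp => //; apply: leq_ltn_trans nN.
  - by apply: IH => //; apply: ltn_trans nN.
move=> a na aN; have a0 : (0 < `|a|)%N by rewrite absz_gt0.
have := Pn _ a0 aN; have [ha|ha] := leP 0 a; first by rewrite gez0_abs.
have e : a = -1 * `|a|%N%:Z by lia.
by move=> h; rewrite e; apply: PM => //; rewrite eqz_nat absz_eq0.
Qed.

Lemma hs_total_gen N p b : prime p -> odd p -> (p < N)%N ->
  (forall q, prime q -> odd q -> q != p -> ~~ (q%:Z %| b)%Z) ->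
  hs_total N p b = hs2 p b (+) hs p p b.
Proof.
move=> pp op pN hb; rewrite /hs_total {1}/hsoo /=; congr (_ (+) _).
have mp : p \in [seq q <- iota 0 N | prime q && odd q].
  by rewrite mem_filter pp op mem_iota.
rewrite (bigD1_seq p) //=; last by apply: filter_uniq; apply: iota_uniq.
rewrite big_seq_cond big1 ?addbF // => q /andP[]; rewrite mem_filter => /andP[/andP[pq oq] _] nq.
by apply: hs_unit => //; [rewrite dvdzE /= dvdn_prime2|exact: hb].
Qed.

Lemma hs_total_unit N a b :
  (forall q, prime q -> odd q -> ~~ (q%:Z %| a)%Z /\ ~~ (q%:Z %| b)%Z) ->
  hs_total N a b = hsoo a b (+) hs2 a b.
Proof.
move=> h; rewrite /hs_total big_seq big1 ?addbF // => q.
by rewrite mem_filter => /andP[/andP[pq oq] _]; case: (h _ pq oq) => ? ?; apply: hs_unit.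
Qed.

Lemma prime_ndvd1 q : prime q -> ~~ (q%:Z %| 1)%Z /\ ~~ (q%:Z %| -1)%Z.
Proof. by move=> pq; rewrite !dvdzE /= dvdn1; split; apply: contraTneq pq => ->. Qed.

Lemma odd_prime_ndvd2 q : prime q -> odd q -> ~~ (q%:Z %| 2)%Z.
Proof. by move=> pq oq; rewrite dvdzE /= dvdn_prime2 //; apply: contraTneq oq => ->. Qed.

Lemma odd_upart2 (a : int) : ~~ (2 %| a)%Z -> upart 2 a = a /\ vodd 2 a = false.
Proof. by move=> h; apply: upart_id. Qed.

Lemma hs2_odd (a b : int) : ~~ (2 %| a)%Z -> ~~ (2 %| b)%Z -> hs2 a b = eps4 a && eps4 b.
Proof.
by move=> ha hb; rewrite /hs2 !(odd_upart2 ha).1 !(odd_upart2 ha).2 !(odd_upart2 hb).1 !(odd_upart2 hb).2 !addbF.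
Qed.

Lemma hs2_2 (b : int) : ~~ (2 %| b)%Z -> hs2 2 b = omega8 b.
Proof.
move=> hb; have [u2 v2] := upart_prime (isT : prime 2).
by rewrite /hs2 !(odd_upart2 hb).1 !(odd_upart2 hb).2 u2 v2 /= addbF.
Qed.

(** On generators the product formula is reciprocity: (p, -1) and (p, 2) are the supplementary laws,
    two distinct odd primes give the main law, and (p, p) comes down to the first supplement. *)
Lemma hs_total_gens N :
  (forall p : nat, prime p -> (p < N)%N -> hs_total N p (-1) = false) /\
  (forall p q : nat, prime p -> prime q -> (p < N)%N -> (q < N)%N -> hs_total N p q = false).
Proof.
have o2 (p : nat) : odd p -> ~~ (2 %| p%:Z)%Z by rewrite dvdzE /= dvdn2 negbK.
have [u2 v2] := upart_prime (isT : prime 2).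
split=> [p pp pN|].
  have [op|/negbTE] := boolP (odd p).
    rewrite hs_total_gen //; last by move=> q pq _ _; case: (prime_ndvd1 pq).
    rewrite hs2_odd ?o2 // hs_prime //; last by case: (prime_ndvd1 pp).
    by rewrite nonresN1 // andbT addbb.
  case/even_prime: pp => [->|->] // _; rewrite hs_total_unit; last first.
    by move=> q pq oq; split; [exact: odd_prime_ndvd2|case: (prime_ndvd1 pq)].
  by rewrite hs2_2.
have g2 (p : nat) : prime p -> odd p -> (p < N)%N -> hs_total N p 2 = false.
  move=> pp op pN; rewrite hs_total_gen //; last by move=> q pq oq _; exact: odd_prime_ndvd2.
  by rewrite hs2C hs2_2 ?o2 // hs_prime ?odd_prime_ndvd2 // nonres2 // addbb.
move=> p q pp pq pN qN.
have [op|/negbTE] := boolP (odd p); have [oq|/negbTE] := boolP (odd q).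
- have [e|npq] := eqVneq p q.
    rewrite -e hs_total_gen //; last first.
      by move=> r pr _ nr; rewrite dvdzE /= dvdn_prime2.
    rewrite hs2_odd ?o2 // andbb /hs (upart_prime pp).1 (upart_prime pp).2 nonres1 //=.
    by rewrite nonresN1 // addbb.
  rewrite /hs_total {1}/hsoo /= hs2_odd ?o2 //.
  have mp (r : nat) : prime r -> odd r -> (r < N)%N -> r \in [seq q <- iota 0 N | prime q && odd q].
    by move=> pr or rN; rewrite mem_filter pr or mem_iota.
  rewrite (bigD1_seq p) ?mp //=; last by apply: filter_uniq; apply: iota_uniq.
  rewrite -big_filter (bigD1_seq q) /=; last first.
  + by do 2 apply: filter_uniq; apply: iota_uniq.
  + by rewrite mem_filter mp // eq_sym npq.
  rewrite big_seq_cond big1 ?addbF; last first.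
    move=> r /andP[]; rewrite mem_filter => /andP[rp]; rewrite mem_filter => /andP[/andP[pr or] _] rq.
    by apply: hs_unit => //; rewrite dvdzE /= dvdn_prime2.
  rewrite hs_prime //; last by rewrite dvdzE /= dvdn_prime2.
  rewrite hsC hs_prime //; last by rewrite dvdzE /= dvdn_prime2 // eq_sym.
  by rewrite (nonres_reciprocity pp op pq oq npq); bcase.
- by case/even_prime: pq => [->|->] // _; exact: g2.
- by case/even_prime: pp => [->|->] // _; rewrite hs_totalC; exact: g2.
- case/even_prime: pq => [->|->] // _; case/even_prime: pp => [->|->] // _.
  rewrite hs_total_unit; last by move=> r pr or; split; exact: odd_prime_ndvd2.
  by rewrite /hs2 u2 v2.
Qed.

Lemma hilbert_product N a b : a != 0 -> b != 0 -> (`|a| < N)%N -> (`|b| < N)%N ->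
  hs_total N a b = false.
Proof.
move=> na nb aN bN; have [g1 g2] := hs_total_gens N.
have n1 : (-1 : int) != 0 by [].
have p0 (p : nat) : prime p -> (p%:Z : int) != 0 by case: p.
have gm b' : b' != 0 -> (`|b'| < N)%N -> hs_total N (-1) b' = false.
  move=> nb' bN'; rewrite hs_totalC; move: b' nb' bN'; apply: int_mul_ind => //.
  - by rewrite hs_total1.
  - rewrite hs_total_unit; last by move=> q pq _; have [] := prime_ndvd1 pq.
    by rewrite hs2_odd.
  - by move=> x y nx ny hx hy; rewrite hs_totalMl // hx hy.
move: a na aN; apply: int_mul_ind.
- by rewrite hs_total1.
- exact: gm.
- move=> p pp pN; rewrite hs_totalC; move: b nb bN; apply: int_mul_ind.
  + by rewrite hs_total1 ?p0.
  + by rewrite hs_totalC; exact: g1.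
  + by move=> q pq qN; exact: g2.
  + by move=> x y nx ny hx hy; rewrite hs_totalMl ?p0 // hx hy.
- by move=> x y nx ny hx hy; rewrite hs_totalMl // hx hy.
Qed.

(** The product formula, read as a computation of the one remaining place. *)
Lemma hs2_from_others a b : a != 0 -> b != 0 -> hsoo a b = false ->
  (forall p, prime p -> odd p -> hs p a b = false) -> hs2 a b = false.
Proof.
move=> na nb hoo hp.
have := hilbert_product (N := (`|a| + `|b|).+1) na nb; rewrite !ltnS leq_addr leq_addl => /(_ isT isT).
rewrite /hs_total hoo big_seq big1 ?addbF //= => p.
by rewrite mem_filter => /andP[/andP[pp op] _]; exact: hp.
Qed.

(** * Local solvability of the 2-coverings *)

Lemma dvdz_lin (d a b x y : int) : (d %| x)%Z -> (d %| y)%Z -> (d %| a * x + b * y)%Z.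
Proof. by move=> hx hy; rewrite rpredD // dvdz_mull. Qed.

Lemma Euclid_dvdzX p (x : int) : prime p -> (p%:Z %| x ^+ 2)%Z = (p%:Z %| x)%Z.
Proof. by move=> pp; rewrite expr2 Euclid_dvdzM // orbb. Qed.

Lemma pow_dvdz p (c : nat) (x : int) : prime p -> x != 0 ->
  ((p%:Z) ^+ c %| x)%Z = (c <= logn p `|x|)%N.
Proof. by move=> pp nx; rewrite dvdzE abszX /= pfactor_dvdn // absz_gt0. Qed.

Lemma not_pow_dvdM p (a b : nat) (x y : int) : prime p ->
  ~~ ((p%:Z) ^+ a %| x)%Z -> ~~ ((p%:Z) ^+ b %| y)%Z -> ~~ ((p%:Z) ^+ (a + b) %| x * y)%Z.
Proof.
move=> pp hx hy.
have nx : x != 0 by apply: contraNneq hx => ->.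
have ny : y != 0 by apply: contraNneq hy => ->.
move: hx hy; rewrite !pow_dvdz ?mulf_neq0 // abszM lognM ?absz_gt0 //; lia.
Qed.

Lemma pow_dvd_le p (a b : nat) (x : int) : (a <= b)%N -> ((p%:Z) ^+ b %| x)%Z -> ((p%:Z) ^+ a %| x)%Z.
Proof. by move=> ab; apply: dvdz_trans; rewrite -(subnK ab) exprD dvdz_mull. Qed.

Lemma pow_dvd1 p (a : nat) (x : int) : (0 < a)%N -> ((p%:Z) ^+ a %| x)%Z -> (p%:Z %| x)%Z.
Proof. by move=> a0 h; have := @pow_dvd_le p 1 a x a0 h; rewrite expr1. Qed.

Lemma not_pow_dvd p (x : int) : prime p -> x != 0 -> ~~ ((p%:Z) ^+ (logn p `|x|).+1 %| x)%Z.
Proof. by move=> pp nx; rewrite pow_dvdz // ltnn. Qed.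

(** * Hensel lifting of square roots *)

Lemma inv_mod p (a : int) : prime p -> ~~ (p%:Z %| a)%Z -> exists b, (p%:Z %| a * b - 1)%Z.
Proof.
move=> pp ha; have [u [v e]] := Bezoutz a p%:Z.
have g1 : gcdz a p = 1.
  by rewrite /gcdz /=; apply/eqP; rewrite eqz_nat -/(coprime _ _) coprime_sym prime_coprime.
exists u; rewrite (_ : a * u - 1 = - v * p%:Z); first by rewrite dvdz_mull.
by rewrite -g1 -e; ring.
Qed.

Lemma hensel_odd p (r : int) : prime p -> odd p -> ~~ (p%:Z %| r)%Z -> nonres p r = false ->
  forall e, exists2 w, ~~ (p%:Z %| w)%Z & ((p%:Z) ^+ e %| w ^+ 2 - r)%Z.
Proof.
move=> pp op hr hq.
have base : exists2 w, ~~ (p%:Z %| w)%Z & (p%:Z %| w ^+ 2 - r)%Z.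
  have : qr r p by rewrite qr_nonres // hq.
  rewrite /qr => /andP[_ /existsP[x hx]]; exists x%:Z => //.
  apply: contra hr => h; rewrite (_ : r = x%:Z * x%:Z - (x%:Z ^+ 2 - r)); last by ring.
  by rewrite rpredB // dvdz_mull.
have n2 := odd_prime_ndvd2 pp op.
elim=> [|e [w hw IH]]; first by case: base => w hw _; exists w; rewrite ?expr0 ?dvd1z.
case: e IH => [_|e IH]; first by case: base => w1 ? ?; exists w1; rewrite ?expr1.
have /dvdzP[k hk] := IH.
have n2w : ~~ (p%:Z %| 2 * w)%Z by rewrite Euclid_dvdzM // negb_or n2.
have [b hb] := inv_mod pp n2w.
have {}hb : (p%:Z %| k - 2 * w * (k * b))%Z.
  by rewrite (_ : _ - _ = - k * (2 * w * b - 1)); [rewrite dvdz_mull|ring].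
(* Newton step: [b] inverts [2 * w] modulo [p], so the error [k * p ^ e.+1] cancels to first order,
   and the quadratic term is divisible by [p ^ e.+2]. *)
exists (w - p%:Z ^+ e.+1 * (k * b)).
  apply: contra hw => h.
  rewrite (_ : w = w - p%:Z ^+ e.+1 * (k * b) + p%:Z * (p%:Z ^+ e * (k * b))); last by rewrite exprS; ring.
  by rewrite rpredD // dvdz_mulr.
rewrite (_ : _ - r = p%:Z ^+ e.+1 * (k - 2 * w * (k * b)) + p%:Z ^+ e.+2 * (p%:Z ^+ e * (k * b) ^+ 2)); last first.
  transitivity (w ^+ 2 - r - 2 * w * (p%:Z ^+ e.+1 * (k * b)) + (p%:Z ^+ e.+1 * (k * b)) ^+ 2); first by ring.
  by rewrite hk !exprS; ring.
apply: rpredD; last by rewrite dvdz_mulr.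
by rewrite [p%:Z ^+ e.+2]exprSr dvdz_mul.
Qed.

Lemma hensel_two (r : int) : (r %% 8)%Z = 1 ->
  forall e, exists2 w, ~~ (2 %| w)%Z & (2 ^+ e %| w ^+ 2 - r)%Z.
Proof.
move=> hr.
have st e : exists2 w, ~~ (2 %| w)%Z & (2 ^+ (e + 3) %| w ^+ 2 - r)%Z.
  elim: e => [|e [w hw /dvdzP[k hk]]].
    exists 1 => //; rewrite (_ : 2 ^+ (0 + 3) = 8 :> int) //; lia.
  (* Half the modulus is added: the square changes by [2 ^+ (e + 3) * k * w] to first order, and
     [k * (1 + w)] is even because [w] is odd. *)
  exists (w + 2 ^+ (e + 2) * k).
    by rewrite addnS exprS; lia.
  rewrite (_ : _ - r = 2 ^+ (e + 3) * (k * (1 + w)) + 2 ^+ (e + 4) * (2 ^+ e * k ^+ 2)).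
    have -> : (2 ^+ (e.+1 + 3) : int) = 2 ^+ (e + 3) * 2 by rewrite addSn exprSr.
    rewrite rpredD //.
      by rewrite dvdz_mul // dvdz_mull //; lia.
    by rewrite dvdz_mulr // !addnS exprSr !addn0.
  transitivity (w ^+ 2 - r + 2 * w * (2 ^+ (e + 2) * k) + (2 ^+ (e + 2) * k) ^+ 2); first by ring.
  by rewrite hk !addnS !exprS addn0; ring.
move=> e; have [w hw h] := st e; exists w => //.
by apply: (@pow_dvd_le 2) h; rewrite leq_addr.
Qed.

(* [sqp p r] says that [r] is a nonzero square of [Q_p]; the exponent [c]
   bounds the valuations of the approximate roots uniformly in the precision. *)
Definition sqp (p : nat) (r : int) : Prop :=
  exists c : nat, forall e : nat, exists x y : int,
    [/\ ~~ ((p%:Z) ^+ c %| x)%Z, ~~ ((p%:Z) ^+ c %| y)%Z & ((p%:Z) ^+ e %| r * x ^+ 2 - y ^+ 2)%Z].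

Lemma sqp_sqr p (k : int) : prime p -> k != 0 -> sqp p (k ^+ 2).
Proof.
move=> pp nk; exists (logn p `|k|).+1 => e; exists 1, k; split.
- by apply/negP => /(pow_dvd1 (ltn0Sn _)); apply/negP; case: (prime_ndvd1 pp).
- exact: not_pow_dvd.
- by rewrite expr1n mulr1 subrr dvdz0.
Qed.

Lemma sqpM p r s : prime p -> sqp p r -> sqp p s -> sqp p (r * s).
Proof.
move=> pp [c h] [c' h']; exists (c + c')%N => e.
have [x [y [hx hy hxy]]] := h e; have [x' [y' [hx' hy' hxy']]] := h' e.
exists (x * x'), (y * y'); split; [exact: not_pow_dvdM|exact: not_pow_dvdM|].
rewrite (_ : _ - _ = s * x' ^+ 2 * (r * x ^+ 2 - y ^+ 2) + y ^+ 2 * (s * x' ^+ 2 - y' ^+ 2)); last by ring.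
exact: dvdz_lin.
Qed.

Lemma sqp_odd p r : prime p -> odd p -> ~~ (p%:Z %| r)%Z -> nonres p r = false -> sqp p r.
Proof.
move=> pp op hr hq; exists 1%N => e; have [w hw h] := hensel_odd pp op hr hq e.
exists 1, w; rewrite expr1 expr1n mulr1; split => //; first by case: (prime_ndvd1 pp).
by rewrite -opprB rpredN.
Qed.

Lemma sqp_two r : (r %% 8)%Z = 1 -> sqp 2 r.
Proof.
move=> hr; exists 1%N => e; have [w hw h] := hensel_two hr e.
exists 1, w; rewrite expr1 expr1n mulr1; split => //.
by rewrite -opprB rpredN.
Qed.

Lemma sqp_cancel p r k : prime p -> k != 0 -> sqp p (r * k ^+ 2) -> sqp p r.
Proof.
move=> pp nk [c h]; exists (c + (logn p `|k|).+1)%N => e.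
have [x [y [hx hy hxy]]] := h e; exists (x * k), y; split.
- by apply: not_pow_dvdM => //; apply: not_pow_dvd.
- by apply: contra hy; apply: pow_dvd_le; rewrite leq_addr.
- by rewrite exprMn mulrA mulrAC.
Qed.

(** A Q_p-point of the covering, as approximate solutions whose minimal valuation stays below a
    bound independent of the precision [e]. Unlike primitivity, this survives rescaling the
    coordinates by fixed nonzero integers. *)
Definition lsol (p : nat) (a1 a2 a3 d1 d2 d3 : int) : Prop :=
  exists c : nat, forall e : nat, exists t u1 u2 u3 : int,
    ~~ [&& ((p%:Z) ^+ c %| t)%Z, ((p%:Z) ^+ c %| u1)%Z, ((p%:Z) ^+ c %| u2)%Z
         & ((p%:Z) ^+ c %| u3)%Z] /\
    [/\ ((p%:Z) ^+ e %| a1 * t ^+ 2 + d2 * u2 ^+ 2 - d3 * u3 ^+ 2)%Z,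
        ((p%:Z) ^+ e %| a2 * t ^+ 2 + d3 * u3 ^+ 2 - d1 * u1 ^+ 2)%Z
      & ((p%:Z) ^+ e %| a3 * t ^+ 2 + d1 * u1 ^+ 2 - d2 * u2 ^+ 2)%Z].

Definition psol (p : nat) (a1 a2 a3 d1 d2 d3 : int) (e : nat) (t u1 u2 u3 : int) : Prop :=
    ~~ [&& (p%:Z %| t)%Z, (p%:Z %| u1)%Z, (p%:Z %| u2)%Z & (p%:Z %| u3)%Z] /\
    [/\ ((p%:Z) ^+ e %| a1 * t ^+ 2 + d2 * u2 ^+ 2 - d3 * u3 ^+ 2)%Z,
        ((p%:Z) ^+ e %| a2 * t ^+ 2 + d3 * u3 ^+ 2 - d1 * u1 ^+ 2)%Z
      & ((p%:Z) ^+ e %| a3 * t ^+ 2 + d1 * u1 ^+ 2 - d2 * u2 ^+ 2)%Z].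

Lemma pow_dvd_scale p c (x : int) : prime p -> ((p%:Z) ^+ c.+1 %| x * p%:Z)%Z = ((p%:Z) ^+ c %| x)%Z.
Proof. by move=> pp; rewrite exprSr dvdz_mul2r // eqz_nat -lt0n prime_gt0. Qed.

Lemma lsol_primitive p a1 a2 a3 d1 d2 d3 : prime p -> lsol p a1 a2 a3 d1 d2 d3 ->
  forall e, exists t u1 u2 u3, psol p a1 a2 a3 d1 d2 d3 e t u1 u2 u3.
Proof.
(* Each common factor [p] removed from the coordinates costs [p ^ 2] in the equations, and at most
   [c] of them can be removed. *)
move=> pp [c h] e; have [t [u1 [u2 [u3 [hn hE]]]]] := h (e + 2 * c)%N.
elim: c t u1 u2 u3 {h} hn hE => [|c IH] t u1 u2 u3; first by rewrite expr0 !dvd1z.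
move=> hn hE.
have [/and4P[]|hp] := boolP [&& (p%:Z %| t)%Z, (p%:Z %| u1)%Z, (p%:Z %| u2)%Z & (p%:Z %| u3)%Z]; last first.
  exists t, u1, u2, u3; split=> //; case: hE => *.
  by split; apply: (@pow_dvd_le _ _ (e + 2 * c.+1)) => //; rewrite leq_addr.
move=> /dvdzP[t' et] /dvdzP[v1 e1] /dvdzP[v2 e2] /dvdzP[v3 e3].
apply: (IH t' v1 v2 v3); first by move: hn; rewrite et e1 e2 e3 !pow_dvd_scale.
have np : (p%:Z ^+ 2 : int) != 0 by rewrite expf_neq0 // eqz_nat -lt0n prime_gt0.
have sc (x y : int) : x = p%:Z ^+ 2 * y ->
  ((p%:Z) ^+ (e + 2 * c.+1) %| x)%Z -> ((p%:Z) ^+ (e + 2 * c) %| y)%Z.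
  move=> ->; rewrite (_ : e + 2 * c.+1 = 2 + (e + 2 * c))%N; last by lia.
  by rewrite exprD dvdz_mul2l.
by case: hE => h1 h2 h3; split; [apply: sc h1|apply: sc h2|apply: sc h3];
   rewrite ?et ?e1 ?e2 ?e3; ring.
Qed.

Lemma psol_lsol p a1 a2 a3 d1 d2 d3 :
  (forall e, exists t u1 u2 u3, psol p a1 a2 a3 d1 d2 d3 e t u1 u2 u3) -> lsol p a1 a2 a3 d1 d2 d3.
Proof. by move=> h; exists 1%N => e; have [t [u1 [u2 [u3 [hn hE]]]]] := h e; exists t, u1, u2, u3; rewrite expr1. Qed.

Lemma Qp_solvable4_lsol p e1 e2 e3 m d1 d2 d3 : prime p ->
  Qp_solvable4 p (D_eqs e1 e2 e3 m d1 d2 d3) <-> lsol p (e1 * m) (e2 * m) (e3 * m) d1 d2 d3.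
Proof.
move=> pp; split=> [h|h e].
  apply: psol_lsol => e; have [t [u1 [u2 [u3 [hn]]]]] := h e.
  by rewrite /= andbT => /and3P[h1 h2 h3]; exists t, u1, u2, u3.
have [t [u1 [u2 [u3 [hn [h1 h2 h3]]]]]] := lsol_primitive pp h e.
by exists t, u1, u2, u3; rewrite /= h1 h2 h3.
Qed.

Lemma lsol_cyc p a1 a2 a3 d1 d2 d3 : lsol p a1 a2 a3 d1 d2 d3 -> lsol p a2 a3 a1 d2 d3 d1.
Proof.
move=> [c h]; exists c => e; have [t [u1 [u2 [u3 [hn [h1 h2 h3]]]]]] := h e.
exists t, u2, u3, u1; split=> //.
by apply: contra hn => /and4P[-> -> -> ->].
Qed.

Lemma lsol_exact p (a1 a2 a3 d1 d2 d3 t u1 u2 u3 : int) : prime p ->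
  [|| t != 0, u1 != 0, u2 != 0 | u3 != 0] ->
  a1 * t ^+ 2 + d2 * u2 ^+ 2 - d3 * u3 ^+ 2 = 0 ->
  a2 * t ^+ 2 + d3 * u3 ^+ 2 - d1 * u1 ^+ 2 = 0 ->
  a3 * t ^+ 2 + d1 * u1 ^+ 2 - d2 * u2 ^+ 2 = 0 -> lsol p a1 a2 a3 d1 d2 d3.
Proof.
move=> pp nz h1 h2 h3.
exists (maxn (maxn (logn p `|t|) (logn p `|u1|)) (maxn (logn p `|u2|) (logn p `|u3|))).+1 => e.
exists t, u1, u2, u3; rewrite h1 h2 h3 dvdz0; split=> //.
apply/negP => /and4P[ht h1' h2' h3'].
case/or4P: nz => nz; have := not_pow_dvd pp nz; apply/negP/negPn;
 [apply: pow_dvd_le ht|apply: pow_dvd_le h1'|apply: pow_dvd_le h2'|apply: pow_dvd_le h3'];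
 rewrite ltnS !leq_max leqnn ?orbT //.
Qed.

Lemma not_all_scale p c c' (t u1 u2 u3 k0 k1 k2 k3 : int) : prime p ->
  ~~ [&& ((p%:Z) ^+ c %| t)%Z, ((p%:Z) ^+ c %| u1)%Z, ((p%:Z) ^+ c %| u2)%Z & ((p%:Z) ^+ c %| u3)%Z] ->
  ~~ ((p%:Z) ^+ c' %| k0)%Z -> ~~ ((p%:Z) ^+ c' %| k1)%Z -> ~~ ((p%:Z) ^+ c' %| k2)%Z ->
  ~~ ((p%:Z) ^+ c' %| k3)%Z ->
  ~~ [&& ((p%:Z) ^+ (c + c') %| t * k0)%Z, ((p%:Z) ^+ (c + c') %| u1 * k1)%Z,
    ((p%:Z) ^+ (c + c') %| u2 * k2)%Z & ((p%:Z) ^+ (c + c') %| u3 * k3)%Z].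
Proof.
move=> pp hn h0 h1 h2 h3; apply: contra hn => /and4P[a b c0 d].
by apply/and4P; split; apply/negPn; [apply: contraL a|apply: contraL b|apply: contraL c0|apply: contraL d] => hh;
   apply: not_pow_dvdM.
Qed.

(** If [d1 * d1' * x ^+ 2] is close to [y ^+ 2], multiplying [u1] by [y] and the other coordinates
    by [x * d1'] absorbs the change of representative. *)
Lemma lsol_square1 p a1 a2 a3 d1 d2 d3 d1' : prime p -> d1' != 0 ->
  lsol p a1 a2 a3 d1 d2 d3 -> sqp p (d1 * d1') -> lsol p a1 a2 a3 d1' d2 d3.
Proof.
move=> pp nd [c h] [c' h'].
exists (c + (c' + (logn p `|d1'|).+1))%N => e.
have [t [u1 [u2 [u3 [hn [h1 h2 h3]]]]]] := h e; have [x [y [hx hy hxy]]] := h' e.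
have nX : ~~ ((p%:Z) ^+ (c' + (logn p `|d1'|).+1) %| x * d1')%Z.
  by apply: not_pow_dvdM => //; apply: not_pow_dvd.
have ny : ~~ ((p%:Z) ^+ (c' + (logn p `|d1'|).+1) %| y)%Z.
  by apply: contra hy; apply: pow_dvd_le; rewrite leq_addr.
exists (t * (x * d1')), (u1 * y), (u2 * (x * d1')), (u3 * (x * d1')); split.
  exact: not_all_scale.
split.
- rewrite (_ : _ - _ = (x * d1') ^+ 2 * (a1 * t ^+ 2 + d2 * u2 ^+ 2 - d3 * u3 ^+ 2)); last by ring.
  by rewrite dvdz_mull.
- rewrite (_ : _ - _ = (x * d1') ^+ 2 * (a2 * t ^+ 2 + d3 * u3 ^+ 2 - d1 * u1 ^+ 2)
    + d1' * u1 ^+ 2 * (d1 * d1' * x ^+ 2 - y ^+ 2)); last by ring.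
  exact: dvdz_lin.
- rewrite (_ : _ - _ = (x * d1') ^+ 2 * (a3 * t ^+ 2 + d1 * u1 ^+ 2 - d2 * u2 ^+ 2)
    + (- (d1' * u1 ^+ 2)) * (d1 * d1' * x ^+ 2 - y ^+ 2)); last by ring.
  exact: dvdz_lin.
Qed.

Lemma lsol_square p a1 a2 a3 d1 d2 d3 d1' d2' d3' : prime p -> d1' != 0 -> d2' != 0 -> d3' != 0 ->
  lsol p a1 a2 a3 d1 d2 d3 -> sqp p (d1 * d1') -> sqp p (d2 * d2') -> sqp p (d3 * d3') ->
  lsol p a1 a2 a3 d1' d2' d3'.
Proof.
move=> pp n1 n2 n3 h s1 s2 s3.
have h1 := lsol_cyc (lsol_square1 pp n1 h s1).
have h2 := lsol_cyc (lsol_square1 pp n2 h1 s2).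
by have h3 := lsol_cyc (lsol_square1 pp n3 h2 s3).
Qed.

(** The same rescaling with [t] in the distinguished role: twists in one local square class have
    isomorphic coverings. *)
Lemma lsol_twist_square p a1 a2 a3 d1 d2 d3 r r' : prime p -> r' != 0 ->
  lsol p (a1 * r) (a2 * r) (a3 * r) d1 d2 d3 -> sqp p (r * r') ->
  lsol p (a1 * r') (a2 * r') (a3 * r') d1 d2 d3.
Proof.
move=> pp nd [c h] [c' h'].
exists (c + (c' + (logn p `|r'|).+1))%N => e.
have [t [u1 [u2 [u3 [hn [h1 h2 h3]]]]]] := h e; have [x [y [hx hy hxy]]] := h' e.
have nX : ~~ ((p%:Z) ^+ (c' + (logn p `|r'|).+1) %| x * r')%Z.
  by apply: not_pow_dvdM => //; apply: not_pow_dvd.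
have ny : ~~ ((p%:Z) ^+ (c' + (logn p `|r'|).+1) %| y)%Z.
  by apply: contra hy; apply: pow_dvd_le; rewrite leq_addr.
exists (t * y), (u1 * (x * r')), (u2 * (x * r')), (u3 * (x * r')); split.
  exact: not_all_scale.
have st (a b : int) : (p%:Z ^+ e %| a * r * t ^+ 2 + b)%Z ->
    (p%:Z ^+ e %| a * r' * (t * y) ^+ 2 + (x * r') ^+ 2 * b)%Z.
  move=> hab.
  rewrite (_ : _ + _ = (x * r') ^+ 2 * (a * r * t ^+ 2 + b) + (- (a * r' * t ^+ 2)) * (r * r' * x ^+ 2 - y ^+ 2)); last by ring.
  exact: dvdz_lin.
move: h1 h2 h3; rewrite -!addrA => /st h1 /st h2 /st h3.
split; [move: h1|move: h2|move: h3]; congr (_ %| _)%Z; ring.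
Qed.

(* Translation by the 2-torsion point (0,0): on the curve it is
   x |-> - a1 a2 / x, which exchanges the roles of t and u3, and of u1 and u2. *)
Lemma lsol_torsion p a1 a2 a3 d1 d2 d3 w : prime p -> d1 != 0 -> d2 != 0 -> d3 != 0 ->
  a1 + a2 + a3 = 0 -> d1 * d2 * d3 = w ^+ 2 -> lsol p a1 a2 a3 d1 d2 d3 ->
  lsol p a1 a2 a3 (d1 * a2) (- d2 * a1) (- d3 * a1 * a2).
Proof.
move=> pp n1 n2 n3 ha hw [c h].
have nw : w != 0.
  apply/eqP => w0; move: hw; rewrite w0 expr0n /= => /eqP.
  by rewrite !mulf_eq0 (negbTE n1) (negbTE n2) (negbTE n3).
(* Every factor multiplying a coordinate below divides [K], so one exponent [C] bounds all their
   valuations. *)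
pose K := d1 * d2 * d3 * w.
have nK : K != 0 by rewrite !mulf_neq0.
pose C := (logn p `|K|).+1.
have nd (x y : int) : x * y = K -> ~~ ((p%:Z) ^+ C %| x)%Z.
  by move=> e; apply: contra (not_pow_dvd pp nK) => hx; rewrite -[X in (_ %| X)%Z]e dvdz_mulr.
exists (c + C)%N => e; have [t [u1 [u2 [u3 [hn [h1 h2 h3]]]]]] := h e.
exists (u3 * (d1 * d2 * d3)), (u2 * (d2 * w)), (u1 * (d1 * w)), (t * (d1 * d2)); split.
  apply: not_all_scale => //.
  - by apply: contra hn => /and4P[-> -> -> ->].
  - by apply: (nd _ w).
  - by apply: (nd _ (d1 * d3)); rewrite /K; ring.
  - by apply: (nd _ (d2 * d3)); rewrite /K; ring.
  - by apply: (nd _ (d3 * w)); rewrite /K; ring.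
have ea3 : a3 = - a1 - a2 by rewrite -[LHS]addr0 -oppr0 -ha; ring.
split.
- rewrite (_ : _ - _ = a1 * (d1 ^+ 2 * d2 ^+ 2 * d3 * (a2 * t ^+ 2 + d3 * u3 ^+ 2))
     - d1 ^+ 2 * d2 * a1 * u1 ^+ 2 * w ^+ 2); last by ring.
  rewrite -hw (_ : _ - _ = a1 * d1 ^+ 2 * d2 ^+ 2 * d3 * (a2 * t ^+ 2 + d3 * u3 ^+ 2 - d1 * u1 ^+ 2)); last by ring.
  by rewrite dvdz_mull.
- rewrite (_ : _ - _ = a2 * (d1 ^+ 2 * d2 ^+ 2 * d3 * (d3 * u3 ^+ 2 - a1 * t ^+ 2))
     - d2 ^+ 2 * d1 * a2 * u2 ^+ 2 * w ^+ 2); last by ring.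
  rewrite -hw (_ : _ - _ = - (a2 * d1 ^+ 2 * d2 ^+ 2 * d3) * (a1 * t ^+ 2 + d2 * u2 ^+ 2 - d3 * u3 ^+ 2)); last by ring.
  by rewrite dvdz_mull.
- rewrite (_ : _ - _ = a3 * (d1 ^+ 2 * d2 ^+ 2 * d3 ^+ 2 * u3 ^+ 2)
     + (d2 ^+ 2 * d1 * a2 * u2 ^+ 2 + d1 ^+ 2 * d2 * a1 * u1 ^+ 2) * w ^+ 2); last by ring.
  rewrite -hw ea3 (_ : _ + _ = a2 * d1 ^+ 2 * d2 ^+ 2 * d3 * (a1 * t ^+ 2 + d2 * u2 ^+ 2 - d3 * u3 ^+ 2)
   + - (a1 * d1 ^+ 2 * d2 ^+ 2 * d3) * (a2 * t ^+ 2 + d3 * u3 ^+ 2 - d1 * u1 ^+ 2)); last by ring.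
  exact: dvdz_lin.
Qed.

(** * Conics and ramification *)

(** Isotropy over Q_p of the conic z^2 = a x^2 + b y^2, in the encoding of [lsol]. *)
Definition csol (p : nat) (a b : int) : Prop :=
  exists c : nat, forall e : nat, exists x y z : int,
    ~~ [&& ((p%:Z) ^+ c %| x)%Z, ((p%:Z) ^+ c %| y)%Z & ((p%:Z) ^+ c %| z)%Z] /\
    ((p%:Z) ^+ e %| z ^+ 2 - a * x ^+ 2 - b * y ^+ 2)%Z.

Lemma csol_primitive p a b : prime p -> csol p a b ->
  forall e, exists x y z : int, ~~ [&& (p%:Z %| x)%Z, (p%:Z %| y)%Z & (p%:Z %| z)%Z] /\
    ((p%:Z) ^+ e %| z ^+ 2 - a * x ^+ 2 - b * y ^+ 2)%Z.
Proof.
move=> pp [c h] e; have [x [y [z [hn hE]]]] := h (e + 2 * c)%N.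
elim: c x y z {h} hn hE => [|c IH] x y z; first by rewrite expr0 !dvd1z.
move=> hn hE.
have [/and3P[]|hp] := boolP [&& (p%:Z %| x)%Z, (p%:Z %| y)%Z & (p%:Z %| z)%Z]; last first.
  by exists x, y, z; split=> //; apply: pow_dvd_le hE; rewrite leq_addr.
move=> /dvdzP[x' ex] /dvdzP[y' ey] /dvdzP[z' ez].
apply: (IH x' y' z'); first by move: hn; rewrite ex ey ez !pow_dvd_scale.
have np : (p%:Z ^+ 2 : int) != 0 by rewrite expf_neq0 // eqz_nat -lt0n prime_gt0.
move: hE; rewrite ex ey ez (_ : e + 2 * c.+1 = 2 + (e + 2 * c))%N; last by lia.
rewrite (_ : _ - _ = p%:Z ^+ 2 * (z' ^+ 2 - a * x' ^+ 2 - b * y' ^+ 2)); last by ring.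
by rewrite exprD dvdz_mul2l.
Qed.

Lemma csol_sym p a b : csol p a b -> csol p b a.
Proof.
move=> [c h]; exists c => e; have [x [y [z [hn hE]]]] := h e.
exists y, x, z; split; first by apply: contra hn => /and3P[-> -> ->].
by rewrite addrAC.
Qed.

Lemma csol_strip p a b k : prime p -> k != 0 -> csol p (a * k ^+ 2) b -> csol p a b.
Proof.
move=> pp nk [c h]; exists (c + (logn p `|k|).+1)%N => e.
have [x [y [z [hn hE]]]] := h e; exists (x * k), y, z; split; last first.
  by move: hE; congr (_ %| _)%Z; ring.
apply: contra hn => /and3P[hx hy hz]; apply/and3P; split.
- by apply/negPn; apply: contraL hx => hx; apply: not_pow_dvdM => //; apply: not_pow_dvd.
- by apply: pow_dvd_le hy; rewrite leq_addr.
- by apply: pow_dvd_le hz; rewrite leq_addr.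
Qed.

Lemma residue_of_conic p (v y z : int) : prime p -> odd p -> ~~ (p%:Z %| v)%Z -> ~~ (p%:Z %| y)%Z ->
  (p%:Z %| z ^+ 2 - v * y ^+ 2)%Z -> nonres p v = false.
Proof.
move=> pp op hv hy h.
have hz : ~~ (p%:Z %| z)%Z.
  apply/negP => hz; have : (p%:Z %| v * y ^+ 2)%Z.
    rewrite (_ : v * y ^+ 2 = z * z - (z ^+ 2 - v * y ^+ 2)); last by ring.
    by rewrite rpredB // dvdz_mull.
  by rewrite Euclid_dvdzM // Euclid_dvdzX // (negbTE hv) (negbTE hy).
have : nonres p (z * z) = nonres p (v * (y * y)) by rewrite /nonres -!expr2 (leg_mod pp h).
by rewrite !nonresM ?Euclid_dvdzM ?negb_or ?hy ?hz ?hv // !addbb addbF.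
Qed.

Lemma hs_sqr p a k b : prime p -> odd p -> a != 0 -> k != 0 -> b != 0 -> hs p (a * k ^+ 2) b = hs p a b.
Proof. by move=> pp op na nk nb; rewrite hsMl ?expf_neq0 // expr2 hsMl // addbb addbF. Qed.

Lemma even_part p a : prime p -> a != 0 -> exists2 k : int, k != 0 &
  exists (u : int) (i : bool), [/\ ~~ (p%:Z %| u)%Z, u != 0 & a = (p ^ i)%N%:Z * u * k ^+ 2].
Proof.
move=> pp na; pose l := logn p `|a|.
have uu := upart_unit pp na.
exists (p ^ l./2)%N%:Z; first by rewrite eqz_nat -lt0n expn_gt0 prime_gt0.
exists (upart p a), (odd l); split=> //; first by apply: contraNneq uu => ->.
rewrite {1}(upartE pp na) -/l -{1}(odd_double_half l) expnD -muln2 expnM !PoszM.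
by ring.
Qed.

(** After removing squares [a] and [b] have valuation 0 or 1, and a primitive solution modulo
    [p ^ 2] already decides the symbol. *)
Lemma csol_hs p a b : prime p -> odd p -> a != 0 -> b != 0 -> csol p a b -> hs p a b = false.
Proof.
move=> pp op na nb.
have [k nk [u [i [uu nu ea]]]] := even_part pp na.
have [l nl [v [j [uv nv eb]]]] := even_part pp nb.
have np0 : (p%:Z : int) != 0 by rewrite eqz_nat -lt0n prime_gt0.
have npi (b0 : bool) : ((p ^ b0)%N%:Z : int) != 0 by rewrite eqz_nat -lt0n expn_gt0 prime_gt0.
rewrite ea eb => h; rewrite hs_sqr ?mulf_neq0 ?expf_neq0 //.
rewrite hsC hs_sqr ?mulf_neq0 ?expf_neq0 // hsC.
have {h} /(_ 2%N) [x [y [z [hn hE]]]] := csol_primitive pp (csol_sym (csol_strip pp nl (csol_sym (csol_strip pp nk h)))).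
have hE1 := pow_dvd1 (ltn0Sn 1) hE.
have [[n1 nm1] n2] := (prime_ndvd1 pp, odd_prime_ndvd2 pp op).
(* Exactly one odd valuation: if [p] divided [y'], it would divide [z'] and then, looking modulo
   [p ^ 2], also [x']. *)
have mixed (a' b' x' y' z' : int) : ~~ (p%:Z %| a')%Z -> ~~ (p%:Z %| b')%Z ->
    ~~ [&& (p%:Z %| x')%Z, (p%:Z %| y')%Z & (p%:Z %| z')%Z] ->
    (p%:Z ^+ 2 %| z' ^+ 2 - p%:Z * a' * x' ^+ 2 - b' * y' ^+ 2)%Z -> nonres p b' = false.
  move=> ha' hb' hn' hE'.
  have h1 : (p%:Z %| z' ^+ 2 - b' * y' ^+ 2)%Z.
    rewrite (_ : _ - _ = (z' ^+ 2 - p%:Z * a' * x' ^+ 2 - b' * y' ^+ 2) + a' * x' ^+ 2 * p%:Z); last by ring.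
    by rewrite rpredD ?dvdz_mull // (pow_dvd1 _ hE').
  have [hy|hy] := boolP (p%:Z %| y')%Z; last exact: residue_of_conic h1.
  have hz : (p%:Z %| z')%Z.
    rewrite -Euclid_dvdzX // (_ : z' ^+ 2 = (z' ^+ 2 - b' * y' ^+ 2) + b' * y' * y'); last by ring.
    by rewrite rpredD // dvdz_mull.
  case/negP: hn'; rewrite hy hz !andbT.
  have : (p%:Z ^+ 2 %| p%:Z * (a' * x' ^+ 2))%Z.
    rewrite (_ : p%:Z * _ = z' ^+ 2 - b' * y' ^+ 2 - (z' ^+ 2 - p%:Z * a' * x' ^+ 2 - b' * y' ^+ 2)); last by ring.
    by rewrite rpredB // rpredB ?dvdz_exp2r // dvdz_mull // dvdz_exp2r.
  by rewrite expr2 dvdz_mul2l // Euclid_dvdzM // Euclid_dvdzX // (negbTE ha').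
move: i j {ea eb} hE hE1 => [] [] /=; rewrite ?expn0 ?expn1 ?mul1r => hE hE1.
- rewrite (hsMl pp op np0 nu (mulf_neq0 np0 nv)) !(hsMr pp op _ np0 nv) // [hs p u p]hsC (hs_prime pp op uu) (hs_prime pp op uv) (hs_unit pp uu uv) addbF.
  rewrite {1}/hs (upart_prime pp).1 (upart_prime pp).2 nonres1 //= -!nonresM ?Euclid_dvdzM ?negb_or ?nm1 //.
  (* Both valuations odd: [p] divides [z], hence also [u * x ^+ 2 + v * y ^+ 2], and [- u * v] is a
     residue. *)
  have hz : (p%:Z %| z)%Z.
    rewrite -Euclid_dvdzX // (_ : z ^+ 2 = (z ^+ 2 - p%:Z * u * x ^+ 2 - p%:Z * v * y ^+ 2) + (u * x ^+ 2 + v * y ^+ 2) * p%:Z); last by ring.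
    by rewrite rpredD // dvdz_mull.
  have h2 : (p%:Z %| u * x ^+ 2 + v * y ^+ 2)%Z.
    have : (p%:Z ^+ 2 %| p%:Z * (u * x ^+ 2 + v * y ^+ 2))%Z.
      rewrite (_ : p%:Z * _ = z ^+ 2 - (z ^+ 2 - p%:Z * u * x ^+ 2 - p%:Z * v * y ^+ 2)); last by ring.
      by rewrite rpredB // dvdz_exp2r.
    by rewrite expr2 dvdz_mul2l.
  apply: (@residue_of_conic p _ y (u * x)) => //.
  + by rewrite !Euclid_dvdzM ?negb_or ?nm1 ?uu ?uv.
  + apply: contra hn => hy; rewrite hy hz andbT /=.
    have : (p%:Z %| u * x ^+ 2)%Z.
      rewrite (_ : u * x ^+ 2 = (u * x ^+ 2 + v * y ^+ 2) - v * y * y); last by ring.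
      by rewrite rpredB // dvdz_mull.
    by rewrite Euclid_dvdzM // Euclid_dvdzX // (negbTE uu) andbT.
  + rewrite (_ : _ - _ = u * (u * x ^+ 2 + v * y ^+ 2)); last by ring.
    by rewrite dvdz_mull.
- rewrite hsMl // hs_prime // hs_unit // addbF.
  exact: mixed uu uv hn hE.
- rewrite hsC hsMl // hs_prime // hs_unit // addbF.
  apply: (mixed v u y x z) => //; first by apply: contra hn => /and3P[-> -> ->].
  by rewrite addrAC.
- by rewrite hs_unit.
Qed.

(** The first equation times [d3] reads d3 a1 t^2 + d2 d3 u2^2 = (d3 u3)^2, and [d2 * d3] lies in
    the square class of [d1]; the factors [d1] and [w] in the witness clear denominators. *)
Lemma lsol_conic p a1 a2 a3 d1 d2 d3 w : prime p -> d1 != 0 -> d2 != 0 -> d3 != 0 ->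
  d1 * d2 * d3 = w ^+ 2 -> lsol p a1 a2 a3 d1 d2 d3 -> csol p (d3 * a1) d1.
Proof.
move=> pp n1 n2 n3 hw h.
have nw : w != 0.
  apply/eqP => w0; move: hw; rewrite w0 expr0n /= => /eqP.
  by rewrite !mulf_eq0 (negbTE n1) (negbTE n2) (negbTE n3).
pose K := d1 * d3 * w; have nK : K != 0 by rewrite !mulf_neq0.
pose f := (logn p `|d1|).+2; pose C := (logn p `|K|).+1.
have nd (x y : int) : x * y = K -> ~~ ((p%:Z) ^+ C %| x)%Z.
  by move=> e; apply: contra (not_pow_dvd pp nK) => hx; rewrite -[X in (_ %| X)%Z]e dvdz_mulr.
exists (f + C)%N => e.
have [t [u1 [u2 [u3 [hn [h1 h2 h3]]]]]] := lsol_primitive pp h (e + 2 * f)%N.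
exists (t * d1), (u2 * w), (u3 * (d1 * d3)); split; last first.
  rewrite (_ : _ - _ = - (d1 ^+ 2 * d3) * (a1 * t ^+ 2 - d3 * u3 ^+ 2) - d1 * u2 ^+ 2 * w ^+ 2); last by ring.
  rewrite -hw (_ : _ - _ = - (d1 ^+ 2 * d3) * (a1 * t ^+ 2 + d2 * u2 ^+ 2 - d3 * u3 ^+ 2)); last by ring.
  by rewrite dvdz_mull //; apply: pow_dvd_le h1; rewrite leq_addr.
(* The new coordinates omit [u1]. If [t], [u2], [u3] were all divisible by [p ^ f], the second
   equation would make [p] divide [u1] too, [f] being larger than the valuation of [d1]. *)
apply/negP => /and3P[ht hu2 hu3].
have cl (x k y : int) : k * y = K -> (p%:Z ^+ (f + C) %| x * k)%Z -> (p%:Z ^+ f %| x)%Z.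
  by move=> ek hx; apply/negPn; apply: contraL hx => hx; apply: not_pow_dvdM => //; apply: nd ek.
have {}ht : (p%:Z ^+ f %| t)%Z by apply: (@cl t d1 (d3 * w)) ht; rewrite /K; ring.
have {}hu2 : (p%:Z ^+ f %| u2)%Z by apply: (@cl u2 w (d1 * d3)) hu2; rewrite /K; ring.
have {}hu3 : (p%:Z ^+ f %| u3)%Z by apply: (@cl u3 (d1 * d3) w) hu3; rewrite /K; ring.
case/negP: hn; rewrite (pow_dvd1 _ ht) // (pow_dvd1 _ hu2) // (pow_dvd1 _ hu3) //= andbT.
have : (p%:Z ^+ (f + f) %| d1 * u1 ^+ 2)%Z.
  rewrite (_ : d1 * u1 ^+ 2 = a2 * t ^+ 2 + d3 * u3 ^+ 2 - (a2 * t ^+ 2 + d3 * u3 ^+ 2 - d1 * u1 ^+ 2)); last by ring.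
  rewrite rpredB //.
    by rewrite exprD -!expr2 rpredD // dvdz_mull // dvdz_exp2r.
  by apply: pow_dvd_le h2; rewrite mul2n addnn leq_addl.
move=> hh; apply/negPn; apply: contraL hh => hu1.
have := not_pow_dvdM (a := (logn p `|d1|).+1) (b := 2) pp (not_pow_dvd pp n1) (y := u1 ^+ 2).
have h' : ~~ (p%:Z ^+ 2 %| u1 ^+ 2)%Z.
  by rewrite expr2 (not_pow_dvdM (a := 1) (b := 1)).
move=> /(_ h'); apply: contra; apply: pow_dvd_le.
by rewrite /f; lia.
Qed.

Lemma lsol_hs p a1 a2 a3 d1 d2 d3 w : prime p -> odd p -> a1 != 0 -> d1 != 0 -> d2 != 0 -> d3 != 0 ->
  d1 * d2 * d3 = w ^+ 2 -> lsol p a1 a2 a3 d1 d2 d3 -> hs p (d3 * a1) d1 = false.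
Proof.
move=> pp op na n1 n2 n3 hw h; apply: csol_hs => //; first by rewrite mulf_neq0.
exact: lsol_conic hw h.
Qed.

Lemma sqfree_neq0 d : sqfree d -> d != 0. Proof. by case. Qed.

Lemma sqfree_dvd d p : sqfree d -> prime p -> (p%:Z %| d)%Z ->
  exists2 d' : int, d = p%:Z * d' & ~~ (p%:Z %| d')%Z.
Proof.
move=> [nd sf] pp /dvdzP[d' e]; exists d'; first by rewrite mulrC.
apply/negP => /dvdzP[c e']; apply: (sf p pp).
by rewrite e e' -mulrA dvdz_mull // PoszM mulrC dvdz_mull.
Qed.

(** The product has even valuation, and each squarefree factor contributes at most 1. *)
Lemma square_triple_dvd d1 d2 d3 w p : sqfree d1 -> sqfree d2 -> sqfree d3 -> prime p ->
  d1 * d2 * d3 = w ^+ 2 -> (p%:Z %| d1)%Z ->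
  ((p%:Z %| d2)%Z && ~~ (p%:Z %| d3)%Z) || (~~ (p%:Z %| d2)%Z && (p%:Z %| d3)%Z).
Proof.
move=> s1 s2 s3 pp hw h1.
have np0 : (p%:Z : int) != 0 by rewrite eqz_nat -lt0n prime_gt0.
have [d1' e1 n1] := sqfree_dvd s1 pp h1.
have /dvdzP[w' ew] : (p%:Z %| w)%Z by rewrite -Euclid_dvdzX // -hw -mulrA dvdz_mulr.
have e : d1' * (d2 * d3) = p%:Z * w' ^+ 2.
  by apply: (mulfI np0); move: hw; rewrite e1 ew => hw; transitivity ((p%:Z * d1') * d2 * d3); [ring|rewrite hw; ring].
have : (p%:Z %| d1' * (d2 * d3))%Z by rewrite e dvdz_mulr.
rewrite !Euclid_dvdzM // (negbTE n1) /=.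
have [h2|h2] := boolP (p%:Z %| d2)%Z; have [h3|h3] := boolP (p%:Z %| d3)%Z => //= _.
have [d2' e2 n2] := sqfree_dvd s2 pp h2; have [d3' e3 n3] := sqfree_dvd s3 pp h3.
have e' : p%:Z * (d1' * d2' * d3') = w' ^+ 2.
  by apply: (mulfI np0); rewrite -e e2 e3; ring.
have /dvdzP[w2 ew2] : (p%:Z %| w')%Z by rewrite -Euclid_dvdzX // -e' dvdz_mulr.
have : (p%:Z %| d1' * d2' * d3')%Z.
  by apply/dvdzP; exists (w2 ^+ 2); apply: (mulfI np0); rewrite e' ew2; ring.
by rewrite !Euclid_dvdzM // (negbTE n1) (negbTE n2) (negbTE n3).
Qed.

(** [a2] and [a3] are, up to sign, the differences between the first root and the others, so [d1]
    can ramify only where one of them vanishes. Concretely, if [p] divided [d1] it would divide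
    exactly one of [d2], [d3], and the equations modulo [p ^ 2] would make it divide all four
    coordinates. *)
Lemma lsol_unit1 p a1 a2 a3 d1 d2 d3 w : prime p -> sqfree d1 -> sqfree d2 -> sqfree d3 ->
  d1 * d2 * d3 = w ^+ 2 -> ~~ (p%:Z %| a2)%Z -> ~~ (p%:Z %| a3)%Z ->
  lsol p a1 a2 a3 d1 d2 d3 -> ~~ (p%:Z %| d1)%Z.
Proof.
move=> pp s1 s2 s3 hw na2 na3 h; apply/negP => h1.
have np0 : (p%:Z : int) != 0 by rewrite eqz_nat -lt0n prime_gt0.
have [d1' e1 n1] := sqfree_dvd s1 pp h1.
have [t [u1 [u2 [u3 [hn [E1 E2 E3]]]]]] := lsol_primitive pp h 2.
have sq2 (c x : int) : (p%:Z %| x)%Z -> (p%:Z ^+ 2 %| c * x ^+ 2)%Z.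
  by move=> hx; rewrite dvdz_mull // dvdz_exp2r.
have fromE (c x R : int) : ~~ (p%:Z %| c)%Z -> (p%:Z ^+ 2 %| c * x ^+ 2 + p%:Z * R)%Z -> (p%:Z %| x)%Z.
  move=> nc hh; have : (p%:Z %| c * x ^+ 2)%Z.
    rewrite (_ : _ * _ = c * x ^+ 2 + p%:Z * R - R * p%:Z); last by ring.
    by rewrite rpredB ?dvdz_mull // (pow_dvd1 _ hh).
  by rewrite Euclid_dvdzM // Euclid_dvdzX // (negbTE nc).
have fromE2 (c x R : int) : ~~ (p%:Z %| c)%Z -> (p%:Z ^+ 2 %| R)%Z ->
    (p%:Z ^+ 2 %| R + p%:Z * c * x ^+ 2)%Z -> (p%:Z %| x)%Z.
  move=> nc hR hh; have : (p%:Z ^+ 2 %| p%:Z * (c * x ^+ 2))%Z.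
    rewrite (_ : _ * _ = R + p%:Z * c * x ^+ 2 - R); last by ring.
    by rewrite rpredB.
  by rewrite expr2 dvdz_mul2l // Euclid_dvdzM // Euclid_dvdzX // (negbTE nc).
have nN (c : int) : ~~ (p%:Z %| c)%Z -> ~~ (p%:Z %| - c)%Z by rewrite rpredN.
case/orP: (square_triple_dvd s1 s2 s3 pp hw h1) => /andP[h2 h3].
- have [d2' e2 n2] := sqfree_dvd s2 pp h2.
  have ht : (p%:Z %| t)%Z.
    by apply: (fromE a3 _ (d1' * u1 ^+ 2 - d2' * u2 ^+ 2)) => //; move: E3; rewrite e1 e2; congr (_ %| _)%Z; ring.
  have /dvdzP[t' et] := ht.
  have hu3 : (p%:Z %| u3)%Z.
    apply: (fromE d3 _ (a2 * t' * t - d1' * u1 ^+ 2)) => //; move: E2; rewrite e1 et; congr (_ %| _)%Z; ring.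
  have hu1 : (p%:Z %| u1)%Z.
    have R2 : (p%:Z ^+ 2 %| a2 * t ^+ 2 + d3 * u3 ^+ 2)%Z by rewrite rpredD ?sq2.
    apply: (fromE2 (- d1') _ _ (nN _ n1) R2).
    by move: E2; rewrite e1; congr (_ %| _)%Z; ring.
  have hu2 : (p%:Z %| u2)%Z.
    have R2 : (p%:Z ^+ 2 %| a3 * t ^+ 2 + d1 * u1 ^+ 2)%Z by rewrite rpredD ?sq2.
    apply: (fromE2 (- d2') _ _ (nN _ n2) R2).
    by move: E3; rewrite e2; congr (_ %| _)%Z; ring.
  by move: hn; rewrite ht hu1 hu2 hu3.
- have [d3' e3 n3] := sqfree_dvd s3 pp h3.
  have ht : (p%:Z %| t)%Z.
    by apply: (fromE a2 _ (d3' * u3 ^+ 2 - d1' * u1 ^+ 2)) => //; move: E2; rewrite e1 e3; congr (_ %| _)%Z; ring.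
  have /dvdzP[t' et] := ht.
  have hu2 : (p%:Z %| u2)%Z.
    apply: (fromE (- d2) _ (a3 * t' * t + d1' * u1 ^+ 2)); rewrite ?nN //; move: E3; rewrite e1 et; congr (_ %| _)%Z; ring.
  have hu1 : (p%:Z %| u1)%Z.
    have R2 : (p%:Z ^+ 2 %| a3 * t ^+ 2 - d2 * u2 ^+ 2)%Z by rewrite rpredB ?sq2.
    apply: (fromE2 d1' _ _ n1 R2).
    by move: E3; rewrite e1; congr (_ %| _)%Z; ring.
  have hu3 : (p%:Z %| u3)%Z.
    have R2 : (p%:Z ^+ 2 %| a2 * t ^+ 2 - d1 * u1 ^+ 2)%Z by rewrite rpredB ?sq2.
    apply: (fromE2 d3' _ _ n3 R2).
    by move: E2; rewrite e3; congr (_ %| _)%Z; ring.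
  by move: hn; rewrite ht hu1 hu2 hu3.
Qed.

(** * Primes of good reduction and primes dividing n *)

Lemma quadchar_sqrt (F : finFieldType) (x : F) : quadchar x != -1 -> exists y, y ^+ 2 = x.
Proof.
have [->|nx] := eqVneq x 0; first by exists 0; rewrite expr0n.
case: (quadchar_val nx) => q; last by rewrite q.
by have [y _ hy] := quadcharP q; exists y.
Qed.

(** The two-character analogue of [three_quadchar]: the weighted number of values [s] of
    [a * x ^+ 2] with [c - s] of the form [b * y ^+ 2] is [#|F|] minus a sign, hence positive. *)
Lemma binary_represent (F : finFieldType) (a b c : F) : (2%:R : F) != 0 ->
  a != 0 -> b != 0 -> c != 0 -> exists x y, a * x ^+ 2 + b * y ^+ 2 = c.
Proof.
move=> n2 na nb nc.
pose f (a c x : F) := 1 + quadchar (a * (x + c)).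
have f0 k l x : 0 <= f k l x.
  rewrite /f; have [->|h] := eqVneq (k * (x + l)) 0; first by rewrite quadchar0.
  by case: (quadchar_val h) => ->.
have hsum : 0 < \sum_x f a 0 x * f (- b) (- c) x.
  have -> : \sum_x f a 0 x * f (- b) (- c) x = \sum_(x : F) 1 + \sum_x quadchar (a * (x + 0))
    + \sum_x quadchar (- b * (x + - c)) + \sum_x quadchar (a * (x + 0)) * quadchar (- b * (x + - c)).
    by rewrite -!big_split; apply: eq_bigr => x _; rewrite /f /=; ring.
  rewrite !sum_quadchar_affine // sum_quadchar2 ?[0 == - c]eq_sym ?oppr_eq0 //.
  rewrite sumr_const natz (eq_card (B := F)) //.
  have := finNzRing_gt1 F.
  have nab : a * - b != 0 by rewrite mulf_neq0 ?oppr_eq0.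
  case: (quadchar_val nab) => -> h1; rewrite !addr0; first by rewrite subr_gt0 ltz_nat.
  by rewrite opprK ltzD1.
have [s hs|hno] := pickP (fun x => 0 < f a 0 x * f (- b) (- c) x).
  have /quadchar_sqrt[y hy] : quadchar (a * (s + 0)) != -1.
    by apply: contraTneq hs => h; rewrite /f h subrr mul0r ltxx.
  have /quadchar_sqrt[z hz] : quadchar (- b * (s + - c)) != -1.
    by apply: contraTneq hs => h; rewrite /f h subrr mulr0 ltxx.
  exists (y / a), (z / b).
  by rewrite !expr_div_n hy hz; field; rewrite na nb.
suff : \sum_x f a 0 x * f (- b) (- c) x <= 0 by lia.
by apply: sumr_le0 => x _; have := hno x; lia.
Qed.

Lemma binary_represent_mod p (a b c : int) : prime p -> odd p ->
  ~~ (p%:Z %| a)%Z -> ~~ (p%:Z %| b)%Z -> ~~ (p%:Z %| c)%Z ->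
  exists x y : int, (p%:Z %| a * x ^+ 2 + b * y ^+ 2 - c)%Z.
Proof.
move=> pp op; rewrite -!Fp_eq0 // => na nb nc.
have [x [y e]] := binary_represent (Fp_two pp op) na nb nc.
exists (x : nat)%:Z, (y : nat)%:Z; rewrite -Fp_eq0 //.
by rewrite rmorphB rmorphD !expr2 !rmorphM /= -!Fp_int -!expr2 e subrr.
Qed.

Lemma sqp_of_square p r k : prime p -> odd p -> ~~ (p%:Z %| r)%Z -> (p%:Z %| k ^+ 2 - r)%Z -> sqp p r.
Proof.
move=> pp op hr h; apply: sqp_odd => //; apply: (@residue_of_conic p _ 1 k) => //.
  by case: (prime_ndvd1 pp).
by rewrite expr1n mulr1.
Qed.

Section TorsionPoints.
Variables (p : nat) (a1 a2 a3 d1 d2 d3 : int).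
Hypotheses (pp : prime p) (ha : a1 + a2 + a3 = 0).
Hypotheses (n1 : d1 != 0) (n2 : d2 != 0) (n3 : d3 != 0).

Lemma lsol_trivial : sqp p d1 -> sqp p d2 -> sqp p d3 -> lsol p a1 a2 a3 d1 d2 d3.
Proof.
move=> s1 s2 s3; apply: (@lsol_square p a1 a2 a3 1 1 1); rewrite ?mul1r //.
by apply: (@lsol_exact p _ _ _ _ _ _ 0 1 1 1); rewrite ?oner_eq0 //; ring.
Qed.

(** The point (t, u1, u2, u3) = (1, 1, 1, 0) over a 2-torsion point; the coefficient [d3] is
    multiplied by zero, so its square class does not enter. *)
Lemma lsol_u3 : sqp p (a2 * d1) -> sqp p (- a1 * d2) -> lsol p a1 a2 a3 d1 d2 d3.
Proof.
move=> s1 s2; apply: (@lsol_square p a1 a2 a3 a2 (- a1) d3) => //; last first.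
  by rewrite -expr2; apply: sqp_sqr.
apply: (@lsol_exact p _ _ _ _ _ _ 1 1 1 0); rewrite ?oner_eq0 //; try ring.
by rewrite -ha; ring.
Qed.
End TorsionPoints.

Lemma lsol_u1 p a1 a2 a3 d1 d2 d3 : prime p -> a1 + a2 + a3 = 0 -> d1 != 0 -> d2 != 0 -> d3 != 0 ->
  sqp p (a3 * d2) -> sqp p (- a2 * d3) -> lsol p a1 a2 a3 d1 d2 d3.
Proof.
by move=> pp ha n1 n2 n3 s1 s2; do 2 apply: lsol_cyc; apply: lsol_u3 => //; rewrite -ha; ring.
Qed.

Lemma lsol_u2 p a1 a2 a3 d1 d2 d3 : prime p -> a1 + a2 + a3 = 0 -> d1 != 0 -> d2 != 0 -> d3 != 0 ->
  sqp p (a1 * d3) -> sqp p (- a3 * d1) -> lsol p a1 a2 a3 d1 d2 d3.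
Proof.
by move=> pp ha n1 n2 n3 s1 s2; apply: lsol_cyc; apply: lsol_u3 => //; rewrite -ha; ring.
Qed.

Lemma nonres_mod p u v : prime p -> (p%:Z %| u - v)%Z -> nonres p u = nonres p v.
Proof. by move=> pp h; rewrite /nonres (leg_mod pp h). Qed.

Lemma unit_mod p u v : (p%:Z %| u - v)%Z -> ~~ (p%:Z %| v)%Z -> ~~ (p%:Z %| u)%Z.
Proof.
by move=> h; apply: contra => hu; rewrite -[v](subKr u) rpredB.
Qed.

Lemma sqp_mod p u v : prime p -> odd p -> (p%:Z %| u - v)%Z -> ~~ (p%:Z %| v)%Z ->
  nonres p u = false -> sqp p v.
Proof. by move=> pp op h hv hu; apply: sqp_odd => //; rewrite -(nonres_mod pp h). Qed.

(** With t = 1, a value [s] of d3 u3^2 is sought for which [d1 * (s + a2)], [d2 * (s - a1)] and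
    [d3 * s] are squares modulo [p], zero allowed. [three_quadchar] supplies it unless all three
    [d]s are residues, when the point with t = 0 serves; if one of the three values vanishes modulo
    [p], a 2-torsion point takes over. *)
Lemma lsol_good p a1 a2 a3 d1 d2 d3 w : prime p -> odd p ->
  ~~ (p%:Z %| a1)%Z -> ~~ (p%:Z %| a2)%Z -> ~~ (p%:Z %| a3)%Z -> a1 + a2 + a3 = 0 ->
  ~~ (p%:Z %| d1)%Z -> ~~ (p%:Z %| d2)%Z -> ~~ (p%:Z %| d3)%Z -> d1 * d2 * d3 = w ^+ 2 ->
  lsol p a1 a2 a3 d1 d2 d3.
Proof.
move=> pp op na1 na2 na3 ha u1 u2 u3 hw.
have nz (x : int) : ~~ (p%:Z %| x)%Z -> x != 0 by apply: contraNneq => ->; rewrite dvdz0.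
have [/and3P[/negbTE r1 /negbTE r2 /negbTE r3]|hn] := boolP [&& ~~ nonres p d1, ~~ nonres p d2 & ~~ nonres p d3].
  by apply: lsol_trivial; rewrite ?nz //; apply: sqp_odd.
have cond : quadchar (d1%:~R * d2%:~R * d3%:~R : 'F_p) = 1.
  rewrite -!rmorphM /= hw rmorphXn /= quadchar_sqr ?Fp_two // Fp_eq0 //.
  by rewrite -Euclid_dvdzX // -hw !Euclid_dvdzM // !negb_or u1 u2 u3.
have lq (u : int) : ~~ (p%:Z %| u)%Z -> (quadchar (u%:~R : 'F_p) == 1) = ~~ nonres p u.
  by move=> hu; rewrite /nonres -[quadchar _]/(leg p u); case: (leg_val pp hu) => ->.
have [|||||||s0 [c1 c2 c3]] := @three_quadchar 'F_p (Fp_two pp op) d1%:~R d2%:~R d3%:~R a2%:~R (- a1)%:~R 0.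
- by rewrite -subr_eq0 -rmorphB /= Fp_eq0 // opprK addrC (_ : a1 + a2 = - a3) ?rpredN // -[RHS]add0r -ha addrK.
- by rewrite Fp_eq0 // rpredN.
- by rewrite Fp_eq0.
- by rewrite Fp_eq0.
- by rewrite Fp_eq0.
- exact: cond.
- by rewrite !lq.
pose s : int := (s0 : nat)%:Z.
have hc (d a : int) : quadchar (d%:~R * (s0 + a%:~R) : 'F_p) != -1 -> nonres p (d * (s + a)) = false.
  by rewrite [s0]Fp_int -rmorphD -rmorphM /= => /negbTE.
have {}c1 := hc _ _ c1; have {}c2 := hc _ _ c2.
have {}c3 : nonres p (d3 * s) = false by rewrite -[s]addr0; apply: hc; rewrite rmorph0.
have md (d x y : int) : (p%:Z %| x - y)%Z -> (p%:Z %| d * x - d * y)%Z by move=> h; rewrite -mulrBr dvdz_mull.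
have um (x y : int) : ~~ (p%:Z %| x)%Z -> ~~ (p%:Z %| y)%Z -> ~~ (p%:Z %| x * y)%Z.
  by move=> hx hy; rewrite Euclid_dvdzM // negb_or hx.
have [z1|z1] := boolP (p%:Z %| s)%Z.
  apply: lsol_u3; rewrite ?nz //.
    by apply: (@sqp_mod p (d1 * (s + a2))); rewrite ?um // [a2 * d1]mulrC md // addrK.
  by apply: (@sqp_mod p (d2 * (s + - a1))); rewrite ?um ?rpredN // [- a1 * d2]mulrC md // addrK.
have [z2|z2] := boolP (p%:Z %| s + a2)%Z.
  apply: lsol_u1; rewrite ?nz //.
    apply: (@sqp_mod p (d2 * (s + - a1))); rewrite ?um // [a3 * d2]mulrC md //.
    by rewrite (_ : s + _ - _ = s + a2 - (a1 + a2 + a3)); [rewrite ha subr0|ring].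
  by apply: (@sqp_mod p (d3 * s)); rewrite ?um ?rpredN // [- a2 * d3]mulrC md // opprK.
have [z3|z3] := boolP (p%:Z %| s + - a1)%Z.
  apply: lsol_u2; rewrite ?nz //.
    by apply: (@sqp_mod p (d3 * s)); rewrite ?um // [a1 * d3]mulrC md.
  apply: (@sqp_mod p (d1 * (s + a2))); rewrite ?um ?rpredN // [- a3 * d1]mulrC md //.
  by rewrite (_ : s + _ - _ = s - a1 + (a1 + a2 + a3)); [rewrite ha addr0|ring].
apply: (@lsol_square p a1 a2 a3 (s + a2) (s - a1) s); rewrite ?nz //.
- apply: (@lsol_exact p _ _ _ _ _ _ 1 1 1 1); rewrite ?oner_eq0 //; try ring.
  by rewrite -ha; ring.
- by rewrite mulrC; apply: sqp_odd; rewrite ?um.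
- by rewrite mulrC; apply: sqp_odd; rewrite ?um.
- by rewrite mulrC; apply: sqp_odd; rewrite ?um.
Qed.

Lemma hs_pu_unit p u v : prime p -> odd p -> ~~ (p%:Z %| u)%Z -> ~~ (p%:Z %| v)%Z ->
  hs p (p%:Z * u) v = nonres p v.
Proof.
move=> pp op hu hv.
have np0 : (p%:Z : int) != 0 by rewrite eqz_nat -lt0n prime_gt0.
have nz (x : int) : ~~ (p%:Z %| x)%Z -> x != 0 by apply: contraNneq => ->; rewrite dvdz0.
by rewrite (hsMl pp op np0 (nz _ hu) (nz _ hv)) hs_prime // hs_unit // addbF.
Qed.

Lemma hs_pu_pv p u v : prime p -> odd p -> ~~ (p%:Z %| u)%Z -> ~~ (p%:Z %| v)%Z ->
  hs p (p%:Z * u) (p%:Z * v) = nonres p (-1) (+) nonres p u (+) nonres p v.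
Proof.
move=> pp op hu hv.
have np0 : (p%:Z : int) != 0 by rewrite eqz_nat -lt0n prime_gt0.
have nz (x : int) : ~~ (p%:Z %| x)%Z -> x != 0 by apply: contraNneq => ->; rewrite dvdz0.
rewrite (hsMr pp op (mulf_neq0 np0 (nz _ hu)) np0 (nz _ hv)) (hs_pu_unit pp op hu hv) hsC.
rewrite (hsMr pp op np0 np0 (nz _ hu)) (hs_prime pp op hu) {1}/hs (upart_prime pp).1 (upart_prime pp).2.
by rewrite nonres1.
Qed.

(** All three coefficients have valuation 1, so the local image is that of the 2-torsion. Which of
    [d1], [d3] are divisible by [p] singles out one torsion point, and the two symbol relations
    supply the residue conditions that match the class with it. *)
Lemma lsol_bad p e1 e2 e3 n n' d1 d2 d3 w : prime p -> odd p ->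
  ~~ (p%:Z %| e1)%Z -> ~~ (p%:Z %| e2)%Z -> ~~ (p%:Z %| e3)%Z -> e1 + e2 + e3 = 0 ->
  n = p%:Z * n' -> ~~ (p%:Z %| n')%Z ->
  sqfree d1 -> sqfree d2 -> sqfree d3 -> d1 * d2 * d3 = w ^+ 2 ->
  hs p d1 (- (e1 * e2) * n ^+ 2) = hs p d3 (e2 * n) ->
  hs p d1 (- (e2 * n)) = hs p d3 (- (e2 * e3) * n ^+ 2) ->
  lsol p (e1 * n) (e2 * n) (e3 * n) d1 d2 d3.
Proof.
move=> pp op u1 u2 u3 hsum en un s1 s2 s3 hw J1 J2.
have np0 : (p%:Z : int) != 0 by rewrite eqz_nat -lt0n prime_gt0.
have nz (x : int) : ~~ (p%:Z %| x)%Z -> x != 0 by apply: contraNneq => ->; rewrite dvdz0.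
have [n1 nm1] := prime_ndvd1 pp.
have [z1 z2 z3] : [/\ d1 != 0, d2 != 0 & d3 != 0] by split; apply: sqfree_neq0.
have nn : n != 0 by rewrite en; apply: (mulf_neq0 np0 (nz _ un)).
have ha : e1 * n + e2 * n + e3 * n = 0 by rewrite -!mulrDl hsum mul0r.
have um (x y : int) : ~~ (p%:Z %| x)%Z -> ~~ (p%:Z %| y)%Z -> ~~ (p%:Z %| x * y)%Z.
  by move=> hx hy; rewrite Euclid_dvdzM // negb_or hx.
have NM (x y : int) := @nonresM p x y pp op.
have sqpp (x y k : int) : x * y = k * p%:Z ^+ 2 -> ~~ (p%:Z %| k)%Z -> nonres p k = false -> sqp p (x * y).
  by move=> -> hk rk; apply: sqpM => //; [exact: sqp_odd|exact: sqp_sqr].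
have sqn (k d : int) : ~~ (p%:Z %| k)%Z -> d != 0 -> hs p d (k * n ^+ 2) = hs p d k.
  by move=> hk hd; rewrite hsC (hs_sqr pp op (nz _ hk) nn hd) hsC.
have um3 (x y : int) : ~~ (p%:Z %| x)%Z -> ~~ (p%:Z %| y)%Z -> ~~ (p%:Z %| -1 * x * y)%Z by move=> hx hy; rewrite !um.
have {}J1 : hs p d1 (-1 * e1 * e2) = hs p d3 (p%:Z * (e2 * n')).
  rewrite -(sqn _ _ (um3 _ _ u1 u2) z1) (_ : -1 * e1 * e2 = - (e1 * e2)); last by ring.
  by rewrite J1 en; congr (hs _ _ _); ring.
have {}J2 : hs p d1 (p%:Z * (-1 * e2 * n')) = hs p d3 (-1 * e2 * e3).
  rewrite -(sqn _ _ (um3 _ _ u2 u3) z3) (_ : -1 * e2 * e3 = - (e2 * e3)); last by ring.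
  by rewrite -J2 en; congr (hs _ _ _); ring.
have sq (x : int) : nonres p (x ^+ 2) = false \/ (p%:Z %| x)%Z.
  have [h|h] := boolP (p%:Z %| x)%Z; [by right|left].
  by rewrite expr2 NM // addbb.
have t1 := square_triple_dvd s1 s2 s3 pp hw.
have t2 : (p%:Z %| d2)%Z -> (p%:Z %| d1)%Z || (p%:Z %| d3)%Z.
  move=> h; have := @square_triple_dvd d2 d1 d3 w p s2 s1 s3 pp; rewrite [d2 * d1]mulrC => /(_ hw h).
  by case/orP => /andP[? ?]; apply/orP; [left|right].
have t3 : (p%:Z %| d3)%Z -> ((p%:Z %| d1)%Z && ~~ (p%:Z %| d2)%Z) || (~~ (p%:Z %| d1)%Z && (p%:Z %| d2)%Z).
  by move=> h; apply: (@square_triple_dvd d3 d1 d2 w p) => //; rewrite -hw; ring.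
have [h1|h1] := boolP (p%:Z %| d1)%Z; have [h3|h3] := boolP (p%:Z %| d3)%Z.
- have [x1 E1 v1] := sqfree_dvd s1 pp h1; have [x3 E3 v3] := sqfree_dvd s3 pp h3.
  move: J1 J2; rewrite {1 2}E1 {1 2}E3 !hs_pu_pv ?um // !hs_pu_unit ?um // => I1 I2.
  apply: lsol_u2 => //.
    apply: (@sqpp _ _ (e1 * n' * x3)); rewrite ?um //; first by rewrite E3 en; ring.
    by move: I1; rewrite !NM ?um //; bcase.
  apply: (@sqpp _ _ (-1 * e3 * n' * x1)); rewrite ?um //; first by rewrite E1 en; ring.
  by move: I2; rewrite !NM ?um //; bcase.
- have [x1 E1 v1] := sqfree_dvd s1 pp h1.
  have h2 : (p%:Z %| d2)%Z by move: (t1 h1); rewrite (negbTE h3) andbF orbF => /andP[].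
  have [x2 E2 v2] := sqfree_dvd s2 pp h2.
  have /dvdzP[w' ew] : (p%:Z %| w)%Z by rewrite -Euclid_dvdzX // -hw -mulrA dvdz_mulr.
  have e : x1 * x2 * d3 = w' ^+ 2.
    apply: (mulfI np0); apply: (mulfI np0).
    transitivity (d1 * d2 * d3); [by rewrite E1 E2; ring|by rewrite hw ew; ring].
  have er : nonres p (x1 * x2 * d3) = false.
    rewrite e; case: (sq w') => // hw'; have : (p%:Z %| x1 * x2 * d3)%Z by rewrite e Euclid_dvdzX.
    by rewrite (negbTE (um _ _ (um _ _ v1 v2) h3)).
  move: J1 J2; rewrite {1 2}E1 hs_pu_pv ?um // hs_pu_unit ?um // [hs p d3 (p%:Z * _)]hsC hs_pu_unit ?um // hs_unit ?um // => I1 I2.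
  apply: lsol_u3 => //.
    apply: (@sqpp _ _ (e2 * n' * x1)); rewrite ?um //; first by rewrite E1 en; ring.
    by move: I2; rewrite !NM ?um //; bcase.
  apply: (@sqpp _ _ (-1 * e1 * n' * x2)); rewrite ?um //; first by rewrite E2 en; ring.
  by move: I1 I2 er; rewrite !NM ?um //; bcase.
- have [x3 E3 v3] := sqfree_dvd s3 pp h3.
  have h2 : (p%:Z %| d2)%Z by move: (t3 h3); rewrite (negbTE h1) /=.
  have [x2 E2 v2] := sqfree_dvd s2 pp h2.
  have /dvdzP[w' ew] : (p%:Z %| w)%Z by rewrite -Euclid_dvdzX // -hw dvdz_mull.
  have e : d1 * x2 * x3 = w' ^+ 2.
    apply: (mulfI np0); apply: (mulfI np0).
    transitivity (d1 * d2 * d3); [by rewrite E3 E2; ring|by rewrite hw ew; ring].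
  have er : nonres p (d1 * x2 * x3) = false.
    rewrite e; case: (sq w') => // hw'; have : (p%:Z %| d1 * x2 * x3)%Z by rewrite e Euclid_dvdzX.
    by rewrite (negbTE (um _ _ (um _ _ h1 v2) v3)).
  move: J1 J2; rewrite {1 2}E3 hs_pu_pv ?um // [hs p d1 (p%:Z * _)]hsC !hs_pu_unit ?um // hs_unit ?um // => I1 I2.
  apply: lsol_u1 => //.
    apply: (@sqpp _ _ (e3 * n' * x2)); rewrite ?um //; first by rewrite E2 en; ring.
    by move: I1 I2 er; rewrite !NM ?um //; bcase.
  apply: (@sqpp _ _ (-1 * e2 * n' * x3)); rewrite ?um //; first by rewrite E3 en; ring.
  by move: I1; rewrite !NM ?um //; bcase.
- have h2 : ~~ (p%:Z %| d2)%Z by apply/negP => /t2; rewrite (negbTE h1) (negbTE h3).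
  move: J1 J2; rewrite ![hs p _ (p%:Z * _)]hsC !hs_pu_unit ?um // ![hs p _ (_ * _)]hs_unit ?um // => I1 I2.
  have er : nonres p (d1 * d2 * d3) = false.
    rewrite hw; case: (sq w) => // hw'; have : (p%:Z %| d1 * d2 * d3)%Z by rewrite hw Euclid_dvdzX.
    by rewrite (negbTE (um _ _ (um _ _ h1 h2) h3)).
  apply: lsol_trivial => //; apply: sqp_odd => //.
  by move: er; rewrite !NM ?um // -I1 I2; bcase.
Qed.

(** * Primes of multiplicative reduction *)

Section MultiplicativePrime.
Variables (q : nat) (a1 a2 a3 : int).
Hypotheses (pq : prime q) (oq : odd q).
Hypotheses (ha1 : (q%:Z %| a1)%Z) (ha2 : ~~ (q%:Z %| a2)%Z) (ha3 : ~~ (q%:Z %| a3)%Z).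
Hypothesis ha : a1 + a2 + a3 = 0.

Let um (x y : int) : ~~ (q%:Z %| x)%Z -> ~~ (q%:Z %| y)%Z -> ~~ (q%:Z %| x * y)%Z.
Proof. by move=> hx hy; rewrite Euclid_dvdzM // negb_or hx. Qed.

Let nz (x : int) : ~~ (q%:Z %| x)%Z -> x != 0.
Proof. by apply: contraNneq => ->; rewrite dvdz0. Qed.

(** Modulo [q] the second and third roots coincide, so u2 = u3 = 1 leaves the single equation y^2 -
    a2 t^2 = c. If [q] divides [y], then [- a2 * c] is a residue and the point with u1 = 0 is used,
    as [a3] is congruent to [- a2]. *)
Lemma lsol_node c : ~~ (q%:Z %| c)%Z -> lsol q a1 a2 a3 1 c c.
Proof.
move=> hc; have [n1 nm1] := prime_ndvd1 pq.
have [|y [t h]] := @binary_represent_mod q 1 (- a2) c pq oq n1 _ hc; first by rewrite rpredN.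
have na : ~~ (q%:Z %| - a2 * c)%Z by rewrite um ?rpredN.
have [hy|hy] := boolP (q%:Z %| y)%Z.
  have s2 : sqp q (- a2 * c).
    apply: (@sqp_of_square q _ (a2 * t)) => //.
    rewrite (_ : _ - _ = - a2 * (1 * y ^+ 2 + - a2 * t ^+ 2 - c) + a2 * y * y); last by ring.
    exact: dvdz_lin.
  apply: lsol_u1; rewrite ?nz //.
  apply: (@sqp_of_square q _ (a2 * t)); rewrite ?um //.
  have -> : a3 = - a2 - a1 by rewrite -[LHS]addr0 -oppr0 -ha; ring.
  rewrite (_ : _ - _ = - a2 * (1 * y ^+ 2 + - a2 * t ^+ 2 - c) + (a2 * y * y + c * a1)); last by ring.
  by rewrite rpredD ?dvdz_mull // rpredD // dvdz_mull.
have hs1 : (q%:Z %| y ^+ 2 - (c + a2 * t ^+ 2))%Z.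
  by move: h; congr (_ %| _)%Z; ring.
have hu : ~~ (q%:Z %| c + a2 * t ^+ 2)%Z.
  by apply: (@unit_mod q _ (y ^+ 2)); rewrite ?Euclid_dvdzX // -opprB rpredN.
apply: (@lsol_square q a1 a2 a3 (c + a2 * t ^+ 2) (c - a1 * t ^+ 2) c); rewrite ?nz //.
- apply: (@lsol_exact q _ _ _ _ _ _ t 1 1 1); rewrite ?oner_eq0 ?orbT //; try ring.
  by rewrite -[RHS](mul0r (t ^+ 2)) -ha; ring.
- by rewrite mulr1; apply: (sqp_of_square pq oq hu hs1).
- apply: (@sqp_of_square q _ c) => //.
    apply: (@unit_mod q _ (c * c)); rewrite ?um //.
    by rewrite (_ : _ - _ = - (t ^+ 2 * c) * a1); [rewrite dvdz_mull|ring].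
  by rewrite (_ : _ - _ = (t ^+ 2 * c) * a1); [rewrite dvdz_mull|ring].
- by rewrite -expr2; apply: sqp_sqr; rewrite ?nz.
Qed.

(** Units are norms from the unramified algebra obtained by adjoining a square root of [d]. [ga] is
    a denominator: it equals [d] when [q] divides [x], where a purely imaginary element has the
    required norm. *)
Lemma norm_represent d u : ~~ (q%:Z %| d)%Z -> ~~ (q%:Z %| u)%Z -> forall e,
  exists al be ga : int, ~~ (q%:Z %| ga)%Z /\ (q%:Z ^+ e %| al ^+ 2 - d * be ^+ 2 - u * ga ^+ 2)%Z.
Proof.
move=> hd hu e; have [n1 nm1] := prime_ndvd1 pq.
have [|x [y h]] := @binary_represent_mod q 1 (- d) u pq oq n1 _ hu; first by rewrite rpredN.
have [hx|hx] := boolP (q%:Z %| x)%Z.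
  have hud : ~~ (q%:Z %| - u * d)%Z by rewrite um ?rpredN.
  have r : nonres q (- u * d) = false.
    apply: (@residue_of_conic q _ 1 (d * y)) => //.
    rewrite expr1n mulr1 (_ : _ - _ = - d * (1 * x ^+ 2 + - d * y ^+ 2 - u) + d * x * x); last by ring.
    exact: dvdz_lin.
  have [b hb hE] := hensel_odd pq oq hud r e.
  exists 0, b, d; split=> //.
  by rewrite (_ : _ - _ = - d * (b ^+ 2 - - u * d)); [rewrite dvdz_mull|ring].
have h1 : (q%:Z %| x ^+ 2 - (u + d * y ^+ 2))%Z by move: h; congr (_ %| _)%Z; ring.
have hv : ~~ (q%:Z %| u + d * y ^+ 2)%Z.
  by apply: (@unit_mod q _ (x ^+ 2)); rewrite ?Euclid_dvdzX // -opprB rpredN.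
have r : nonres q (u + d * y ^+ 2) = false.
  by apply: (@residue_of_conic q _ 1 x) => //; rewrite expr1n mulr1.
have [b hb hE] := hensel_odd pq oq hv r e.
exists b, y, 1; split=> //.
by move: hE; congr (_ %| _)%Z; ring.
Qed.

(* Away from the smooth case, a solution has [t] and [u1] units and the two terms
   [d2 u2^2], [d3 u3^2] divisible by [q].  An element of norm [u] of
   [Q_q(sqrt d1)] multiplies the binary form [d2 u2^2 - d3 u3^2] by [u] and
   leaves [a2 t^2] unchanged modulo [q], so that Hensel's lemma restores [u1]. *)
Lemma lsol_twist d1 d2 d3 w u : sqfree d1 -> sqfree d2 -> sqfree d3 -> d1 * d2 * d3 = w ^+ 2 ->
  ~~ (q%:Z %| u)%Z -> lsol q a1 a2 a3 d1 d2 d3 -> lsol q a1 a2 a3 d1 (u * d2) (u * d3).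
Proof.
move=> s1 s2 s3 hw hu h.
have hd1 := lsol_unit1 pq s1 s2 s3 hw ha2 ha3 h.
have [z1 z2 z3] : [/\ d1 != 0, d2 != 0 & d3 != 0] by split; apply: sqfree_neq0.
have nw : w != 0.
  apply/eqP => w0; move: hw; rewrite w0 expr0n /= => /eqP.
  by rewrite !mulf_eq0 (negbTE z1) (negbTE z2) (negbTE z3).
have t3 : (q%:Z %| d3)%Z -> (q%:Z %| d2)%Z.
  move=> h3; have := @square_triple_dvd d3 d1 d2 w q s3 s1 s2 pq; rewrite (negbTE hd1) /= => -> //.
  by rewrite -hw; ring.
have t2 : (q%:Z %| d2)%Z -> (q%:Z %| d3)%Z.
  move=> h2; have := @square_triple_dvd d2 d1 d3 w q s2 s1 s3 pq; rewrite (negbTE hd1) /= => -> //.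
  by rewrite -hw; ring.
have n2 : nonres q (w ^+ 2) = false \/ (q%:Z %| w)%Z.
  have [|hw'] := boolP (q%:Z %| w)%Z; [by right|left].
  by rewrite expr2 nonresM // addbb.
(* If [d3] is a unit and [d1] a residue, the twisted class is (1, u d3, u d3) up to local squares,
   and the node provides a point. *)
have [/andP[h3 r1]|hII] := boolP (~~ (q%:Z %| d3)%Z && ~~ nonres q d1).
  have h2 : ~~ (q%:Z %| d2)%Z by apply: contra h3 => /t2.
  have hn := lsol_node (um hu h3).
  apply: (@lsol_square q a1 a2 a3 1 (u * d3) (u * d3)) => //; rewrite ?mulf_neq0 ?nz //.
  - by rewrite mul1r; apply: sqp_odd => //; apply: negbTE.
  - rewrite (_ : _ * _ = d2 * d3 * u ^+ 2); last by ring.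
    apply: sqpM => //; last by apply: sqp_sqr; rewrite ?nz.
    apply: sqp_odd; rewrite ?um // nonresM //.
    case: n2 => [|hw']; first by rewrite -hw !nonresM ?um // (negbTE r1).
    have : (q%:Z %| d1 * d2 * d3)%Z by rewrite hw Euclid_dvdzX.
    by rewrite (negbTE (um (um hd1 h2) h3)).
  - by rewrite -expr2; apply: sqp_sqr; rewrite ?mulf_neq0 ?nz.
exists (logn q `|w|).+1 => e.
have [t [u1 [u2 [u3 [hn [E1 E2 E3]]]]]] := lsol_primitive pq h e.+2.
have E1q := pow_dvd1 (ltn0Sn _) E1; have E2q := pow_dvd1 (ltn0Sn _) E2.
(* Otherwise either [q] divides both [d2] and [d3], or [d1] is a nonresidue; then the form d2 u2^2 -
   d3 u3^2 is anisotropic modulo [q], and the first equation makes [q] divide [u2] and [u3]. *)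
have divs : [/\ (q%:Z %| d2 * u2)%Z, (q%:Z %| d3 * u3)%Z & (q%:Z %| w * u2)%Z].
  have [h3|h3] := boolP (q%:Z %| d3)%Z.
    have h2 := t3 h3; have hw' : (q%:Z %| w)%Z by rewrite -Euclid_dvdzX // -hw dvdz_mull.
    by rewrite !dvdz_mulr.
  have r1 : nonres q d1 by move: hII; rewrite h3 /= negbK.
  have h2 : ~~ (q%:Z %| d2)%Z by apply: contra h3 => /t2.
  have hwq : ~~ (q%:Z %| w)%Z by rewrite -Euclid_dvdzX // -hw !um.
  have r23 : nonres q (d2 * d3).
    case: n2 => [|hw']; last by rewrite hw' in hwq.
    by rewrite -hw -mulrA nonresM ?um // r1 => /negbT; rewrite negbK.
  have E1' : (q%:Z %| (d2 * u2) ^+ 2 - d2 * d3 * u3 ^+ 2)%Z.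
    rewrite (_ : _ - _ = d2 * (a1 * t ^+ 2 + d2 * u2 ^+ 2 - d3 * u3 ^+ 2) + - (d2 * t ^+ 2) * a1); last by ring.
    exact: dvdz_lin.
  have hu3 : (q%:Z %| u3)%Z.
    apply/negPn/negP => hu3; move: r23.
    by rewrite (residue_of_conic pq oq _ hu3 E1') // um.
  have hu2 : (q%:Z %| u2)%Z.
    have : (q%:Z %| (d2 * u2) ^+ 2)%Z.
      rewrite (_ : _ ^+ 2 = (d2 * u2) ^+ 2 - d2 * d3 * u3 ^+ 2 + d2 * d3 * u3 * u3); last by ring.
      by rewrite rpredD // dvdz_mull.
    by rewrite Euclid_dvdzX // Euclid_dvdzM // (negbTE h2).
  by rewrite !dvdz_mull.
case: divs => D2 D3 Dw.
have E2' : (q%:Z %| a2 * t ^+ 2 - d1 * u1 ^+ 2)%Z.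
  rewrite (_ : _ - _ = a2 * t ^+ 2 + d3 * u3 ^+ 2 - d1 * u1 ^+ 2 - u3 * (d3 * u3)); last by ring.
  by rewrite rpredB // dvdz_mull.
have ht : ~~ (q%:Z %| t)%Z.
  apply/negP => ht.
  have hu1 : (q%:Z %| u1)%Z.
    have : (q%:Z %| d1 * u1 ^+ 2)%Z.
      rewrite (_ : _ * _ = a2 * t * t - (a2 * t ^+ 2 - d1 * u1 ^+ 2)); last by ring.
      by rewrite rpredB // dvdz_mull.
    by rewrite Euclid_dvdzM // Euclid_dvdzX // (negbTE hd1).
  have sq2 (c x : int) : (q%:Z %| x)%Z -> (q%:Z ^+ 2 %| c * x ^+ 2)%Z.
    by move=> hx; rewrite dvdz_mull // dvdz_exp2r.
  have sf (d x : int) : sqfree d -> (q%:Z ^+ 2 %| d * x ^+ 2)%Z -> (q%:Z %| x)%Z.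
    move=> [_ sd] hx; apply/negPn/negP => nx.
    have nx2 : ~~ (q%:Z ^+ 2 %| d)%Z by apply/negP; move: (sd q pq); rewrite -mulnn PoszM -expr2.
    have cop : coprimez (q%:Z ^+ 2) (x ^+ 2).
      by rewrite coprimezXl // coprimezXr // coprimezE /= prime_coprime.
    by move: hx; rewrite mulrC Gauss_dvdzr // (negbTE nx2).
  have e2 := pow_dvd_le (isT : (2 <= e.+2)%N) E2; have e3 := pow_dvd_le (isT : (2 <= e.+2)%N) E3.
  case/negP: hn; rewrite ht hu1 /=; apply/andP; split.
    apply: (sf d2 _ s2); rewrite (_ : _ * _ = a3 * t ^+ 2 + d1 * u1 ^+ 2 - (a3 * t ^+ 2 + d1 * u1 ^+ 2 - d2 * u2 ^+ 2)); last by ring.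
    by rewrite rpredB // rpredD ?sq2.
  apply: (sf d3 _ s3); rewrite (_ : _ * _ = (a2 * t ^+ 2 + d3 * u3 ^+ 2 - d1 * u1 ^+ 2) - (a2 * t ^+ 2 - d1 * u1 ^+ 2)); last by ring.
  by rewrite rpredB // rpredB ?sq2.
have [al [be [ga [hga N]]]] := norm_represent hd1 hu e.
(* Up to the factor [d1 ^+ 2 * w ^+ 2], [T0] is the value required of d1 u1^2 after the twist. Since
   [d1 * T0] is congruent to the square of [d1 * u1 * u * ga], it has a root to every precision. *)
pose T0 := a2 * (u * ga * t) ^+ 2 + u * (d3 * al ^+ 2 * u3 ^+ 2 + 2 * al * be * w * u2 * u3 + be ^+ 2 * d1 * d2 * u2 ^+ 2).
have hT : (q%:Z %| (d1 * u1 * u * ga) ^+ 2 - d1 * T0)%Z.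
  rewrite (_ : _ - _ = - (d1 * (u * ga) ^+ 2) * (a2 * t ^+ 2 - d1 * u1 ^+ 2) +
    - (d1 * u) * (al ^+ 2 * u3 * (d3 * u3) + 2 * al * be * u3 * (w * u2) + be ^+ 2 * d1 * u2 * (d2 * u2))); last by rewrite /T0; ring.
  by apply: dvdz_lin => //; apply: rpredD; [apply: rpredD|]; apply: dvdz_mull.
have hu1 : ~~ (q%:Z %| u1)%Z.
  apply/negP => hu1; have : (q%:Z %| a2 * t ^+ 2)%Z.
    rewrite (_ : _ * _ = a2 * t ^+ 2 - d1 * u1 ^+ 2 + d1 * u1 * u1); last by ring.
    by rewrite rpredD // dvdz_mull.
  by rewrite Euclid_dvdzM // Euclid_dvdzX // (negbTE ha2) (negbTE ht).
have uT : ~~ (q%:Z %| d1 * T0)%Z.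
  apply: (@unit_mod q _ ((d1 * u1 * u * ga) ^+ 2)); first by rewrite -opprB rpredN.
  by rewrite Euclid_dvdzX // !um.
have rT : nonres q (d1 * T0) = false.
  by apply: (residue_of_conic pq oq uT (prime_ndvd1 pq).1 (z := d1 * u1 * u * ga)); rewrite expr1n mulr1.
have [y hy Y] := hensel_odd pq oq uT rT e.
(* The last two entries are the pair ([u2], [u3]) multiplied by al + be sqrt(d1); [w] and [d1] clear
   denominators. *)
exists (d1 * u * w * ga * t), (w * y), (d1 * (al * w * u2 + be * d1 * d3 * u3)), (d1 * (al * w * u3 + be * d1 * d2 * u2)).
have F1 : (q%:Z ^+ e %| a1 * (d1 * u * w * ga * t) ^+ 2 + u * d2 * (d1 * (al * w * u2 + be * d1 * d3 * u3)) ^+ 2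
   - u * d3 * (d1 * (al * w * u3 + be * d1 * d2 * u2)) ^+ 2)%Z.
  rewrite (_ : _ - _ = d1 ^+ 2 * (u * ga * w) ^+ 2 * (a1 * t ^+ 2 + d2 * u2 ^+ 2 - d3 * u3 ^+ 2)
    + (u * d1 ^+ 2 * (d2 * u2 ^+ 2 - d3 * u3 ^+ 2)) * (w ^+ 2 * (al ^+ 2 - u * ga ^+ 2) - d1 * d2 * d3 * d1 * be ^+ 2)); last by ring.
  apply: dvdz_lin; first by apply: pow_dvd_le E1; rewrite -addn2 leq_addr.
  rewrite hw (_ : _ - _ = w ^+ 2 * (al ^+ 2 - d1 * be ^+ 2 - u * ga ^+ 2)); last by ring.
  by rewrite dvdz_mull.
have F2 : (q%:Z ^+ e %| a2 * (d1 * u * w * ga * t) ^+ 2 + u * d3 * (d1 * (al * w * u3 + be * d1 * d2 * u2)) ^+ 2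
   - d1 * (w * y) ^+ 2)%Z.
  rewrite (_ : _ - _ = d1 ^+ 2 * w ^+ 2 * (a2 * (u * ga * t) ^+ 2 + u * d3 * al ^+ 2 * u3 ^+ 2)
    + (u * d1 ^+ 2) * (d1 * d2 * d3) * (2 * al * be * w * u2 * u3 + be ^+ 2 * d1 * d2 * u2 ^+ 2)
    - d1 * w ^+ 2 * y ^+ 2); last by ring.
  rewrite hw (_ : _ - _ = - (d1 * w ^+ 2) * (y ^+ 2 - d1 * T0)); last by rewrite /T0; ring.
  by rewrite dvdz_mull.
split.
  apply/negP => /and4P[hh _ _ _]; have := not_pow_dvd pq nw; apply/negP/negPn.
  have cop : coprimez (q%:Z ^+ (logn q `|w|).+1) (d1 * u * ga * t).
    by rewrite coprimezXl // coprimezE /= prime_coprime // -[(_ %| _)%N]/(q%:Z %| _)%Z !um.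
  rewrite -(Gauss_dvdzr _ cop); move: hh; congr (_ %| _)%Z; ring.
split=> //.
(* The third equation is minus the sum of the first two. *)
rewrite -rpredN; have -> : a3 = - a1 - a2 by rewrite -[LHS]addr0 -oppr0 -ha; ring.
move: (rpredD F1 F2); congr (_ %| _)%Z; ring.
Qed.

End MultiplicativePrime.

(** * The places 2 and infinity *)

Lemma sqr_odd8 (u : int) : ~~ (2 %| u)%Z -> (u ^+ 2 %% 8)%Z = 1.
Proof.
by move=> /odd_dvd2; rewrite !inE expr2 -modzMml -modzMmr => /or4P[]/eqP ->.
Qed.

Lemma odd_decomp (d : int) : ~~ (2 %| d)%Z -> exists k, d = 2 * k + 1.
Proof. by move=> h; exists (d %/ 2)%Z; lia. Qed.

Lemma double_odd (a : int) : (2 %| a)%Z -> ~~ (4 %| a)%Z -> exists2 b, a = 2 * b & ~~ (2 %| b)%Z.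
Proof. by move=> h h4; exists (a %/ 2)%Z; lia. Qed.

Lemma odd_mul (x y : int) : ~~ (2 %| x)%Z -> ~~ (2 %| y)%Z -> ~~ (2 %| x * y)%Z.
Proof. by move=> hx hy; rewrite (Euclid_dvdzM _ _ (isT : prime 2)) negb_or hx. Qed.

Lemma eps4_sqr (w : int) : ~~ (2 %| w)%Z -> eps4 (w ^+ 2) = false.
Proof. by move=> hw; rewrite expr2 eps4M // addbb. Qed.

Lemma even_congr (a T d d' U U' : int) : (2 %| a)%Z -> ~~ (2 %| d)%Z -> ~~ (2 %| d')%Z ->
  (4 %| a * T + d * U ^+ 2 - d' * U' ^+ 2)%Z -> (2 %| U)%Z = (2 %| U')%Z.
Proof.
move=> /dvdzP[b ->] /odd_decomp[k ->] /odd_decomp[k' ->] h.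
have p2 : prime 2 by [].
rewrite -(Euclid_dvdzX U p2) -(Euclid_dvdzX U' p2).
by move: (U ^+ 2) (U' ^+ 2) h => V V' h; lia.
Qed.

(** Modulo 4 a primitive solution has [u1], [u2], [u3] of equal parity, and they are odd since
    otherwise [t] would be even too, [a1] being twice an odd number. As 4 divides [a3], the third
    equation makes [d1] and [d2] congruent modulo 4, and the odd square product gives [d3]. *)
Lemma lsol_two_eps4 a1 a2 a3 d1 d2 d3 w : (2 %| a1)%Z -> ~~ (4 %| a1)%Z -> (2 %| a2)%Z -> (4 %| a3)%Z ->
  ~~ (2 %| d1)%Z -> ~~ (2 %| d2)%Z -> ~~ (2 %| d3)%Z -> d1 * d2 * d3 = w ^+ 2 ->
  lsol 2 a1 a2 a3 d1 d2 d3 -> eps4 d3 = false.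
Proof.
move=> h1 h1' h2 h3 o1 o2 o3 hw h.
have p2 : prime 2 by [].
have hwo : ~~ (2 %| w)%Z by rewrite -(Euclid_dvdzX w p2) -hw !odd_mul.
suff e : eps4 d1 = eps4 d2.
  by have := eps4_sqr hwo; rewrite -hw !eps4M ?odd_mul // e addbb.
have [t [u1 [u2 [u3 [hn [E1 E2 E3]]]]]] := lsol_primitive p2 h 2.
rewrite (_ : (2%N%:Z ^+ 2 : int) = 4) // in E1 E2 E3.
have c23 := even_congr h1 o2 o3 E1; have c31 := even_congr h2 o3 o1 E2.
have [ev|od] := boolP (2 %| u2)%Z.
  case/negP: hn; rewrite -c31 -c23 ev !andbT -(Euclid_dvdzX t p2).
  have [b eb ob] := double_odd h1 h1'.
  have /dvdzP[v2 e2] := ev; have /dvdzP[v3 e3] : (2 %| u3)%Z by rewrite -c23.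
  have [k ek] := odd_decomp ob.
  move: E1; rewrite e2 e3 eb ek.
  rewrite (_ : _ - _ = 4 * (k * t ^+ 2 + d2 * v2 ^+ 2 - d3 * v3 ^+ 2) + 2 * t ^+ 2); last by ring.
  by move: (k * t ^+ 2 + d2 * v2 ^+ 2 - d3 * v3 ^+ 2) (t ^+ 2); clear=> X T; lia.
have o1' : ~~ (2 %| u1)%Z by rewrite -c31 -c23.
have [k1 ek1] := odd_decomp o1; have [k2 ek2] := odd_decomp o2; have [b3 eb3] := dvdzP h3.
have s1 := sqr_odd8 o1'; have s2 := sqr_odd8 od.
rewrite /eps4 ek1 ek2; rewrite ek1 ek2 eb3 in E3.
by move: (u1 ^+ 2) (u2 ^+ 2) (t ^+ 2) s1 s2 E3 => U1 U2 T s1 s2 E3; clear -s1 s2 E3; lia.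
Qed.

Lemma mod8_double (b d : int) : ((2 * b + d) %% 8)%Z = ((2 * (b %% 4)%Z + (d %% 8)%Z) %% 8)%Z.
Proof. lia. Qed.

(** [r1], [r3] are [d1], [d3] modulo 8 and [c1], [c2] are [a1 / 2], [a2 / 2] modulo 4. The premise
    says that [d3] is 1 modulo 4 and that two conic symbols vanish; the last line says that [d1] is
    [a2 + d3] and [d2] is [d3 - a1] modulo 8, with [4 - c1] standing for [- c1]. *)
Definition two_residue_check (r1 r3 c1 c2 : int) : bool :=
  let r2 := (r1 * r3 %% 8)%Z in
  ~~ eps4 r3 && ~~ (omega8 r1 (+) (eps4 c1 && eps4 r1)) &&
  ~~ ((eps4 r1 && eps4 r2) (+) (omega8 r2 (+) (eps4 c2 && eps4 r2))) ==>
  [&& r1 == 1, r2 == 1 & r3 == 1] ||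
  (r1 == ((2 * c2 + r3) %% 8)%Z) && (r2 == ((2 * (4 - c1) + r3) %% 8)%Z).

Lemma two_residues r1 r3 c1 c2 : r1 \in [:: 1; 3; 5; 7] -> r3 \in [:: 1; 3; 5; 7] ->
  c1 \in [:: 1; 3] -> c2 \in [:: 1; 3] -> two_residue_check r1 r3 c1 c2.
Proof.
have /allP h : all (fun r1 => all (fun r3 => all (fun c1 => all (two_residue_check r1 r3 c1) [:: 1; 3])
  [:: 1; 3]) [:: 1; 3; 5; 7]) [:: 1; 3; 5; 7] by vm_compute.
by move=> /h/allP h1 /h1/allP h3 /h3/allP h4 /h4.
Qed.

Lemma eps4_mod8 d : eps4 (d %% 8)%Z = eps4 d.
Proof. by rewrite /eps4; congr (_ == _); lia. Qed.

Lemma eps4_mod4 d : eps4 (d %% 4)%Z = eps4 d.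
Proof. by rewrite /eps4 modz_mod. Qed.

Lemma omega8_mod8 d : omega8 (d %% 8)%Z = omega8 d.
Proof. by rewrite /omega8 modz_mod. Qed.

(** By the residue check either all three components are 2-adic squares, or, after changing [d1] and
    [d2] by 2-adic squares, the point (1, 1, 1, 1) lies on the covering. *)
Lemma lsol_two a1 a2 a3 d1 d2 d3 w : (2 %| a1)%Z -> ~~ (4 %| a1)%Z -> (2 %| a2)%Z -> ~~ (4 %| a2)%Z ->
  a1 + a2 + a3 = 0 ->
  ~~ (2 %| d1)%Z -> ~~ (2 %| d2)%Z -> ~~ (2 %| d3)%Z -> d1 * d2 * d3 = w ^+ 2 ->
  eps4 d3 = false -> hs2 (d3 * a1) d1 = false -> hs2 (d1 * a2) d2 = false ->
  lsol 2 a1 a2 a3 d1 d2 d3.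
Proof.
move=> h1 h1' h2 h2' ha o1 o2 o3 hw e3.
have p2 : prime 2 by [].
have nz (x : int) : ~~ (2 %| x)%Z -> x != 0 by apply: contraNneq => ->; rewrite dvdz0.
have [b1 eb1 ob1] := double_odd h1 h1'; have [b2 eb2 ob2] := double_odd h2 h2'.
have w8 : (w ^+ 2 %% 8)%Z = 1.
  by apply: sqr_odd8; rewrite -(Euclid_dvdzX w p2) -hw !odd_mul.
have d2e : (d2 %% 8)%Z = ((d1 %% 8)%Z * (d3 %% 8)%Z %% 8)%Z.
  move: w8; rewrite -hw -modzMml -[(d1 * d2 %% 8)%Z]modzMml -modzMmr -[X in (X * _ %% _)%Z]modzMmr.
  have := odd_dvd2 o1; have := odd_dvd2 o2; have := odd_dvd2 o3.
  by rewrite !inE => /or4P[]/eqP -> /or4P[]/eqP -> /or4P[]/eqP ->.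
have n2 : (2 : int) != 0 by [].
have [[z1 z2 z3] [y1 y2]] := (And3 (nz _ o1) (nz _ o2) (nz _ o3), conj (nz _ ob1) (nz _ ob2)).
move=> H1 H2.
have {}H1 : omega8 d1 (+) (eps4 b1 && eps4 d1) = false.
  by move: H1; rewrite eb1 !hs2Ml ?mulf_neq0 // hs2_2 // !hs2_odd // e3.
have {}H2 : (eps4 d1 && eps4 d2) (+) (omega8 d2 (+) (eps4 b2 && eps4 d2)) = false.
  by move: H2; rewrite eb2 !hs2Ml ?mulf_neq0 // hs2_2 // !hs2_odd.
have sq8 (x y : int) : ~~ (2 %| x)%Z -> (x %% 8)%Z = (y %% 8)%Z -> sqp 2 (x * y).
  move=> ox e; apply: sqp_two; rewrite -modzMml -modzMmr -e.
  by have := odd_dvd2 ox; rewrite !inE => /or4P[]/eqP ->.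
have cases : [/\ (d1 %% 8)%Z = 1, (d2 %% 8)%Z = 1 & (d3 %% 8)%Z = 1] \/
  ((d1 %% 8)%Z = ((2 * b2 + d3) %% 8)%Z /\ (d2 %% 8)%Z = ((2 * - b1 + d3) %% 8)%Z).
  have hb (b : int) : ~~ (2 %| b)%Z -> (b %% 4)%Z \in [:: 1; 3] by rewrite !inE; clear; lia.
  have := two_residues (odd_dvd2 o1) (odd_dvd2 o3) (hb _ ob1) (hb _ ob2).
  rewrite /two_residue_check -d2e !eps4_mod8 !eps4_mod4 !omega8_mod8 e3 H1 H2 /=.
  case/orP => [/and3P[/eqP ? /eqP ? /eqP ?]|/andP[/eqP -> /eqP ->]]; [by left|right].
  by rewrite mod8_double; split=> //; clear; lia.
case: cases => [[f1 f2 f3]|[f1 f2]].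
  by apply: lsol_trivial => //; apply: sqp_two.
have {}f1 : (d1 %% 8)%Z = ((a2 + d3) %% 8)%Z by rewrite eb2.
have {}f2 : (d2 %% 8)%Z = ((d3 - a1) %% 8)%Z by rewrite f2 eb1; congr (modz _ _); ring.
apply: (@lsol_square 2 a1 a2 a3 (a2 + d3) (d3 - a1) d3) => //.
- apply: (@lsol_exact 2 _ _ _ _ _ _ 1 1 1 1); rewrite ?oner_eq0 //; try ring.
  by rewrite -ha; ring.
- by rewrite mulrC; apply: sq8.
- by rewrite mulrC; apply: sq8.
- exact: sq8.
Qed.

(* Signs ([true] for negative) of the four classes of real points, one for each
   2-torsion point. *)
Definition real_signs (A1 A2 A3 D1 D2 D3 : bool) : bool :=
  [|| [&& ~~ D1, ~~ D2 & ~~ D3], (D1 == A2) && (D2 != A1), (D3 != A2) && (D2 == A3)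
    | (D3 == A1) && (D1 != A3)].

Module RealPlace.
Import Reals Lra.
Local Open Scope R_scope.

Definition conics (A1 A2 A3 D1 D2 D3 t u1 u2 u3 : R) : Prop :=
    ~ (t = 0 /\ u1 = 0 /\ u2 = 0 /\ u3 = 0) /\
    A1 * (t * t) + D2 * (u2 * u2) - D3 * (u3 * u3) = 0 /\
    A2 * (t * t) + D3 * (u3 * u3) - D1 * (u1 * u1) = 0 /\
    A3 * (t * t) + D1 * (u1 * u1) - D2 * (u2 * u2) = 0.

Definition has_sign (x : R) (s : bool) : Prop := if s then x < 0 else 0 < x.

Lemma sign_mul x s y : has_sign x s -> 0 < y -> has_sign (x * y) s.
Proof. by case: s => /= hx hy; nra. Qed.

Lemma sign_mulW x s y : has_sign x s -> 0 <= y -> if s then x * y <= 0 else 0 <= x * y.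
Proof. by case: s => /= hx hy; nra. Qed.

Lemma sign_mul0 x s y : has_sign x s -> x * y = 0 -> y = 0.
Proof. by case: s => /= hx hy; destruct (Rmult_integral _ _ hy); lra. Qed.

Lemma conics_signs A1 A2 A3 D1 D2 D3 sa1 sa2 sa3 s1 s2 s3 t u1 u2 u3 :
  has_sign A1 sa1 -> has_sign A2 sa2 -> has_sign A3 sa3 ->
  has_sign D1 s1 -> has_sign D2 s2 -> has_sign D3 s3 -> addb (addb s1 s2) s3 = false ->
  conics A1 A2 A3 D1 D2 D3 t u1 u2 u3 -> real_signs sa1 sa2 sa3 s1 s2 s3.
Proof.
move=> a1 a2 a3 h1 h2 h3 hs [hn [E1 [E2 E3]]].
have sq x : 0 <= x * x by nra.
have X1 := sign_mulW h1 (sq u1); have X2 := sign_mulW h2 (sq u2); have X3 := sign_mulW h3 (sq u3).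
apply/negPn/negP => hr.
(* With [t] nonzero, the signs of the six terms contradict the failure of [real_signs]; with [t]
   zero, the same enumeration kills the remaining terms. *)
have t0 : t * t = 0.
  destruct (Rle_lt_or_eq_dec 0 (t * t) (sq t)) as [ht|ht]; last by [].
  exfalso; have Y1 := sign_mul a1 ht; have Y2 := sign_mul a2 ht; have Y3 := sign_mul a3 ht.
  move: Y1 Y2 Y3 X1 X2 X3 E1 E2 E3.
  move: (A1 * (t * t)) (A2 * (t * t)) (A3 * (t * t)) (D1 * (u1 * u1)) (D2 * (u2 * u2)) (D3 * (u3 * u3)).
  move: sa1 sa2 sa3 s1 s2 s3 hs hr {a1 a2 a3 h1 h2 h3} => [] [] [] [] [] [] //= _ _; intros; lra.
have K : D1 * (u1 * u1) = 0 /\ D2 * (u2 * u2) = 0 /\ D3 * (u3 * u3) = 0.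
  rewrite t0 in E1 E2 E3; move: X1 X2 X3 E1 E2 E3.
  move: (D1 * (u1 * u1)) (D2 * (u2 * u2)) (D3 * (u3 * u3)).
  move: sa1 sa2 sa3 s1 s2 s3 hs hr {a1 a2 a3 h1 h2 h3} => [] [] [] [] [] [] //= _ _; intros; repeat split; lra.
case: K => [k1 [k2 k3]]; apply: hn.
have r x : x * x = 0 -> x = 0 by move=> h; case: (Rmult_integral _ _ h).
split; first exact: r.
split; first by apply: r; exact: sign_mul0 h1 k1.
by split; apply: r; [exact: sign_mul0 h2 k2|exact: sign_mul0 h3 k3].
Qed.

Lemma sqrt_ratio x y s : has_sign x s -> has_sign y s -> y * (sqrt (x / y) * sqrt (x / y)) = x.
Proof.
move=> hx hy; have hp : 0 <= x / y.
  move: hx hy; case: s => /= hx hy; last by apply: Rlt_le; apply: Rdiv_lt_0_compat.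
  have -> : x / y = (- x) / (- y) by field; lra.
  apply: Rlt_le; apply: Rdiv_lt_0_compat; lra.
rewrite sqrt_sqrt //; field; move: hy; case: s {hx} => /= hy; lra.
Qed.

Lemma has_signN x s : has_sign x s -> has_sign (- x) (~~ s).
Proof. by case: s => /=; lra. Qed.

Lemma signs_conics A1 A2 A3 D1 D2 D3 sa1 sa2 sa3 s1 s2 s3 :
  has_sign A1 sa1 -> has_sign A2 sa2 -> has_sign A3 sa3 ->
  has_sign D1 s1 -> has_sign D2 s2 -> has_sign D3 s3 -> A1 + A2 + A3 = 0 ->
  real_signs sa1 sa2 sa3 s1 s2 s3 -> exists t u1 u2 u3, conics A1 A2 A3 D1 D2 D3 t u1 u2 u3.
Proof.
move=> a1 a2 a3 h1 h2 h3 hs; case/or4P.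
- case/and3P => /negbTE e1 /negbTE e2 /negbTE e3; rewrite e1 in h1; rewrite e2 in h2; rewrite e3 in h3.
  have h0 : has_sign 1 false by rewrite /=; lra.
  have R1 := sqrt_ratio h0 h1; have R2 := sqrt_ratio h0 h2; have R3 := sqrt_ratio h0 h3.
  exists 0, (sqrt (1 / D1)), (sqrt (1 / D2)), (sqrt (1 / D3)); rewrite /conics R1 R2 R3.
  split; last by repeat split; ring.
  by move=> [_ [z _]]; move: R1; rewrite z; lra.
- case/andP => /eqP e1 e2; rewrite e1 in h1.
  have {}e2 : s2 = ~~ sa1 by move: e2; case: (s2); case: (sa1).
  rewrite e2 in h2.
  exists 1, (sqrt (A2 / D1)), (sqrt (- A1 / D2)), 0; rewrite /conics.
  rewrite (sqrt_ratio a2 h1) (sqrt_ratio (has_signN a1) h2).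
  by split; [lra|repeat split; lra].
- case/andP => e1 /eqP e2; rewrite e2 in h2.
  have {}e1 : s3 = ~~ sa2 by move: e1; case: (s3); case: (sa2).
  rewrite e1 in h3.
  exists 1, 0, (sqrt (A3 / D2)), (sqrt (- A2 / D3)); rewrite /conics.
  rewrite (sqrt_ratio a3 h2) (sqrt_ratio (has_signN a2) h3).
  by split; [lra|repeat split; lra].
- case/andP => /eqP e1 e2; rewrite e1 in h3.
  have {}e2 : s1 = ~~ sa3 by move: e2; case: (s1); case: (sa3).
  rewrite e2 in h1.
  exists 1, (sqrt (- A3 / D1)), 0, (sqrt (A1 / D3)); rewrite /conics.
  rewrite (sqrt_ratio a1 h3) (sqrt_ratio (has_signN a3) h1).
  by split; [lra|repeat split; lra].
Qed.

End RealPlace.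

Lemma IR_sign (a : int) : a != 0 -> RealPlace.has_sign (IR a) (a < 0).
Proof.
case: a => n ha; rewrite /IR /=.
  by apply: (RIneq.IZR_lt BinNums.Z0); case: n ha => // n _; lia.
by apply: (RIneq.IZR_lt _ BinNums.Z0); lia.
Qed.

Lemma IR_add (a b c : int) : a + b + c = 0 ->
  Rdefinitions.Rplus (Rdefinitions.Rplus (IR a) (IR b)) (IR c) = Rdefinitions.IZR BinNums.Z0.
Proof.
move=> h; rewrite /IR -!RIneq.plus_IZR; congr Rdefinitions.IZR.
by case: a h => a h; case: b h => b h; case: c h => c h; cbv beta iota delta [int_to_Z]; lia.
Qed.

Lemma real_solvableP e1 e2 e3 m d1 d2 d3 : e1 + e2 + e3 = 0 ->
  e1 * m != 0 -> e2 * m != 0 -> e3 * m != 0 -> d1 != 0 -> d2 != 0 -> d3 != 0 -> 0 < d1 * d2 * d3 ->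
  D_real_solvable e1 e2 e3 m d1 d2 d3 <->
  real_signs (e1 * m < 0) (e2 * m < 0) (e3 * m < 0) (d1 < 0) (d2 < 0) (d3 < 0).
Proof.
move=> hs n1 n2 n3 m1 m2 m3 hp.
have ha : e1 * m + e2 * m + e3 * m = 0 by rewrite -!mulrDl hs mul0r.
have hd : (d1 < 0) (+) (d2 < 0) (+) (d3 < 0) = false.
  by rewrite -!lt0_mul ?mulf_neq0 //; apply/negbTE; rewrite -leNgt ltW.
split=> [[t [u1 [u2 [u3 h]]]]|h].
  by apply: RealPlace.conics_signs h => //; apply: IR_sign.
by apply: (@RealPlace.signs_conics _ _ _ _ _ _ _ _ _ _ _ _ _ _ _ _ _ _ _ h); try exact: IR_sign; exact: IR_add.
Qed.

(** * Selmer classes and translation by 2-torsion *)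

Lemma prod_primes_logn (a : nat) : (0 < a)%N -> a = (\prod_(p <- primes a) p ^ logn p a)%N.
Proof.
move=> a0; rewrite {1}(prod_prime_decomp a0) prime_decompE big_map.
by apply: eq_bigr.
Qed.

Lemma sqfpartE a : a != 0 -> exists2 c : int, c != 0 & a = sqfpart a * c ^+ 2.
Proof.
move=> na; have a0 : (0 < `|a|)%N by rewrite absz_gt0.
pose c := (\prod_(p <- primes `|a|) p ^ (logn p `|a|)./2)%N.
have e : `|a|%N = ((\prod_(p <- primes `|a|) p ^ (logn p `|a| %% 2)) * (c * c))%N.
  rewrite {1}(prod_primes_logn a0) /c -!big_split; apply: eq_bigr => p _ /=.
  by rewrite -!expnD; congr (_ ^ _)%N; rewrite modn2 addnn odd_double_half.
have nc : c != 0%N.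
  by apply/eqP => c0; move: a0; rewrite e c0 !muln0.
exists c%:Z; first by rewrite eqz_nat.
rewrite /sqfpart -mulrA expr2 -!PoszM -e.
by case: (ltgtP a 0) na => // h _; rewrite ?(gtr0_sg h) ?(ltr0_sg h); lia.
Qed.

Lemma sqfpart_neq0 a : a != 0 -> sqfpart a != 0.
Proof. by move=> na; have [c _ e] := sqfpartE na; apply: contraNneq na => z; rewrite e z mul0r. Qed.

Lemma sqfpart_sqfree a : a != 0 -> sqfree (sqfpart a).
Proof.
move=> na; split=> [|q pq]; first exact: sqfpart_neq0.
rewrite dvdzE /sqfpart abszM /= (_ : `|Num.sg a|%N = 1%N) ?mul1n; last by rewrite absz_sg na.
have cop (r : seq nat) (f : nat -> nat) : all prime r -> q \notin r ->
    coprime (q ^ 2) (\prod_(p <- r) p ^ f p).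
  elim: r => [|p r IH]; first by rewrite big_nil coprimen1.
  rewrite /= inE negb_or big_cons => /andP[pp ar] /andP[nqp nqr].
  rewrite coprimeMr IH // andbT coprimeXl // coprimeXr //.
  by rewrite prime_coprime // dvdn_prime2.
have ap : all prime (primes `|a|) by apply/allP => p; rewrite mem_primes => /andP[].
have q1 := prime_gt1 pq.
have [hq|hq] := boolP (q \in primes `|a|); last first.
  have := cop _ (fun p => (logn p `|a| %% 2)%N) ap hq; rewrite /coprime => /eqP cg dv.
  by move: cg; rewrite (gcdn_idPl dv); nia.
rewrite (bigD1_seq q) ?primes_uniq //= -big_filter => dv.
have c2 := cop [seq p <- primes `|a| | p != q] (fun p => (logn p `|a| %% 2)%N).
have {c2} c2 : coprime (q ^ 2) (\prod_(i <- primes `|a| | i != q) i ^ (logn i `|a| %% 2)).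
  rewrite -big_filter c2 //; first by rewrite all_filter; apply: sub_all ap => x /= ->; rewrite implybT.
  by rewrite mem_filter eqxx.
move: dv; rewrite big_filter Gauss_dvdl // dvdn_Pexp2l //.
by rewrite leqNgt ltnS -ltnS ltn_mod.
Qed.

Lemma vodd_square p (a b c : int) : prime p -> b != 0 -> c != 0 -> a = b * c ^+ 2 -> vodd p a = vodd p b.
Proof.
by move=> pp nb nc ->; rewrite voddM ?expf_neq0 // expr2 voddM // addbb addbF.
Qed.

Lemma sqfree_logn d p : sqfree d -> prime p -> logn p `|d| = vodd p d :> nat.
Proof.
move=> [nd sd] pp; rewrite /vodd; have : (logn p `|d| < 2)%N; last by case: (logn _ _) => [|[]].
rewrite ltnNge -pfactor_dvdn ?absz_gt0 //; apply/negP => h; apply: (sd p pp).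
by rewrite dvdzE.
Qed.

(** A squarefree integer is determined by its sign and its valuations modulo 2, and square factors
    change neither. *)
Lemma sqfree_uniq a b c f : sqfree a -> sqfree b -> c != 0 -> f != 0 -> a * c ^+ 2 = b * f ^+ 2 -> a = b.
Proof.
move=> sa sb nc nf e; have [na nb] := (sqfree_neq0 sa, sqfree_neq0 sb).
have : `|a|%N = `|b|%N.
  apply: eqn_from_log; rewrite ?absz_gt0 // => p.
  have [pp|np] := boolP (prime p); last by rewrite lognE (negbTE np) /= lognE (negbTE np).
  rewrite !sqfree_logn //; congr nat_of_bool.
  by rewrite -(vodd_square pp na nc erefl) e (vodd_square pp nb nf erefl).
have s : (a < 0) = (b < 0).
  have pos (x : int) : x != 0 -> (x ^+ 2 < 0) = false by move=> nx; rewrite ltNge sqr_ge0.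
  have := lt0_mul na (expf_neq0 2 nc); have := lt0_mul nb (expf_neq0 2 nf).
  by rewrite e !pos // !addbF => -> ->.
by move: s; clear; case: (ltP a 0); case: (ltP b 0); lia.
Qed.

Lemma sqfpart_uniq a b c f : sqfree a -> b != 0 -> c != 0 -> f != 0 -> a * c ^+ 2 = b * f ^+ 2 ->
  sqfpart b = a.
Proof.
move=> sa nb nc nf e; have [k nk ek] := sqfpartE nb.
apply: (@sqfree_uniq _ _ (k * f) c) => //; rewrite ?mulf_neq0 //; first exact: sqfpart_sqfree.
by rewrite e {2}ek; ring.
Qed.

Lemma sqfpart_id a : sqfree a -> sqfpart a = a.
Proof. by move=> sa; apply: (@sqfpart_uniq a a 1 1) => //; apply: sqfree_neq0. Qed.

Lemma sqfpartMr a b : a != 0 -> b != 0 -> sqfpart (a * sqfpart b) = sqfpart (a * b).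
Proof.
move=> na nb; have [c nc ec] := sqfpartE nb.
have nab : a * b != 0 by rewrite mulf_neq0.
have [k nk ek] := sqfpartE nab.
apply: (@sqfpart_uniq _ _ k c) => //; first exact: sqfpart_sqfree.
  by rewrite mulf_neq0 ?sqfpart_neq0.
by rewrite -ek {1}ec; ring.
Qed.

Lemma sqp_of_eq p x y k : prime p -> k != 0 -> x * y = k ^+ 2 -> sqp p (x * y).
Proof. by move=> pp nk ->; apply: sqp_sqr. Qed.

Lemma sqp_sqfpart p x : prime p -> x != 0 -> sqp p (x * sqfpart x).
Proof.
move=> pp nx; have [c nc ec] := sqfpartE nx.
rewrite {1}ec (_ : _ * _ = (sqfpart x * c) ^+ 2); last by ring.
by apply: sqp_sqr => //; apply: (mulf_neq0 (sqfpart_neq0 nx) nc).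
Qed.

Lemma square_div (x c w : int) : c != 0 -> x * c ^+ 2 = w ^+ 2 -> exists v, x = v ^+ 2.
Proof.
move=> nc e; have : (c %| w)%Z.
  by rewrite -(@dvdz_pexp2r _ _ 2) // -e dvdz_mull.
case/dvdzP => v ev; exists v; apply: (mulIf (expf_neq0 2 nc)).
by rewrite e ev; ring.
Qed.

Lemma sqfpart_sign a : a != 0 -> (sqfpart a < 0) = (a < 0).
Proof.
move=> na; have [c nc ec] := sqfpartE na.
rewrite [in RHS]ec (lt0_mul (sqfpart_neq0 na) (expf_neq0 2 nc)).
by rewrite (ltNge (c ^+ 2)) sqr_ge0 addbF.
Qed.

Lemma vodd_sqfpart p a : prime p -> a != 0 -> vodd p (sqfpart a) = vodd p a.
Proof.
move=> pp na; have [c nc ec] := sqfpartE na.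
by rewrite [in RHS]ec -(vodd_square pp (sqfpart_neq0 na) nc erefl).
Qed.

Lemma dvd_sqfpart (q : nat) a : prime q -> a != 0 -> (q%:Z %| sqfpart a)%Z -> (q%:Z %| a)%Z.
Proof. by move=> pq na h; have [c _ ->] := sqfpartE na; rewrite dvdz_mulr. Qed.

Lemma square_neq0 (d1 d2 d3 w : int) : d1 != 0 -> d2 != 0 -> d3 != 0 -> d1 * d2 * d3 = w ^+ 2 -> w != 0.
Proof.
move=> n1 n2 n3 hw; apply/eqP => w0; move: hw; rewrite w0 expr0n /= => /eqP.
by rewrite !mulf_eq0 (negbTE n1) (negbTE n2) (negbTE n3).
Qed.

Lemma sqfree1 : sqfree 1.
Proof.
split=> // p pp; rewrite dvdzE /= dvdn1 -mulnn => /eqP h.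
by have := prime_gt1 pp; nia.
Qed.

Section Selmer.
Variables (e1 e2 e3 m : int).
Hypotheses (he : e1 + e2 + e3 = 0) (n1 : e1 * m != 0) (n2 : e2 * m != 0) (n3 : e3 * m != 0).

Lemma inSelP L : inSel e1 e2 e3 m L ->
  [/\ sqfree L.1.1, sqfree L.1.2 & sqfree L.2] /\ exists2 w, L.1.1 * L.1.2 * L.2 = w ^+ 2 &
  (forall p, prime p -> lsol p (e1 * m) (e2 * m) (e3 * m) L.1.1 L.1.2 L.2) /\
  real_signs (e1 * m < 0) (e2 * m < 0) (e3 * m < 0) (L.1.1 < 0) (L.1.2 < 0) (L.2 < 0).
Proof.
case=> s1 s2 s3 [w hw] [hr hp]; split=> //; exists w => //; split.
  by move=> p pp; apply/(Qp_solvable4_lsol _ _ _ _ _ _ _ pp); apply: hp.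
have nw := square_neq0 (sqfree_neq0 s1) (sqfree_neq0 s2) (sqfree_neq0 s3) hw.
have pos : 0 < L.1.1 * L.1.2 * L.2 by rewrite hw lt0r expf_neq0 // sqr_ge0.
exact: (real_solvableP he n1 n2 n3 (sqfree_neq0 s1) (sqfree_neq0 s2) (sqfree_neq0 s3) pos).1 hr.
Qed.

(** Local solvability and signs depend only on square classes, so they may be checked on
    representatives that are not squarefree. *)
Lemma inSel_sqf x1 x2 x3 w : x1 != 0 -> x2 != 0 -> x3 != 0 -> x1 * x2 * x3 = w ^+ 2 ->
  (forall p, prime p -> lsol p (e1 * m) (e2 * m) (e3 * m) x1 x2 x3) ->
  real_signs (e1 * m < 0) (e2 * m < 0) (e3 * m < 0) (x1 < 0) (x2 < 0) (x3 < 0) ->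
  inSel e1 e2 e3 m (sqf3 x1 x2 x3).
Proof.
move=> m1 m2 m3 hw hp hr.
have [z1 z2 z3] := And3 (sqfpart_neq0 m1) (sqfpart_neq0 m2) (sqfpart_neq0 m3).
have [c1 nc1 E1] := sqfpartE m1; have [c2 nc2 E2] := sqfpartE m2; have [c3 nc3 E3] := sqfpartE m3.
have e : sqfpart x1 * sqfpart x2 * sqfpart x3 * (c1 * c2 * c3) ^+ 2 = w ^+ 2.
  by rewrite -hw {2}E1 {2}E2 {2}E3; ring.
have [v hv] := square_div (mulf_neq0 (mulf_neq0 nc1 nc2) nc3) e.
have nv := square_neq0 z1 z2 z3 hv.
split; rewrite /=; [exact: sqfpart_sqfree|exact: sqfpart_sqfree|exact: sqfpart_sqfree|by exists v|].
split.
  have pos : 0 < sqfpart x1 * sqfpart x2 * sqfpart x3 by rewrite hv lt0r expf_neq0 // sqr_ge0.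
  by apply: (real_solvableP he n1 n2 n3 z1 z2 z3 pos).2; rewrite !sqfpart_sign.
move=> p pp; apply/Qp_solvable4_lsol => //=.
by apply: (lsol_square pp z1 z2 z3 (hp p pp)); apply: sqp_sqfpart.
Qed.

Lemma inSel_one : inSel e1 e2 e3 m (1, 1, 1).
Proof.
have -> : (1, 1, 1) = sqf3 1 1 1 :> triple by rewrite /sqf3 !(sqfpart_id sqfree1).
apply: (@inSel_sqf 1 1 1 1) => // p pp.
have s1 : sqp p 1 by rewrite -[1](expr1n _ 2); apply: sqp_sqr.
exact: lsol_trivial.
Qed.

Lemma inSel_translate L y1 y2 y3 : inSel e1 e2 e3 m L -> y1 != 0 -> y2 != 0 -> y3 != 0 ->
  (forall p d1 d2 d3 w, prime p -> d1 != 0 -> d2 != 0 -> d3 != 0 -> d1 * d2 * d3 = w ^+ 2 ->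
     lsol p (e1 * m) (e2 * m) (e3 * m) d1 d2 d3 ->
     lsol p (e1 * m) (e2 * m) (e3 * m) (d1 * y1) (d2 * y2) (d3 * y3)) ->
  (forall s1 s2 s3, s1 (+) s2 (+) s3 = false ->
     real_signs (e1 * m < 0) (e2 * m < 0) (e3 * m < 0) s1 s2 s3 ->
     real_signs (e1 * m < 0) (e2 * m < 0) (e3 * m < 0) (s1 (+) (y1 < 0)) (s2 (+) (y2 < 0)) (s3 (+) (y3 < 0))) ->
  (exists v, y1 * y2 * y3 = v ^+ 2) -> inSel e1 e2 e3 m (tmul L (sqf3 y1 y2 y3)).
Proof.
move=> /inSelP[[s1 s2 s3] [w hw [hp hr]]] m1 m2 m3 hl hs [v hv].
have [z1 z2 z3] := And3 (sqfree_neq0 s1) (sqfree_neq0 s2) (sqfree_neq0 s3).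
have nw := square_neq0 z1 z2 z3 hw.
rewrite /tmul /sqf3 /= !sqfpartMr //.
apply: (@inSel_sqf _ _ _ (w * v)); rewrite ?mulf_neq0 //.
- by rewrite exprMn -hw -hv; ring.
- by move=> p pp; apply: (hl p _ _ _ w) => //; apply: hp.
- rewrite (lt0_mul z1 m1) (lt0_mul z2 m2) (lt0_mul z3 m3); apply: hs => //.
  by rewrite -!lt0_mul ?mulf_neq0 // hw ltNge sqr_ge0.
Qed.

(** [lsol_torsion] treats one torsion point; the other two nontrivial ones follow by conjugating
    with the cyclic symmetry. *)
Lemma inSel_tors L tau : inSel e1 e2 e3 m L -> tau \in tors e1 e2 e3 m ->
  inSel e1 e2 e3 m (tmul L tau).
Proof.
move=> hL; have ha : e1 * m + e2 * m + e3 * m = 0 by rewrite -!mulrDl he mul0r.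
have [f1 f2 f3] : [/\ e1 != 0, e2 != 0 & e3 != 0].
  by move: n1 n2 n3; rewrite !mulf_eq0 !negb_or => /andP[-> _] /andP[-> _] /andP[-> _].
have fm : m != 0 by move: n1; rewrite mulf_eq0 negb_or => /andP[].
have sN (x : int) : x != 0 -> (- x < 0) = ~~ (x < 0) by move=> nx; rewrite oppr_lt0 lt_neqAle eq_sym nx /= -leNgt.
have sNm (x : int) : x * m != 0 -> (- x * m < 0) = ~~ (x * m < 0) by move=> nx; rewrite mulNr sN.
have sNM (x y : int) : x != 0 -> y != 0 -> (- x * y < 0) = ~~ ((x * m < 0) (+) (y * m < 0)).
  move=> nx ny; rewrite mulNr sN ?mulf_neq0 // !lt0_mul //.
  by case: (x < 0); case: (y < 0); case: (m < 0).
(* Three nonzero integers with sum zero do not all have the same sign; this excludes the impossible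
   real patterns. *)
have nall : ~~ [&& e1 * m < 0, e2 * m < 0 & e3 * m < 0] && [|| e1 * m < 0, e2 * m < 0 | e3 * m < 0].
  by clear -ha n1 n2 n3; lia.
rewrite !inE => /or4P[]/eqP ->.
- have [[s1 s2 s3] _] := inSelP hL.
  by rewrite /tmul /= !mulr1 !sqfpart_id //; case: L hL {s1 s2 s3} => [[]].
- apply: inSel_translate => //; rewrite ?mulf_neq0 ?oppr_eq0 //.
  + move=> p d1 d2 d3 w pp z1 z2 z3 hw h.
    have hw' : d3 * d1 * d2 = w ^+ 2 by rewrite -hw; ring.
    have ha' : e3 * m + e1 * m + e2 * m = 0 by rewrite -ha; ring.
    have h2 := lsol_cyc (lsol_torsion pp z3 z1 z2 ha' hw' (lsol_cyc (lsol_cyc h))).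
    apply: (lsol_square pp _ _ _ h2); rewrite ?mulf_neq0 ?oppr_eq0 //.
    * by apply: (@sqp_of_eq _ _ _ (d1 * (e3 * m))); rewrite ?mulf_neq0 //; ring.
    * by apply: (@sqp_of_eq _ _ _ (d2 * e1 * e3 * m)); rewrite ?mulf_neq0 //; ring.
    * by apply: (@sqp_of_eq _ _ _ (d3 * (e1 * m))); rewrite ?mulf_neq0 //; ring.
  + rewrite sNm // sNM // /real_signs.
    by case: (e1 * m < 0) nall; case: (e2 * m < 0); case: (e3 * m < 0) => // _ [] [] [].
  + by exists (e1 * e3 * m); ring.
- apply: inSel_translate => //; rewrite ?mulf_neq0 ?oppr_eq0 //.
  + move=> p d1 d2 d3 w pp z1 z2 z3 hw h.
    have hw' : d2 * d3 * d1 = w ^+ 2 by rewrite -hw; ring.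
    have ha' : e2 * m + e3 * m + e1 * m = 0 by rewrite -ha; ring.
    have h2 := lsol_cyc (lsol_cyc (lsol_torsion pp z2 z3 z1 ha' hw' (lsol_cyc h))).
    apply: (lsol_square pp _ _ _ h2); rewrite ?mulf_neq0 ?oppr_eq0 //.
    * by apply: (@sqp_of_eq _ _ _ (d1 * e2 * e3 * m)); rewrite ?mulf_neq0 //; ring.
    * by apply: (@sqp_of_eq _ _ _ (d2 * (e3 * m))); rewrite ?mulf_neq0 //; ring.
    * by apply: (@sqp_of_eq _ _ _ (d3 * (e2 * m))); rewrite ?mulf_neq0 //; ring.
  + rewrite sNm // sNM // /real_signs.
    by case: (e1 * m < 0) nall; case: (e2 * m < 0); case: (e3 * m < 0) => // _ [] [] [].
  + by exists (e2 * e3 * m); ring.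
- apply: inSel_translate => //; rewrite ?mulf_neq0 ?oppr_eq0 //.
  + move=> p d1 d2 d3 w pp z1 z2 z3 hw h.
    have h2 := lsol_torsion pp z1 z2 z3 ha hw h.
    apply: (lsol_square pp _ _ _ h2); rewrite ?mulf_neq0 ?oppr_eq0 //.
    * by apply: (@sqp_of_eq _ _ _ (d1 * (e2 * m))); rewrite ?mulf_neq0 //; ring.
    * by apply: (@sqp_of_eq _ _ _ (d2 * (e1 * m))); rewrite ?mulf_neq0 //; ring.
    * by apply: (@sqp_of_eq _ _ _ (d3 * e1 * e2 * m)); rewrite ?mulf_neq0 //; ring.
  + rewrite sNm // sNM // /real_signs.
    by case: (e1 * m < 0) nall; case: (e2 * m < 0); case: (e3 * m < 0) => // _ [] [] [].
  + by exists (e1 * e2 * m); ring.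
Qed.
End Selmer.

(** * Isotropy relations *)

Lemma hs_self p a : prime p -> odd p -> a != 0 -> hs p a a = hs p a (-1).
Proof.
move=> pp op na; have [_ nm1] := prime_ndvd1 pp.
by rewrite /hs (upart_id pp nm1).1 (upart_id pp nm1).2; bcase.
Qed.

Lemma hs_square_r p a w : prime p -> odd p -> a != 0 -> w != 0 -> hs p a (w ^+ 2) = false.
Proof. by move=> pp op na nw; rewrite expr2 hsMr // addbb. Qed.

(** The three conics give (d3 a1, d1) = (d1 a2, d2) = (d2 a3, d3) = 0. Eliminating [d2] through the
    square product and using (x, x) = (x, -1) leaves two relations: orthogonality to the torsion
    classes (a2, -a1, -a1 a2) and (-a2 a3, a3, -a2). *)
Lemma lsol_isotropy p a1 a2 a3 d1 d2 d3 w : prime p -> odd p ->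
  a1 != 0 -> a2 != 0 -> a3 != 0 -> d1 != 0 -> d2 != 0 -> d3 != 0 -> d1 * d2 * d3 = w ^+ 2 ->
  lsol p a1 a2 a3 d1 d2 d3 ->
  hs p d1 (- (a1 * a2)) = hs p d3 a2 /\ hs p d1 (- a2) = hs p d3 (- (a2 * a3)).
Proof.
move=> pp op n1 n2 n3 m1 m2 m3 hw h.
have nw := square_neq0 m1 m2 m3 hw.
have nN1 : (-1 : int) != 0 by [].
have C1 := lsol_hs pp op n1 m1 m2 m3 hw h.
have hw2 : d2 * d3 * d1 = w ^+ 2 by rewrite -hw; ring.
have hw3 : d3 * d1 * d2 = w ^+ 2 by rewrite -hw; ring.
have C2 := lsol_hs pp op n2 m2 m3 m1 hw2 (lsol_cyc h).
have C3 := lsol_hs pp op n3 m3 m1 m2 hw3 (lsol_cyc (lsol_cyc h)).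
have D2 x : x != 0 -> hs p x d2 = hs p x d1 (+) hs p x d3.
  move=> nx; have := hs_square_r pp op nx nw; rewrite -hw !hsMr ?mulf_neq0 //.
  by case: (hs p x d1); case: (hs p x d2); case: (hs p x d3).
have E1 : - (a1 * a2) = -1 * a1 * a2 by ring.
have E2 : - (a2 * a3) = -1 * a2 * a3 by ring.
have E3 : - a2 = -1 * a2 by ring.
rewrite E1 E2 E3 !hsMr ?mulf_neq0 //.
move: C1 C2 C3; rewrite !hsMl // [hs p d2 d3]hsC !D2 // hs_self // hs_self //.
rewrite [hs p d3 d1]hsC [hs p a1 d1]hsC [hs p a2 d1]hsC [hs p a2 d3]hsC [hs p a3 d3]hsC.
by case: (hs p d1 d3); case: (hs p d1 a1); case: (hs p d1 a2); case: (hs p d1 (-1)); case: (hs p d3 a2);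
   case: (hs p d3 (-1)); case: (hs p d3 a3).
Qed.

(** The symbols of the two conics required by [lsol_two] vanish at every odd prime and at infinity,
    hence at 2. *)
Lemma lsol_two_global a1 a2 a3 d1 d2 d3 w :
  (2 %| a1)%Z -> ~~ (4 %| a1)%Z -> (2 %| a2)%Z -> ~~ (4 %| a2)%Z ->
  a1 + a2 + a3 = 0 -> a1 != 0 -> a2 != 0 -> a3 != 0 ->
  ~~ (2 %| d1)%Z -> ~~ (2 %| d2)%Z -> ~~ (2 %| d3)%Z -> d1 * d2 * d3 = w ^+ 2 -> eps4 d3 = false ->
  (forall q, prime q -> odd q -> lsol q a1 a2 a3 d1 d2 d3) ->
  real_signs (a1 < 0) (a2 < 0) (a3 < 0) (d1 < 0) (d2 < 0) (d3 < 0) -> lsol 2 a1 a2 a3 d1 d2 d3.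
Proof.
move=> h1 h1' h2 h2' ha n1 n2 n3 o1 o2 o3 hw e3 hl hr.
have nz (x : int) : ~~ (2 %| x)%Z -> x != 0 by apply: contraNneq => ->; rewrite dvdz0.
have [z1 z2 z3] := And3 (nz _ o1) (nz _ o2) (nz _ o3).
have hw2 : d2 * d3 * d1 = w ^+ 2 by rewrite -hw; ring.
have nall : ~~ [&& a1 < 0, a2 < 0 & a3 < 0] && [|| a1 < 0, a2 < 0 | a3 < 0].
  by clear -ha n1 n2 n3; lia.
have sd : (d1 < 0) (+) (d2 < 0) (+) (d3 < 0) = false.
  by rewrite -!lt0_mul ?mulf_neq0 // hw ltNge sqr_ge0.
apply: (lsol_two h1 h1' h2 h2' ha o1 o2 o3 hw e3); apply: hs2_from_others; rewrite ?mulf_neq0 //.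
- move: hr nall sd; rewrite /hsoo (lt0_mul z3 n1) /real_signs.
  by case: (a1 < 0); case: (a2 < 0); case: (a3 < 0); case: (d1 < 0); case: (d2 < 0); case: (d3 < 0).
- by move=> q pq oq; apply: (lsol_hs pq oq n1 z1 z2 z3 hw (hl q pq oq)).
- move: hr nall sd; rewrite /hsoo (lt0_mul z1 n2) /real_signs.
  by case: (a1 < 0); case: (a2 < 0); case: (a3 < 0); case: (d1 < 0); case: (d2 < 0); case: (d3 < 0).
- by move=> q pq oq; apply: (lsol_hs pq oq n2 z2 z3 z1 hw2 (lsol_cyc (hl q pq oq))).
Qed.

(** * Bits in F_2 and the Hilbert symbols of the matrix entries *)

Lemma bit_addb (b c : bool) : (b (+) c)%:R = b%:R + c%:R :> 'F_2.
Proof. by case: b; case: c; apply/val_inj. Qed.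

Lemma bit_inj (b c : bool) : b%:R = c%:R :> 'F_2 -> b = c.
Proof. by case: b; case: c => // /(congr1 val). Qed.

Lemma natr_F2 (m : nat) : m%:R = (odd m)%:R :> 'F_2.
Proof.
have e : (2%:R : 'F_2) = 0 by apply/val_inj.
by rewrite -{1}(odd_double_half m) natrD -muln2 natrM e mulr0 addr0.
Qed.

Lemma F2_neq0 (x : 'F_2) : x = (x != 0)%:R.
Proof. by case: x => -[|[|//]] h; apply/val_inj. Qed.

Lemma qr_bit_nonres p u : prime p -> ~~ (p%:Z %| u)%Z -> qr_bit u p = (nonres p u)%:R.
Proof. by move=> pp hu; rewrite /qr_bit qr_nonres //; case: (nonres p u). Qed.

(** One direction is [csol_hs]. Conversely a Hensel root [x] gives the zero (1, 0, x) when [a] is a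
    unit and (x, 1, 0) when [a] is [q]. *)
Lemma hilb_hs q a b' : prime q -> odd q -> ~~ (q%:Z %| a)%Z \/ a = q%:Z -> ~~ (q%:Z %| b')%Z ->
  hilb a (q%:Z * b') q = (hs q a (q%:Z * b'))%:R.
Proof.
move=> pq oq ha hb; have np0 : (q%:Z : int) != 0 by rewrite eqz_nat -lt0n prime_gt0.
have nz (x : int) : ~~ (q%:Z %| x)%Z -> x != 0 by apply: contraNneq => ->; rewrite dvdz0.
have [n1 nm1] := prime_ndvd1 pq.
have na : a != 0 by case: ha => [/nz|->].
rewrite /hilb; case: pselect => h.
  rewrite (csol_hs pq oq na (mulf_neq0 np0 (nz _ hb))) //.
  exists 1%N => e; have [x [y [z [hn]]]] := h e; rewrite /= andbT => hE.
  by exists x, y, z; rewrite expr1.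
case e : (hs _ _ _) => //; case: h => k.
case: ha => [ha|ea].
  have r : nonres q a = false by rewrite -e hsC hs_pu_unit.
  have [x hx hE] := hensel_odd pq oq ha r k.
  exists 1, 0, x; split; first by rewrite (negbTE n1).
  by rewrite /= andbT; move: hE; congr (_ %| _)%Z; ring.
have r : nonres q (-1 * b') = false.
  by have := hs_pu_pv pq oq n1 hb; rewrite mulr1 nonres1 // addbF -{1}ea e nonresM // => <-.
have ub : ~~ (q%:Z %| -1 * b')%Z by rewrite mulN1r rpredN.
have [x hx hE] := hensel_odd pq oq ub r k.
exists x, 1, 0; split; first by rewrite (negbTE hx).
rewrite /= andbT ea (_ : _ - _ = - q%:Z * (x ^+ 2 - -1 * b')); last by ring.
by rewrite dvdz_mull.
Qed.

Lemma pstar_mod4 p : odd p -> (pstar p %% 4)%Z = 1.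
Proof.
move=> op; rewrite /pstar -signr_odd (_ : odd (p.-1)./2 = (p %% 4 == 3)%N); last by lia.
by case: eqP => h; rewrite ?expr1 ?expr0; lia.
Qed.

Lemma pstar_neq0 p : prime p -> pstar p != 0.
Proof. by move=> pp; rewrite /pstar mulf_neq0 ?expf_neq0 // eqz_nat -lt0n prime_gt0. Qed.

Lemma absz_pstar p : `|pstar p|%N = p.
Proof. by rewrite /pstar abszM abszX /= exp1n mul1n. Qed.

Lemma mod4_prod (I : finType) (g : I -> int) (f : I -> nat) :
  (forall i, (g i %% 4)%Z = 1) -> ((\prod_i g i ^+ f i) %% 4)%Z = 1.
Proof.
move=> hg; apply: (big_ind (fun x : int => (x %% 4)%Z = 1)) => // [x y hx hy|i _].
  by rewrite -modzMml -modzMmr hx hy.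
by elim: (f i) => [|m IH]; rewrite ?expr0 // exprS -modzMml -modzMmr hg IH.
Qed.

Lemma nonres_prod q (I : finType) (g : I -> int) (f : I -> nat) : prime q -> odd q ->
  (forall i, ~~ (q%:Z %| g i)%Z /\ nonres q (g i) = false) ->
  ~~ (q%:Z %| \prod_i g i ^+ f i)%Z /\ nonres q (\prod_i g i ^+ f i) = false.
Proof.
move=> pq oq hg; have [n1 _] := prime_ndvd1 pq.
have st (x y : int) : ~~ (q%:Z %| x)%Z /\ nonres q x = false -> ~~ (q%:Z %| y)%Z /\ nonres q y = false ->
    ~~ (q%:Z %| x * y)%Z /\ nonres q (x * y) = false.
  by move=> [hx rx] [hy ry]; rewrite Euclid_dvdzM // negb_or hx hy nonresM // rx ry.
apply: (big_ind (fun x : int => ~~ (q%:Z %| x)%Z /\ nonres q x = false)) => //.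
  by rewrite nonres1.
move=> i _; elim: (f i) => [|m IH]; first by rewrite expr0 nonres1.
by rewrite exprS; apply: st.
Qed.

Lemma hs_prod q (I : finType) (g : I -> int) (f : I -> nat) b : prime q -> odd q -> b != 0 ->
  (forall i, g i != 0) ->
  (hs q (\prod_i g i ^+ f i) b)%:R = \sum_i (hs q (g i) b)%:R * (f i)%:R :> 'F_2.
Proof.
move=> pq oq nb hg.
have h1 : hs q 1 b = false.
  by have := hsMl pq oq (oner_neq0 _) (oner_neq0 _) nb; rewrite mulr1; case: (hs q 1 b).
suff [] : \prod_i g i ^+ f i != 0 /\
  (hs q (\prod_i g i ^+ f i) b)%:R = \sum_i (hs q (g i) b)%:R * (f i)%:R :> 'F_2 by [].
apply: (big_ind2 (fun (x : int) (s : 'F_2) => x != 0 /\ (hs q x b)%:R = s)) => [|x s y t [nx <-] [ny <-]|i _].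
- by rewrite h1.
- by rewrite mulf_neq0 // hsMl // bit_addb.
split; first by rewrite expf_neq0.
elim: (f i) => [|m IH]; first by rewrite expr0 h1 mulr0.
by rewrite exprS hsMl ?expf_neq0 // bit_addb IH mulrS mulrDr mulr1.
Qed.

(** * Divisors of n and the matrix *)

Section PrimeFactors.
Variables (k : nat) (p : 'I_k -> nat) (n : nat).
Hypotheses (hp_prime : forall i, prime (p i)) (hp_odd : forall i, odd (p i)) (hp_inj : injective p).
Hypothesis hn : n = (\prod_(i < k) p i)%N.

(** [dpos] and [dstar] are the two normalizations of a divisor of [n] with given exponents:
    positive, and congruent to 1 modulo 4. *)
Definition dpos (f : 'I_k -> nat) : int := \prod_i (p i)%:Z ^+ f i.
Definition dstar (f : 'I_k -> nat) : int := \prod_i pstar (p i) ^+ f i.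

Lemma p_neq0 i : (p i)%:Z != 0.
Proof. by rewrite eqz_nat -lt0n prime_gt0. Qed.

Lemma absz_prod (g : 'I_k -> int) : `|(\prod_i g i)%R|%N = (\prod_i `|g i|)%N.
Proof. exact: (big_morph absz abszM). Qed.

Lemma absz_dpos f : `|dpos f|%N = (\prod_i p i ^ f i)%N.
Proof. by rewrite absz_prod; apply: eq_bigr => i _; rewrite abszX. Qed.

Lemma absz_dstar f : `|dstar f|%N = `|dpos f|%N.
Proof. by rewrite !absz_prod; apply: eq_bigr => i _; rewrite !abszX absz_pstar. Qed.

Lemma dpos_gt0 f : 0 < dpos f.
Proof. by apply: prodr_gt0 => i _; rewrite exprn_gt0 // ltz_nat prime_gt0. Qed.

Lemma dstar_neq0 f : dstar f != 0.
Proof. by rewrite -absz_eq0 absz_dstar absz_eq0 gt_eqF // dpos_gt0. Qed.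

Lemma dstar_mod4 f : (dstar f %% 4)%Z = 1.
Proof. by apply: mod4_prod => i; apply: pstar_mod4. Qed.

Lemma logn_dpos q f : prime q -> logn q `|dpos f| = (\sum_i f i * (q == p i))%N.
Proof.
move=> pq; rewrite absz_dpos.
suff [] : (0 < \prod_i p i ^ f i)%N /\ logn q (\prod_i p i ^ f i) = (\sum_i f i * (q == p i))%N by [].
apply: (big_ind2 (fun x s => (0 < x)%N /\ logn q x = s)) => [|x s y t [x0 <-] [y0 <-]|i _].
- by rewrite logn1.
- by rewrite muln_gt0 x0 y0 lognM.
- by rewrite expn_gt0 prime_gt0 // lognX logn_prime.
Qed.

Lemma logn_p_dpos i f : logn (p i) `|dpos f| = f i.
Proof.
rewrite logn_dpos // (bigD1 i) //= eqxx muln1 big1 ?addn0 // => j nj.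
by rewrite (inj_eq hp_inj) eq_sym (negbTE nj) muln0.
Qed.

Lemma n_dpos : n%:Z = dpos (fun=> 1%N).
Proof.
by rewrite -[RHS]gez0_abs ?ltW ?dpos_gt0 // absz_dpos hn; congr Posz.
Qed.

Lemma n_gt0 : (0 < n)%N.
Proof. by rewrite hn prodn_gt0 // => i; apply: prime_gt0. Qed.

Lemma n_neq0 : (n%:Z : int) != 0.
Proof. by rewrite eqz_nat -lt0n n_gt0. Qed.

Lemma prime_dvd_n q : prime q -> (q %| n)%N -> exists i, q = p i.
Proof.
move=> pq; rewrite hn; elim/big_rec: _ => [|i x _ IH].
  by rewrite dvdn1 => /eqP q1; rewrite q1 in pq.
rewrite Euclid_dvdM // => /orP[|//]; rewrite dvdn_prime2 // => /eqP ->.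
by exists i.
Qed.

Lemma logn_n q : prime q -> (logn q n <= 1)%N.
Proof.
move=> pq; have [/(prime_dvd_n pq)[i ->]|h] := boolP (q %| n)%N.
  by rewrite -[n]/(`|n%:Z|%N) n_dpos logn_p_dpos.
by rewrite lognE pq n_gt0 (negbTE h).
Qed.

Lemma n_odd : ~~ (2 %| n%:Z)%Z.
Proof.
apply/negP; rewrite dvdzE /= => h2; have [i e] := prime_dvd_n (isT : prime 2) h2.
by have := hp_odd i; rewrite -e.
Qed.

Lemma dvd_n_sqfree d : (d %| n%:Z)%Z -> sqfree d.
Proof.
rewrite dvdzE => hd; split.
  by apply/eqP => d0; move: hd; rewrite d0 dvd0n gtn_eqF // n_gt0.
move=> q pq; rewrite dvdzE => h2; have := dvdn_trans h2 hd.
by rewrite pfactor_dvdn ?n_gt0 // ltnNge logn_n.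
Qed.

Lemma dvd_n_odd d : (d %| n%:Z)%Z -> ~~ (2 %| d)%Z.
Proof. by move=> hd; apply: contra n_odd => h; apply: dvdz_trans hd. Qed.

Lemma sqfree_dvd_n d : sqfree d -> (forall q, prime q -> (q%:Z %| d)%Z -> (q %| n)%N) -> (d %| n%:Z)%Z.
Proof.
move=> sd h; have nd := sqfree_neq0 sd; rewrite dvdzE.
have d0 : (0 < `|d|)%N by rewrite absz_gt0.
apply/(dvdn_partP _ d0) => q; rewrite mem_primes => /and3P[pq _ qd].
rewrite p_part pfactor_dvdn ?n_gt0 // sqfree_logn //.
have : (0 < logn q n)%N by rewrite logn_gt0 mem_primes pq n_gt0 h.
by case: (vodd _ _).
Qed.

Lemma dvd_n_absE d : (d %| n%:Z)%Z -> `|d|%N = `|dpos (fun i => logn (p i) `|d|)|%N.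
Proof.
move=> hd; have nd := sqfree_neq0 (dvd_n_sqfree hd).
apply: eqn_from_log => [||q]; [by rewrite absz_gt0|by rewrite absz_gt0 gt_eqF // dpos_gt0|].
have [pq|npq] := boolP (prime q); last by rewrite lognE (negbTE npq) /= lognE (negbTE npq).
rewrite logn_dpos //; have [/eqP l0|l0] := boolP (logn q `|d| == 0%N).
  by rewrite l0 big1 // => i _; case: eqP => [<-|_]; rewrite ?l0 ?muln0.
have qd : (q %| n)%N.
  rewrite -lt0n logn_gt0 mem_primes in l0; case/and3P: l0 => _ _ h.
  by apply: dvdn_trans h _; rewrite dvdzE in hd.
have [i ->] := prime_dvd_n pq qd.
rewrite (bigD1 i) //= eqxx muln1 big1 ?addn0 // => j nj.
by rewrite (inj_eq hp_inj) eq_sym (negbTE nj) muln0.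
Qed.

Lemma dvd_n_dpos d : (d %| n%:Z)%Z -> 0 < d -> d = dpos (fun i => logn (p i) `|d|).
Proof.
move=> hd d0; have := dvd_n_absE hd; have := dpos_gt0 (fun i => logn (p i) `|d|).
by move: (dpos _) => x; clear -d0; lia.
Qed.

Lemma dvd_n_dstar d : (d %| n%:Z)%Z -> (d %% 4)%Z = 1 -> d = dstar (fun i => logn (p i) `|d|).
Proof.
move=> hd d4; have := dvd_n_absE hd; rewrite -absz_dstar.
have := dstar_mod4 (fun i => logn (p i) `|d|).
by move: (dstar _) => x; clear -d4; lia.
Qed.

Lemma dpos_dvd f : (forall i, f i <= 1)%N -> (dpos f %| n%:Z)%Z.
Proof.
move=> hf; rewrite dvdzE /= absz_dpos hn.
by apply: (big_ind2 (fun x y => x %| y)%N) => // [*|i _]; [exact: dvdn_mul|rewrite -{2}(expn1 (p i)) dvdn_exp2l].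
Qed.

Lemma dstar_dvd f : (forall i, f i <= 1)%N -> (dstar f %| n%:Z)%Z.
Proof. by move=> /dpos_dvd; rewrite !dvdzE absz_dstar. Qed.

Lemma n_cofactor i : exists2 n', n%:Z = (p i)%:Z * n' & ~~ ((p i)%:Z %| n')%Z.
Proof.
have h : ((p i)%:Z %| n%:Z)%Z by rewrite dvdzE /= hn (bigD1 i) //= dvdn_mulr.
exact: sqfree_dvd (dvd_n_sqfree (dvdzz _)) (hp_prime i) h.
Qed.

Lemma ndvd_pp i j : i != j -> ~~ ((p i)%:Z %| (p j)%:Z)%Z.
Proof. by move=> nij; rewrite dvdzE /= dvdn_prime2 // (inj_eq hp_inj). Qed.

Lemma hilb_pp i j : hilb (p j)%:Z (- n%:Z) (p i) = (hs (p i) (p j) (- n%:Z))%:R.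
Proof.
have [n' e un'] := n_cofactor i.
have -> : - n%:Z = (p i)%:Z * - n' by rewrite e; ring.
rewrite hilb_hs ?rpredN //.
by have [->|nij] := eqVneq i j; [right|left; exact: ndvd_pp].
Qed.

(** Off the diagonal both sides are residue symbols exchanged by quadratic reciprocity, the star
    absorbing its sign. Hence [d3] is normalized modulo 4, and its block contains the transpose of
    the matrix for [d1]. *)
Lemma hs_pstar_reciprocity i j : hs (p i) (pstar (p j)) n%:Z = hs (p j) (p i) (- n%:Z).
Proof.
have [pi oi pj oj] := And4 (hp_prime i) (hp_odd i) (hp_prime j) (hp_odd j).
have [n' e un'] := n_cofactor i.
have unit_hs (q : nat) (a b : int) : prime q -> odd q -> ~~ (q%:Z %| a)%Z -> ~~ (q%:Z %| b)%Z ->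
    hs q a (q%:Z * b) = nonres q a.
  by move=> pq oq ha hb; rewrite hsC hs_pu_unit.
have [<-|nij] := eqVneq i j.
  have [n1 nm1] := prime_ndvd1 pi.
  have pself (x : int) : ~~ ((p i)%:Z %| x)%Z ->
      hs (p i) (p i) ((p i)%:Z * x) = nonres (p i) (-1) (+) nonres (p i) x.
    by move=> hx; have := hs_pu_pv pi oi n1 hx; rewrite mulr1 nonres1 // addbF.
  rewrite e -mulrN pself ?rpredN // -[- n']mulN1r nonresM // addbA addbb /=.
  rewrite /pstar -signr_odd.
  have -> : odd (p i).-1./2 = nonres (p i) (-1) by rewrite /nonres legN1 // -signr_odd; case: (odd _).
  case r: (nonres _ (-1)); rewrite ?expr1 ?expr0.
    by rewrite [_ * (p i)%:Z]mulrC hs_pu_pv // r addbb.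
  by rewrite mul1r pself // r.
have up : ~~ ((p i)%:Z %| pstar (p j))%Z by rewrite dvdzE absz_pstar -[(_ %| _)%N]/((p i)%:Z %| (p j)%:Z)%Z ndvd_pp.
rewrite {1}e unit_hs //.
have [m' e' um'] := n_cofactor j.
have -> : - n%:Z = (p j)%:Z * - m' by rewrite e'; ring.
rewrite unit_hs ?rpredN // ?ndvd_pp 1?eq_sym //.
by rewrite /nonres quadratic_reciprocity // (inj_eq hp_inj) eq_sym.
Qed.

Section Rows.
Variables (e1 e2 e3 : int).
Hypotheses (u1 : forall i, ~~ ((p i)%:Z %| e1)%Z) (u2 : forall i, ~~ ((p i)%:Z %| e2)%Z)
  (u3 : forall i, ~~ ((p i)%:Z %| e3)%Z).
Hypotheses (z1 : e1 != 0) (z2 : e2 != 0) (z3 : e3 != 0).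

Definition isotropic (d1 d3 : int) (i : 'I_k) : Prop :=
  hs (p i) d1 (- (e1 * e2) * n%:Z ^+ 2) = hs (p i) d3 (e2 * n%:Z) /\
  hs (p i) d1 (- (e2 * n%:Z)) = hs (p i) d3 (- (e2 * e3) * n%:Z ^+ 2).

Lemma hs_unit_vodd i d u : d != 0 -> ~~ ((p i)%:Z %| u)%Z ->
  (hs (p i) d u)%:R = qr_bit u (p i) * (logn (p i) `|d|)%:R :> 'F_2.
Proof.
move=> nd hu; rewrite (natr_F2 (logn _ _)) qr_bit_nonres // -/(vodd (p i) d).
rewrite /hs (upart_id (hp_prime i) hu).1 (upart_id (hp_prime i) hu).2 andbF /= addbF.
by case: (vodd (p i) d); case: (nonres (p i) u); rewrite ?mulr1 ?mulr0.
Qed.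

(** By bilinearity [Amat] applied to the exponents of [d1] gives (d1, -n), and its transpose applied
    to those of [d3] gives (d3, n); the diagonal matrices add symbols with units. The upper rows are
    the second relation of [isotropic], the lower rows the first. *)
Lemma kernel_isotropic f g L : L.1.1 = dpos f -> L.2 = dstar g ->
  bigM e1 e2 e3 p n *m xz p L = 0 <-> forall i, isotropic L.1.1 L.2 i.
Proof.
move=> E1 E3.
have nd1 : L.1.1 != 0 by rewrite E1 gt_eqF // dpos_gt0.
have nd3 : L.2 != 0 by rewrite E3 dstar_neq0.
have nN : - n%:Z != 0 by rewrite oppr_eq0 n_neq0.
have lg i : logn (p i) `|L.1.1| = f i by rewrite E1 logn_p_dpos.
have lg3 i : logn (p i) `|L.2| = g i by rewrite E3 absz_dstar logn_p_dpos.
have um i (x y : int) : ~~ ((p i)%:Z %| x)%Z -> ~~ ((p i)%:Z %| y)%Z -> ~~ ((p i)%:Z %| x * y)%Z.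
  by move=> hx hy; rewrite Euclid_dvdzM // negb_or hx.
have r1 i : \sum_j hilb (p j)%:Z (- n%:Z) (p i) * (f j)%:R = (hs (p i) L.1.1 (- n%:Z))%:R.
  rewrite E1 hs_prod // => [|j]; last exact: p_neq0.
  by apply: eq_bigr => j _; rewrite hilb_pp.
have r3 i : \sum_j hilb (p i)%:Z (- n%:Z) (p j) * (g j)%:R = (hs (p i) L.2 n%:Z)%:R.
  rewrite E3 hs_prod ?n_neq0 // => [|j]; last exact: pstar_neq0.
  by apply: eq_bigr => j _; rewrite hilb_pp hs_pstar_reciprocity.
have sqn i d u : d != 0 -> ~~ ((p i)%:Z %| u)%Z -> hs (p i) d (u * n%:Z ^+ 2) = hs (p i) d u.
  move=> nd hu; rewrite hsC hs_sqr ?n_neq0 1?hsC //.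
  by apply: contraNneq hu => ->; rewrite dvdz0.
have row1 i : (bigM e1 e2 e3 p n *m xz p L) (lshift k i) 0 =
   (hs (p i) L.1.1 (- (e2 * n%:Z)) (+) hs (p i) L.2 (- (e2 * e3) * n%:Z ^+ 2))%:R.
  rewrite /bigM /xz mul_block_col col_mxEu !mulmxDl !mul_diag_mx !mxE.
  rewrite (eq_bigr (fun j => hilb (p j)%:Z (- n%:Z) (p i) * (f j)%:R)); last first.
    by move=> j _; rewrite !mxE lg.
  rewrite r1 bit_addb sqn //; last by rewrite rpredN um.
  have -> : hs (p i) L.1.1 (- (e2 * n%:Z)) = hs (p i) L.1.1 e2 (+) hs (p i) L.1.1 (- n%:Z).
    by rewrite -mulrN hsMr.
  have v23 : ~~ ((p i)%:Z %| - (e2 * e3))%Z by rewrite rpredN um.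
  rewrite bit_addb (hs_unit_vodd nd1 (u2 i)) (hs_unit_vodd nd3 v23).
  by rewrite mulNr [in RHS](addrC (qr_bit _ _ * _)).
have row2 i : (bigM e1 e2 e3 p n *m xz p L) (rshift k i) 0 =
   (hs (p i) L.1.1 (- (e1 * e2) * n%:Z ^+ 2) (+) hs (p i) L.2 (e2 * n%:Z))%:R.
  rewrite /bigM /xz mul_block_col col_mxEd !mulmxDl !mul_diag_mx !mxE.
  rewrite (eq_bigr (fun j => hilb (p i)%:Z (- n%:Z) (p j) * (g j)%:R)); last first.
    by move=> j _; rewrite !mxE lg3.
  rewrite r3 bit_addb sqn //; last by rewrite rpredN um.
  have v12 : ~~ ((p i)%:Z %| - (e1 * e2))%Z by rewrite rpredN um.
  rewrite (hsMr (hp_prime i) (hp_odd i) nd3 z2 n_neq0) bit_addb (hs_unit_vodd nd1 v12) (hs_unit_vodd nd3 (u2 i)).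
  by rewrite mulNr [in RHS](addrC (qr_bit e2 _ * _)).
split=> [h i|h].
  have h1 := row1 i; have h2 := row2 i; rewrite h mxE in h1; rewrite h mxE in h2.
  split.
    by move: h2 => /esym/(@bit_inj _ false); case: (hs _ _ _); case: (hs _ _ _).
  by move: h1 => /esym/(@bit_inj _ false); case: (hs _ _ _); case: (hs _ _ _).
apply/colP => l; rewrite [RHS]mxE -[l]splitK.
by case: (split l) => i /=; rewrite ?row1 ?row2; have [I1 I2] := h i; rewrite ?I1 ?I2 addbb.
Qed.
End Rows.
End PrimeFactors.

(** * The 2-Selmer group of the twist *)

Lemma sqfree_vodd q d : sqfree d -> prime q -> (q%:Z %| d)%Z = vodd q d.
Proof.
move=> sd pq; have := sqfree_logn sd pq.
have : (0 < logn q `|d|)%N = (q %| `|d|)%N by rewrite logn_gt0 mem_primes pq absz_gt0 (sqfree_neq0 sd).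
by rewrite dvdzE /= => <- ->; case: (vodd _ _).
Qed.

Lemma sqfpartK a : a != 0 -> sqfpart (sqfpart a) = sqfpart a.
Proof. by move=> na; rewrite sqfpart_id //; apply: sqfpart_sqfree. Qed.

Lemma voddN q d : vodd q (- d) = vodd q d.
Proof. by rewrite /vodd abszN. Qed.

Lemma uniq_map_inj (T U : eqType) (f : T -> U) (s : seq T) x y :
  uniq (map f s) -> x \in s -> y \in s -> f x = f y -> x = y.
Proof.
elim: s => //= z s IH /andP[nz us]; rewrite !inE => /orP[/eqP->|xs] /orP[/eqP->|ys] // e.
- by case/negP: nz; rewrite e map_f.
- by case/negP: nz; rewrite -e map_f.
- exact: IH.
Qed.

(** The square product makes the parity of [d2] the sum of these two. *)
Definition vodd2 (L : triple) : bool * bool := (vodd 2 L.1.1, vodd 2 L.2).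

Section TwistedCurve.
Variables (e1 e2 e3 : int) (k : nat) (p : 'I_k -> nat) (n : nat).
Hypotheses (z1 : e1 != 0) (z2 : e2 != 0) (z3 : e3 != 0).
Hypothesis he_sum : e1 + e2 + e3 = 0.
Hypotheses (he1 : (2 %| e1)%Z /\ ~~ (4 %| e1)%Z) (he2 : (2 %| e2)%Z /\ ~~ (4 %| e2)%Z).
Hypothesis he3 : (4 %| e3)%Z.
Hypotheses (hp_prime : forall i, prime (p i)) (hp_odd : forall i, odd (p i)) (hp_inj : injective p).
Hypothesis hn : n = (\prod_(i < k) p i)%N.
Hypothesis hn_cop : coprime n (absz (e1 * e2 * e3)).
Hypothesis hn_qr : forall i (q : nat), prime q -> odd q -> (q%:Z %| e1 * e2 * e3)%Z -> qr (p i)%:Z q.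
Hypothesis h_sign : (0 < e2 /\ e3 < 0) \/ (forall i, p i = 1 %[mod 4]).
Hypothesis h_leg : forall i (q : nat), prime q -> odd q -> (q%:Z %| e2 * e3)%Z -> qr (pstar (p i)) q.
Hypothesis h_sel : exists s : seq triple,
  [/\ uniq s, size s = 4 & forall L, inSel e1 e2 e3 1 L <-> L \in s].

Let nN : (n%:Z : int) != 0 := n_neq0 hp_prime hn.
Let pos_n : 0 < n%:Z. Proof. by rewrite ltz_nat (n_gt0 hp_prime hn). Qed.

Lemma twist_neq0 (m : int) : m != 0 -> [/\ e1 * m != 0, e2 * m != 0 & e3 * m != 0].
Proof. by move=> nm; rewrite !mulf_neq0. Qed.

Lemma twist_sum (m : int) : e1 * m + e2 * m + e3 * m = 0.
Proof. by rewrite -!mulrDl he_sum mul0r. Qed.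

Lemma dvd_e_ndvd_n q : prime q -> (q%:Z %| e1 * e2 * e3)%Z -> ~~ (q%:Z %| n%:Z)%Z.
Proof.
move=> pq h; apply/negP => h'; move: hn_cop; rewrite /coprime => /eqP g.
have : (q %| gcdn n `|(e1 * e2 * e3)%R|)%N by rewrite dvdn_gcd; apply/andP.
by rewrite g dvdn1 => /eqP q1; rewrite q1 in pq.
Qed.

Lemma dvd_eE q : prime q ->
  (q%:Z %| e1 * e2 * e3)%Z = [|| (q%:Z %| e1)%Z, (q%:Z %| e2)%Z | (q%:Z %| e3)%Z].
Proof. by move=> pq; rewrite !Euclid_dvdzM // orbA. Qed.

Lemma p_unit i : [/\ ~~ ((p i)%:Z %| e1)%Z, ~~ ((p i)%:Z %| e2)%Z & ~~ ((p i)%:Z %| e3)%Z].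
Proof.
have hi : ((p i)%:Z %| n%:Z)%Z by have [n' -> _] := n_cofactor hp_prime hp_inj hn i; rewrite dvdz_mulr.
have : ~~ ((p i)%:Z %| e1 * e2 * e3)%Z.
  by apply: contraL hi => h; apply: dvd_e_ndvd_n.
by rewrite dvd_eE // !negb_or => /and3P.
Qed.

Lemma dvd_n_residue q d : prime q -> odd q -> (q%:Z %| e1 * e2 * e3)%Z -> (d %| n%:Z)%Z -> 0 < d ->
  ~~ (q%:Z %| d)%Z /\ nonres q d = false.
Proof.
move=> pq oq hq hd d0; rewrite (dvd_n_dpos hp_prime hp_inj hn hd d0).
apply: nonres_prod => // i; have := hn_qr i pq oq hq.
have hu : ~~ (q%:Z %| (p i)%:Z)%Z.
  apply: contra (dvd_e_ndvd_n pq hq) => h; apply: dvdz_trans h _.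
  by have [n' -> _] := n_cofactor hp_prime hp_inj hn i; rewrite dvdz_mulr.
by rewrite qr_nonres // => /negbTE.
Qed.

Lemma dvd_n_residue_star q d : prime q -> odd q -> (q%:Z %| e2 * e3)%Z -> (d %| n%:Z)%Z -> (d %% 4)%Z = 1 ->
  ~~ (q%:Z %| d)%Z /\ nonres q d = false.
Proof.
move=> pq oq hq hd d4; rewrite (dvd_n_dstar hp_prime hp_odd hp_inj hn hd d4).
apply: nonres_prod => // i; have := h_leg i pq oq hq.
have hu : ~~ (q%:Z %| pstar (p i))%Z by apply/negP => h; have := h_leg i pq oq hq; rewrite /qr h.
by rewrite qr_nonres // => /negbTE.
Qed.

(** If every [p i] is 1 modulo 4, every [pstar (p i)] is positive and so is their product. *)
Lemma dvd_n_negative d : (d %| n%:Z)%Z -> (d %% 4)%Z = 1 -> d < 0 -> 0 < e2 /\ e3 < 0.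
Proof.
move=> hd d4 dn; case: h_sign => // h1; move: dn.
rewrite (dvd_n_dstar hp_prime hp_odd hp_inj hn hd d4) ltNge => /negP[].
apply: prodr_ge0 => i _; rewrite exprn_ge0 // /pstar.
have oi : odd (p i).-1./2 = false by have := h1 i; have := hp_odd i; clear; lia.
by rewrite -signr_odd oi mul1r.
Qed.

Lemma vodd_e : vodd 2 e1 = true /\ vodd 2 e2 = true.
Proof.
have v (e : int) : (2 %| e)%Z /\ ~~ (4 %| e)%Z -> vodd 2 e = true.
  move=> [h h']; have [b eb ob] := double_odd h h'; have [u2 v2] := upart_prime (isT : prime 2).
  have nb : b != 0 by apply: contraNneq ob => ->; rewrite dvdz0.
  by rewrite eb voddM // v2 (odd_upart2 ob).2.
by split; apply: v.
Qed.

Lemma tors_neq0 m tau : m != 0 -> tau \in tors e1 e2 e3 m -> [/\ tau.1.1 != 0, tau.1.2 != 0 & tau.2 != 0].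
Proof.
move=> nm; rewrite !inE => /or4P[]/eqP -> //=; split; apply: sqfpart_neq0; by rewrite ?mulf_neq0 ?oppr_eq0.
Qed.

(** Only the parity of the valuation of [e3] is left open, and both values keep the four entries
    distinct. *)
Lemma vodd2_tors m : ~~ (2 %| m)%Z -> map vodd2 (tors e1 e2 e3 m) =
  [:: (false, false); (vodd 2 e3, true); (~~ vodd 2 e3, true); (true, false)].
Proof.
move=> om; have nm : m != 0 by apply: contraNneq om => ->; rewrite dvdz0.
have [v1 v2] := vodd_e; have vm := (odd_upart2 om).2; have p2 : prime 2 by [].
have v0 : vodd 2 1 = false by [].
rewrite /tors /= /vodd2 /= !vodd_sqfpart ?mulf_neq0 ?oppr_eq0 //.
by rewrite v0 !voddM ?mulf_neq0 ?oppr_eq0 // !voddN v1 v2 vm /= addbF.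
Qed.

Lemma uniq_vodd2_tors m : ~~ (2 %| m)%Z -> uniq (map vodd2 (tors e1 e2 e3 m)).
Proof. by move=> om; rewrite vodd2_tors //; case: (vodd 2 e3). Qed.

Lemma tors_vodd2_inj m tau tau' : ~~ (2 %| m)%Z -> tau \in tors e1 e2 e3 m -> tau' \in tors e1 e2 e3 m ->
  vodd2 tau = vodd2 tau' -> tau = tau'.
Proof. by move=> om; apply: uniq_map_inj; apply: uniq_vodd2_tors. Qed.

Lemma tors_vodd2_ex m b : ~~ (2 %| m)%Z -> exists2 tau, tau \in tors e1 e2 e3 m & vodd2 tau = b.
Proof.
move=> om; have /mapP[tau h ->] : b \in map vodd2 (tors e1 e2 e3 m).
  by rewrite vodd2_tors // !inE; case: b => [[] []]; case: (vodd 2 e3).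
by exists tau.
Qed.

Lemma vodd2_tmul L tau : L.1.1 != 0 -> L.2 != 0 -> tau.1.1 != 0 -> tau.2 != 0 ->
  vodd2 (tmul L tau) = (vodd 2 L.1.1 (+) vodd 2 tau.1.1, vodd 2 L.2 (+) vodd 2 tau.2).
Proof. by move=> *; rewrite /vodd2 /= !vodd_sqfpart ?mulf_neq0 // !voddM. Qed.

(** The four torsion classes are distinct, so they fill the Selmer group of order four, and [vodd2]
    separates them. *)
Lemma sel1_trivial R : inSel e1 e2 e3 1 R -> vodd2 R = (false, false) -> R = (1, 1, 1).
Proof.
move=> hR vR; have [s [us ss hs]] := h_sel.
have [n1 n2 n3] := twist_neq0 (oner_neq0 _).
have o1 : ~~ (2 %| 1)%Z by [].
have ut : uniq (tors e1 e2 e3 1) := map_uniq (uniq_vodd2_tors o1).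
have sub : {subset tors e1 e2 e3 1 <= s}.
  move=> tau ht; apply/hs.
  have := inSel_tors he_sum n1 n2 n3 (inSel_one he_sum n1 n2 n3) ht.
  have -> : tmul (1, 1, 1) tau = tau; last by [].
  move: ht; rewrite !inE => /or4P[]/eqP ->; rewrite /tmul /sqf3 /= !mul1r ?(sqfpart_id sqfree1) //;
  by rewrite !sqfpartK ?mulf_neq0 ?oppr_eq0.
have [_ e] := uniq_min_size ut sub (eq_leq ss).
apply: (@tors_vodd2_inj 1) => //; first by rewrite e; apply/hs.
Qed.

Lemma inSel_vodd2 m L : inSel e1 e2 e3 m L -> m != 0 -> vodd2 L = (false, false) ->
  [/\ ~~ (2 %| L.1.1)%Z, ~~ (2 %| L.1.2)%Z & ~~ (2 %| L.2)%Z].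
Proof.
move=> [s1 s2 s3 [w hw] _] nm [v1 v3].
have p2 : prime 2 by [].
have [y1 y2 y3] := And3 (sqfree_neq0 s1) (sqfree_neq0 s2) (sqfree_neq0 s3).
have nw := square_neq0 y1 y2 y3 hw.
have v2 : vodd 2 L.1.2 = false.
  have : vodd 2 (w ^+ 2) = false by rewrite expr2 voddM // addbb.
  by rewrite -hw !voddM ?mulf_neq0 // v1 v3 addbF.
by rewrite -[(2 %| _)%Z]/(2%N%:Z %| _)%Z !(@sqfree_vodd 2) // v1 v2 v3.
Qed.

Lemma twist_two (m : int) : ~~ (2 %| m)%Z ->
  [/\ (2 %| e1 * m)%Z, ~~ (4 %| e1 * m)%Z, (2 %| e2 * m)%Z, ~~ (4 %| e2 * m)%Z & (4 %| e3 * m)%Z].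
Proof.
move=> om; have [[a1 b1] [a2 b2]] := (he1, he2).
have c4 : coprimez 4 m.
  rewrite coprimezE -[coprime _ _]/(coprime (2 ^ 2) `|m|) coprimeXl // prime_coprime //.
have h4 (e : int) : (4 %| e * m)%Z = (4 %| e)%Z by rewrite mulrC Gauss_dvdzr.
by split; rewrite ?h4 //; apply: dvdz_mulr.
Qed.

Lemma sel_odd_rep L : inSel e1 e2 e3 n%:Z L -> vodd2 L = (false, false) -> is_rep n L.
Proof.
move=> hL vL; have [o1 o2 o3] := inSel_vodd2 hL nN vL.
have [n1 n2 n3] := twist_neq0 nN.
have [[s1 s2 s3] [w hw [hl hr]]] := inSelP he_sum n1 n2 n3 hL.
case: L hL vL o1 o2 o3 s1 s2 s3 hw hl hr => [[d1 d2] d3] /= hL vL o1 o2 o3 s1 s2 s3 hw hl hr.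
have [y1 y2 y3] := And3 (sqfree_neq0 s1) (sqfree_neq0 s2) (sqfree_neq0 s3).
have nw := square_neq0 y1 y2 y3 hw.
have on := n_odd hp_prime hp_odd hn.
have [t1 t2 t3 t4 t5] := twist_two on.
have e3m : eps4 d3 = false := lsol_two_eps4 t1 t2 t3 t5 o1 o2 o3 hw (hl 2 isT).
(* The parts of [d1] and [d3] supported on [n]; the sign of [s3'] makes it 1 modulo 4. *)
pose s1' : int := (gcdn `|d1| n)%:Z; pose g3 : int := (gcdn `|d3| n)%:Z.
pose s3' : int := if eps4 g3 then - g3 else g3.
have gn : (g3 %| n%:Z)%Z by rewrite dvdzE /= dvdn_gcdr.
have og : ~~ (2 %| g3)%Z := dvd_n_odd hp_prime hp_odd hn gn.
have s1n : (s1' %| n%:Z)%Z by rewrite dvdzE /= dvdn_gcdr.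
have s1d : (s1' %| d1)%Z by rewrite dvdzE /= dvdn_gcdl.
have s1p : 0 < s1' by rewrite ltz_nat gcdn_gt0 (n_gt0 hp_prime hn) orbT.
have s3n : (s3' %| n%:Z)%Z by rewrite /s3'; case: ifP => _ //; rewrite dvdzE abszN.
have s3d : (s3' %| d3)%Z.
  have gd : (g3 %| d3)%Z by rewrite dvdzE /= dvdn_gcdl.
  by rewrite /s3'; case: ifP => _ //; rewrite dvdzE abszN.
have s34 : (s3' %% 4)%Z = 1.
  by rewrite /s3' /eps4; case: eqP og; clear; lia.
have [r1 er1] := dvdzP s1d; have [r3 er3] := dvdzP s3d.
have ns1 : s1' != 0 by rewrite gt_eqF.
have ns3 : s3' != 0 by apply: contra_eq_neq s34 => ->.
have [nr1 nr3] : r1 != 0 /\ r3 != 0.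
  by split; [apply: contraNneq y1|apply: contraNneq y3] => z; rewrite ?er1 ?er3 z mul0r.
have nr13 : r1 * r3 != 0 by rewrite mulf_neq0.
(* the quotient is prime to [n] because [d1] and [d3] are squarefree *)
have cop (d s r : int) : sqfree d -> d = r * s -> (forall q : nat, prime q -> (q%:Z %| d)%Z -> (q%:Z %| n%:Z)%Z -> (q%:Z %| s)%Z) ->
    forall q : nat, prime q -> (q%:Z %| n%:Z)%Z -> ~~ (q%:Z %| r)%Z.
  move=> sd ed hs q pq qn; apply/negP => qr.
  have qd : (q%:Z %| d)%Z by rewrite ed dvdz_mulr.
  have [d' ed' ud'] := sqfree_dvd sd pq qd.
  have /dvdzP[s'' es] := hs q pq qd qn; have /dvdzP[r'' er] := qr.
  case/negP: ud'; apply/dvdzP; exists (r'' * s'').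
  have nq : (q%:Z : int) != 0 by rewrite eqz_nat -lt0n prime_gt0.
  by apply: (mulfI nq); rewrite -ed' ed es er; ring.
have c1 := cop d1 s1' r1 s1 er1; have c3 := cop d3 s3' r3 s3 er3.
have {}c1 : forall q : nat, prime q -> (q%:Z %| n%:Z)%Z -> ~~ (q%:Z %| r1)%Z.
  by apply: c1 => q pq qd qn; rewrite dvdzE /= dvdn_gcd; apply/andP.
have {}c3 : forall q : nat, prime q -> (q%:Z %| n%:Z)%Z -> ~~ (q%:Z %| r3)%Z.
  apply: c3 => q pq qd qn.
  have h : (q%:Z %| g3)%Z by rewrite dvdzE /= dvdn_gcd; apply/andP.
  by rewrite /s3'; case: ifP => _ //; rewrite rpredN.
have [m1 m2 m3] := twist_neq0 (oner_neq0 int).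
(* The middle component of the quotient is represented by [r1 * r3], which makes the square product
   explicit. *)
have hsq : r1 * (r1 * r3) * r3 = (r1 * r3) ^+ 2 by ring.
have or1 : ~~ (2 %| r1)%Z by apply: contra o1 => h; rewrite er1 dvdz_mulr.
have or3 : ~~ (2 %| r3)%Z by apply: contra o3 => h; rewrite er3 dvdz_mulr.
have hodd q : prime q -> odd q -> lsol q (e1 * 1) (e2 * 1) (e3 * 1) r1 (r1 * r3) r3.
  move=> pq oq; have hq := hl q pq.
  (* At good primes of [E] the quotient only has to be unramified: by construction when [q] divides
     [n], and by [lsol_unit1] otherwise. *)
  have [qe|qe] := boolP (q%:Z %| e1 * e2 * e3)%Z; last first.
    move: (qe); rewrite dvd_eE // !negb_or => /and3P[v1 v2 v3].
    have [ur1 ur3] : ~~ (q%:Z %| r1)%Z /\ ~~ (q%:Z %| r3)%Z.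
      have [qn|qn] := boolP (q%:Z %| n%:Z)%Z; first by split; [exact: c1|exact: c3].
      have um (x : int) : ~~ (q%:Z %| x)%Z -> ~~ (q%:Z %| x * n%:Z)%Z by move=> hx; rewrite Euclid_dvdzM // negb_or hx.
      have hw3 : d3 * d1 * d2 = w ^+ 2 by rewrite -hw; ring.
      have h1 := lsol_unit1 pq s1 s2 s3 hw (um _ v2) (um _ v3) hq.
      have h3 := lsol_unit1 pq s3 s1 s2 hw3 (um _ v1) (um _ v2) (lsol_cyc (lsol_cyc hq)).
      by split; [apply: contra h1|apply: contra h3] => h; rewrite ?er1 ?er3 dvdz_mulr.
    apply: (lsol_good pq oq _ _ _ _ ur1 _ ur3 hsq); rewrite ?mulr1 //.
    by rewrite Euclid_dvdzM // negb_or ur1.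
  have [un rn] := dvd_n_residue pq oq qe (dvdzz _) pos_n.
  have [us1 rs1] := dvd_n_residue pq oq qe s1n s1p.
  have sn : sqp q (n%:Z * 1) by rewrite mulr1; apply: sqp_odd.
  have hq1 := lsol_twist_square pq (oner_neq0 _) hq sn.
  have ss1 : sqp q s1' by apply: sqp_odd.
  have sd1 : sqp q (d1 * r1).
    by rewrite er1 (_ : _ * _ = s1' * r1 ^+ 2); [apply: sqpM => //; apply: sqp_sqr|ring].
  (* If [q] divides [e2 * e3], both [s1'] and [s3'] are local squares and the local class is
     unchanged. *)
  have [q23|q23] := boolP (q%:Z %| e2 * e3)%Z.
    have [us3 rs3] := dvd_n_residue_star pq oq q23 s3n s34.
    have ss3 : sqp q s3' by apply: sqp_odd.
    apply: (lsol_square pq nr1 nr13 nr3 hq1) => //.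
      apply: (@sqp_cancel q _ (s1' * s3')); rewrite ?mulf_neq0 //.
      rewrite (_ : _ * _ = (r1 * s1') * d2 * (r3 * s3') * (s1' * s3')); last by ring.
      by rewrite -er1 -er3 hw; apply: sqpM; [|apply: sqp_sqr|apply: sqpM].
    by rewrite er3 (_ : _ * _ = s3' * r3 ^+ 2); [apply: sqpM => //; apply: sqp_sqr|ring].
  (* Here [q] divides only [e1] and [s3'] may be a nonresidue; [lsol_twist] multiplies the last two
     components by it. *)
  move: (q23); rewrite Euclid_dvdzM // negb_or => /andP[v2 v3].
  have q1 : (q%:Z %| e1)%Z by move: qe; rewrite dvd_eE // (negbTE v2) (negbTE v3) !orbF.
  have us3 : ~~ (q%:Z %| s3')%Z.
    by apply: contra un => h; apply: dvdz_trans s3n.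
  rewrite !mulr1 in hq1 *.
  have hq2 := lsol_twist pq oq q1 v2 v3 he_sum s1 s2 s3 hw us3 hq1.
  apply: (lsol_square pq nr1 nr13 nr3 hq2) => //.
    apply: (@sqp_cancel q _ s1') => //.
    rewrite (_ : _ * _ = (r1 * s1') * d2 * (r3 * s3') * s1'); last by ring.
    by rewrite -er1 -er3 hw; apply: sqpM; [|apply: sqp_sqr|].
  rewrite er3 (_ : _ * _ = (s3' * r3) ^+ 2); last by ring.
  by apply: sqp_sqr; rewrite ?mulf_neq0.
(* A negative [s3'] forces [e2 > 0 > e3]; the real condition is then just [d1 > 0], insensitive to a
   common sign change of the other components. *)
have hreal : real_signs (e1 * 1 < 0) (e2 * 1 < 0) (e3 * 1 < 0) (r1 < 0) (r1 * r3 < 0) (r3 < 0).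
  have sd2 : (d1 < 0) (+) (d2 < 0) (+) (d3 < 0) = false.
    by rewrite -!lt0_mul ?mulf_neq0 // hw ltNge sqr_ge0.
  have sr1 : (d1 < 0) = (r1 < 0) by rewrite er1 lt0_mul // [s1' < 0]ltNge ltW // addbF.
  have sr3 : (d3 < 0) = (r3 < 0) (+) (s3' < 0) by rewrite er3 lt0_mul.
  have sr2 : (r1 * r3 < 0) = (r1 < 0) (+) (r3 < 0) by rewrite lt0_mul.
  have sn (x : int) : (x * n%:Z < 0) = (x < 0) by rewrite pmulr_llt0.
  move: hr sd2; rewrite !sn !mulr1 sr2 sr1 sr3.
  case e: (s3' < 0); last first.
    by rewrite /real_signs; case: (e1 < 0); case: (e2 < 0); case: (e3 < 0); case: (d2 < 0); case: (r1 < 0); case: (r3 < 0).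
  have [q2 q3] := dvd_n_negative s3n s34 e.
  have -> : (e2 < 0) = false by rewrite ltNge ltW.
  rewrite q3 /real_signs.
  by case: (e1 < 0); case: (d2 < 0); case: (r1 < 0); case: (r3 < 0).
have o2' : ~~ (2 %| 1)%Z by [].
have [b1 b2 b3 b4 b5] := twist_two o2'.
have er : eps4 r3 = false.
  have os : ~~ (2 %| s3')%Z := dvd_n_odd hp_prime hp_odd hn s3n.
  move: e3m; rewrite er3 eps4M // [eps4 s3']/eps4 s34 addbF //.
have hR : inSel e1 e2 e3 1 (sqf3 r1 (r1 * r3) r3).
  apply: (inSel_sqf he_sum m1 m2 m3 nr1 nr13 nr3 hsq _ hreal) => q pq.
  have [oq|] := boolP (odd q); first exact: hodd.
  case/even_prime: (pq) => [-> _|->] //.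
  exact: (lsol_two_global b1 b2 b3 b4 (twist_sum 1) m1 m2 m3 or1 (odd_mul or1 or3) or3 hsq er hodd hreal).
have := sel1_trivial hR; rewrite /vodd2 /= !vodd_sqfpart // (odd_upart2 or1).2 (odd_upart2 or3).2 => /(_ erefl) [R1 _ R3].
have sqr (d s r : int) : sqfree d -> d = r * s -> s != 0 -> r != 0 -> sqfree r.
  move=> [_ sd] ed ns nr; split=> // q pq h; apply: (sd q pq); rewrite ed dvdz_mulr //.
have E1 : d1 = s1' by rewrite er1 -(sqfpart_id (sqr _ _ _ s1 er1 ns1 nr1)) R1 mul1r.
have E3 : d3 = s3' by rewrite er3 -(sqfpart_id (sqr _ _ _ s3 er3 ns3 nr3)) R3 mul1r.
split=> //=; rewrite ?E1 ?E3 //.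
(* By the square product a prime of [d2] divides [d1] or [d3], now known to divide [n]. *)
apply: (sqfree_dvd_n hp_prime hn s2) => q pq q2.
have : (q%:Z %| d1 * d3)%Z.
  have hw2 : d2 * d1 * d3 = w ^+ 2 by rewrite -hw; ring.
  have := square_triple_dvd s2 s1 s3 pq hw2 q2; rewrite Euclid_dvdzM //.
  by case/orP => /andP[h h']; rewrite ?h ?h' ?orbT.
rewrite Euclid_dvdzM // E1 E3 -[(q %| n)%N]/(q%:Z %| n%:Z)%Z => /orP[h|h]; exact: dvdz_trans h _.
Qed.

Lemma is_rep_vodd2 L : is_rep n L -> vodd2 L = (false, false).
Proof.
move=> [r1 _ r3 _ _]; rewrite /vodd2.
by rewrite (odd_upart2 (dvd_n_odd hp_prime hp_odd hn r1)).2 (odd_upart2 (dvd_n_odd hp_prime hp_odd hn r3)).2.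
Qed.

Lemma rep_kernel L : inSel e1 e2 e3 n%:Z L -> is_rep n L -> bigM e1 e2 e3 p n *m xz p L = 0.
Proof.
move=> hL [r1 r2 r3 d0 d4].
have [n1 n2 n3] := twist_neq0 nN.
have [[s1 s2 s3] [w hw [hl _]]] := inSelP he_sum n1 n2 n3 hL.
have u i := p_unit i.
apply/(kernel_isotropic hp_prime hp_odd hp_inj hn (fun i => let: And3 a _ _ := u i in a)
  (fun i => let: And3 _ a _ := u i in a) (fun i => let: And3 _ _ a := u i in a) z2
  (dvd_n_dpos hp_prime hp_inj hn r1 d0) (dvd_n_dstar hp_prime hp_odd hp_inj hn r3 d4)) => i.
have [I1 I2] := lsol_isotropy (hp_prime i) (hp_odd i) n1 n2 n3 (sqfree_neq0 s1) (sqfree_neq0 s2) (sqfree_neq0 s3) hw (hl _ (hp_prime i)).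
split.
  by rewrite -I1; congr (hs _ _ _); ring.
by rewrite I2; congr (hs _ _ _); ring.
Qed.

Lemma xz_inj L L' : inSel e1 e2 e3 n%:Z L -> inSel e1 e2 e3 n%:Z L' -> is_rep n L -> is_rep n L' ->
  xz p L = xz p L' -> L = L'.
Proof.
move=> [s1 s2 s3 [w hw] _] [s1' s2' s3' [w' hw'] _] [r1 r2 r3 d0 d4] [r1' r2' r3' d0' d4'] e.
have [ex ez] := eq_col_mx e.
have lg (d d' : int) : sqfree d -> sqfree d' ->
    \col_i (logn (p i) `|d|)%:R = \col_i (logn (p i) `|d'|)%:R :> 'cV['F_2]_k ->
    (fun i => logn (p i) `|d|) =1 (fun i => logn (p i) `|d'|).
  move=> sd sd' /colP h i; have := h i; rewrite !mxE !sqfree_logn //.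
  by move/bit_inj => ->.
have E1 : L.1.1 = L'.1.1.
  rewrite (dvd_n_dpos hp_prime hp_inj hn r1 d0) (dvd_n_dpos hp_prime hp_inj hn r1' d0').
  by apply: eq_bigr => i _; rewrite (lg _ _ s1 s1' ex i).
have E3 : L.2 = L'.2.
  rewrite (dvd_n_dstar hp_prime hp_odd hp_inj hn r3 d4) (dvd_n_dstar hp_prime hp_odd hp_inj hn r3' d4').
  by apply: eq_bigr => i _; rewrite (lg _ _ s3 s3' ez i).
have E2 : L.1.2 = L'.1.2.
  have [y1 y2 y3] := And3 (sqfree_neq0 s1) (sqfree_neq0 s2) (sqfree_neq0 s3).
  have [y1' y2' y3'] := And3 (sqfree_neq0 s1') (sqfree_neq0 s2') (sqfree_neq0 s3').
  apply: (sqfree_uniq s2 s2' (square_neq0 y1' y2' y3' hw') (square_neq0 y1 y2 y3 hw)).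
  by rewrite -hw -hw' E1 E3; ring.
by move: E1 E2 E3; case: (L) (L') => [[? ?] ?] [[? ?] ?] /= -> -> ->.
Qed.

Lemma kernel_rep v : bigM e1 e2 e3 p n *m v = 0 ->
  exists2 L, inSel e1 e2 e3 n%:Z L /\ is_rep n L & xz p L = v.
Proof.
(* The bits become exponents 0 or 1, and the square product forces [d2]. *)
move=> hv; pose f i : nat := (usubmx v i 0 != 0); pose g i : nat := (dsubmx v i 0 != 0).
pose d1 := dpos p f; pose d3 := dstar p g; pose d2 := sqfpart (d1 * d3).
have d0 : 0 < d1 by apply: dpos_gt0.
have y1 : d1 != 0 by rewrite gt_eqF.
have y3 : d3 != 0 by apply: dstar_neq0.
have r1 : (d1 %| n%:Z)%Z by apply: (dpos_dvd hn) => i; rewrite /f; case: (_ != _).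
have r3 : (d3 %| n%:Z)%Z by apply: (dstar_dvd hn) => i; rewrite /g; case: (_ != _).
have d4 : (d3 %% 4)%Z = 1 by apply: dstar_mod4.
have y13 : d1 * d3 != 0 by rewrite mulf_neq0.
have y2 : d2 != 0 by apply: sqfpart_neq0.
have s1 := dvd_n_sqfree hp_prime hp_inj hn r1; have s3 := dvd_n_sqfree hp_prime hp_inj hn r3.
have s2 : sqfree d2 by apply: sqfpart_sqfree.
have [c nc ec] := sqfpartE y13.
have [w hw] : exists w, d1 * d2 * d3 = w ^+ 2.
  by exists (d2 * c); rewrite mulrAC {1}ec -/d2; ring.
have nw := square_neq0 y1 y2 y3 hw.
have r2 : (d2 %| n%:Z)%Z.
  apply: (sqfree_dvd_n hp_prime hn s2) => q pq /(dvd_sqfpart pq y13).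
  by rewrite Euclid_dvdzM // -[(q %| n)%N]/(q%:Z %| n%:Z)%Z => /orP[h|h]; apply: dvdz_trans h _.
have xzL : xz p (d1, d2, d3) = v.
  rewrite /xz /= -[v]vsubmxK; congr col_mx; apply/colP => i; rewrite mxE.
    by rewrite (logn_p_dpos hp_prime hp_inj) [RHS]F2_neq0.
  by rewrite absz_dstar (logn_p_dpos hp_prime hp_inj) [RHS]F2_neq0.
exists (d1, d2, d3) => //; split; last by [].
have [n1 n2 n3] := twist_neq0 nN.
have u i := p_unit i.
have iso : forall i, isotropic p n e1 e2 e3 d1 d3 i.
  apply/(kernel_isotropic hp_prime hp_odd hp_inj hn (fun i => let: And3 a _ _ := u i in a)
  (fun i => let: And3 _ a _ := u i in a) (fun i => let: And3 _ _ a := u i in a) z2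
  (erefl : (d1, d2, d3).1.1 = dpos p f) (erefl : (d1, d2, d3).2 = dstar p g)).
  by rewrite xzL.
have hodd q : prime q -> odd q -> lsol q (e1 * n%:Z) (e2 * n%:Z) (e3 * n%:Z) d1 d2 d3.
  move=> pq oq.
  have [qn|qn] := boolP (q%:Z %| n%:Z)%Z.
    have [i ei] := prime_dvd_n hp_prime hn pq qn; rewrite ei in pq oq qn *.
    have [n' en un] := n_cofactor hp_prime hp_inj hn i; have [w1 w2 w3] := p_unit i.
    by have [I1 I2] := iso i; apply: (lsol_bad pq oq w1 w2 w3 he_sum en un s1 s2 s3 hw).
  have ud (d : int) : (d %| n%:Z)%Z -> ~~ (q%:Z %| d)%Z by move=> hd; apply: contra qn => h; apply: dvdz_trans hd.
  have um (x : int) : ~~ (q%:Z %| x)%Z -> ~~ (q%:Z %| x * n%:Z)%Z by move=> hx; rewrite Euclid_dvdzM // negb_or hx.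
  have [qe|qe] := boolP (q%:Z %| e1 * e2 * e3)%Z; last first.
    move: (qe); rewrite dvd_eE // !negb_or => /and3P[v1 v2 v3].
    exact: (lsol_good pq oq (um _ v1) (um _ v2) (um _ v3) (twist_sum _) (ud _ r1) (ud _ r2) (ud _ r3) hw).
  have [us1 rs1] := dvd_n_residue pq oq qe r1 d0.
  have ss1 : sqp q d1 by apply: sqp_odd.
  (* If [q] divides [e2 * e3] the class is locally trivial; if it divides only [e1], the class is
     (1, d3, d3) up to local squares. *)
  have [q23|q23] := boolP (q%:Z %| e2 * e3)%Z.
    have [us3 rs3] := dvd_n_residue_star pq oq q23 r3 d4.
    have ss3 : sqp q d3 by apply: sqp_odd.
    apply: lsol_trivial => //; apply: (@sqp_cancel q _ (d1 * d3)) => //.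
    rewrite (_ : _ * _ = d1 * d2 * d3 * (d1 * d3)); last by ring.
    by rewrite hw; apply: sqpM; [|apply: sqp_sqr|apply: sqpM].
  move: (q23); rewrite Euclid_dvdzM // negb_or => /andP[v2 v3].
  have q1 : (q%:Z %| e1 * n%:Z)%Z by move: qe; rewrite dvd_eE // (negbTE v2) (negbTE v3) !orbF => h; rewrite dvdz_mulr.
  have hnode := lsol_node pq oq q1 (um _ v2) (um _ v3) (twist_sum _) (ud _ r3).
  apply: (lsol_square pq y1 y2 y3 hnode); first by rewrite mul1r.
    apply: (@sqp_cancel q _ d1) => //.
    rewrite (_ : _ * _ = d1 * d2 * d3 * d1); last by ring.
    by rewrite hw; apply: sqpM; [|apply: sqp_sqr|].
  by rewrite -expr2; apply: sqp_sqr.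
have hreal : real_signs (e1 * n%:Z < 0) (e2 * n%:Z < 0) (e3 * n%:Z < 0) (d1 < 0) (d2 < 0) (d3 < 0).
  have sn (x : int) : (x * n%:Z < 0) = (x < 0) by rewrite pmulr_llt0.
  have sd1 : (d1 < 0) = false by rewrite ltNge ltW.
  have sd2 : (d2 < 0) = (d3 < 0) by rewrite sqfpart_sign // lt0_mul // sd1.
  rewrite !sn sd1 sd2; case e: (d3 < 0); last by [].
  have [q2 q3] := dvd_n_negative r3 d4 e.
  have -> : (e2 < 0) = false by rewrite ltNge ltW.
  by rewrite q3; case: (e1 < 0).
have on := n_odd hp_prime hp_odd hn.
have [t1 t2 t3 t4 t5] := twist_two on.
have oddn (d : int) := @dvd_n_odd _ _ _ hp_prime hp_odd hn d.
have er : eps4 d3 = false by rewrite /eps4 d4.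
have -> : (d1, d2, d3) = sqf3 d1 d2 d3 :> triple by rewrite /sqf3 !sqfpart_id.
apply: (inSel_sqf he_sum n1 n2 n3 y1 y2 y3 hw _ hreal) => q pq.
have [oq|] := boolP (odd q); first exact: hodd.
case/even_prime: (pq) => [-> _|->] //.
exact: (lsol_two_global t1 t2 t3 t4 (twist_sum _) n1 n2 n3 (oddn _ r1) (oddn _ r2) (oddn _ r3) hw er hodd hreal).
Qed.

End TwistedCurve.


(** * Normalized representatives and the isomorphism with the kernel *)

Theorem theorem4p4
  (e1 e2 e3 : int) (k : nat) (p : 'I_k -> nat) (n : nat)
  (he_nz : [/\ e1 != 0, e2 != 0 & e3 != 0])
  (he_sum : e1 + e2 + e3 = 0)
  (he1 : (2 %| e1)%Z /\ ~~ (4 %| e1)%Z)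
  (he2 : (2 %| e2)%Z /\ ~~ (4 %| e2)%Z)
  (he3 : (4 %| e3)%Z)
  (hp_prime : forall i, prime (p i))
  (hp_odd : forall i, odd (p i))
  (hp_inj : injective p)
  (hn : n = (\prod_(i < k) p i)%N)
  (hn_cop : coprime n (absz (e1 * e2 * e3)))
  (hn_qr : forall i (q : nat), prime q -> odd q -> (q%:Z %| e1 * e2 * e3)%Z ->
             qr (p i)%:Z q)
  (h_no4 : ~ has_point_order4 e1 e2 1 /\ ~ has_point_order4 e1 e2 n%:Z)
  (h_sign : (0 < e2 /\ e3 < 0) \/ (forall i, p i = 1 %[mod 4]))
  (h_leg : forall i (q : nat), prime q -> odd q -> (q%:Z %| e2 * e3)%Z ->
             qr (pstar (p i)) q)
  (h_sel : exists s : seq triple,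
             [/\ uniq s, size s = 4 & forall L, inSel e1 e2 e3 1 L <-> L \in s]) :
  let m := n%:Z in
  (* every class of Sel_2'(E^(n)) has a unique normalized representative *)
  (forall L, inSel e1 e2 e3 m L ->
     exists L', [/\ inSel e1 e2 e3 m L', sel'_eq e1 e2 e3 m L L', is_rep n L' &
       forall L'', inSel e1 e2 e3 m L'' -> sel'_eq e1 e2 e3 m L L'' -> is_rep n L'' ->
         L'' = L']) /\
  (* the map (d1,d2,d3) |-> (x; z) induces an isomorphism onto ker M *)
  let Rep L := inSel e1 e2 e3 m L /\ is_rep n L in
  let M := bigM e1 e2 e3 p n in
  [/\ (forall L, Rep L -> M *m xz p L = 0),
      (forall L L', Rep L -> Rep L' -> xz p L = xz p L' -> L = L'),
      (forall v, M *m v = 0 -> exists2 L, Rep L & xz p L = v) &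
      (forall L L' L'', Rep L -> Rep L' -> Rep L'' ->
         sel'_eq e1 e2 e3 m (tmul L L') L'' -> xz p L'' = xz p L + xz p L')].
Proof.
move=> m; case: he_nz => z1 z2 z3.
have on : ~~ (2 %| m)%Z := n_odd hp_prime hp_odd hn.
have nm : m != 0 := n_neq0 hp_prime hn.
have [n1 n2 n3] : [/\ e1 * m != 0, e2 * m != 0 & e3 * m != 0] by rewrite !mulf_neq0.
have rep0 := is_rep_vodd2 hp_prime hp_odd hn.
have sel0 L : inSel e1 e2 e3 m L -> L.1.1 != 0 /\ L.2 != 0.
  by case=> s1 _ s3 _ _; rewrite !sqfree_neq0.
have vt L tau : L.1.1 != 0 -> L.2 != 0 -> tau \in tors e1 e2 e3 m ->
    vodd2 (tmul L tau) = (vodd 2 L.1.1 (+) vodd 2 tau.1.1, vodd 2 L.2 (+) vodd 2 tau.2).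
  by move=> y1 y3 /(tors_neq0 z1 z2 z3 nm)[? _ ?]; apply: vodd2_tmul.
split=> [L hL|Rep M].
  have [y1 y3] := sel0 _ hL.
  (* The torsion class with the same parities at 2 as [L] makes the product odd, and injectivity of
     [vodd2] on torsion makes it the only one. *)
  have [tau htau vtau] := tors_vodd2_ex z1 z2 z3 he1 he2 (vodd2 L) on.
  have hL' := inSel_tors he_sum n1 n2 n3 hL htau.
  exists (tmul L tau); split=> //; first by exists tau.
    apply: (sel_odd_rep z1 z2 z3 he_sum he1 he2 he3 hp_prime hp_odd hp_inj hn hn_cop hn_qr h_sign h_leg h_sel hL').
    by rewrite vt //; case: vtau => -> ->; rewrite !addbb.
  move=> L'' hL'' [tau' htau' ->] /rep0; rewrite vt // => -[v1 v3]; congr tmul.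
  apply: (tors_vodd2_inj z1 z2 z3 he1 he2 on htau' htau); rewrite vtau /vodd2.
  by move: v1 v3; do 4!case: (vodd _ _).
split.
- move=> L [hL rL].
  exact: (rep_kernel z1 z2 z3 he_sum hp_prime hp_odd hp_inj hn hn_cop hL rL).
- by move=> L L' [hL rL] [hL' rL']; apply: (xz_inj hp_prime hp_odd hp_inj hn hL hL' rL rL').
- move=> v hv.
  exact: (kernel_rep z1 z2 z3 he_sum he1 he2 he3 hp_prime hp_odd hp_inj hn hn_cop hn_qr h_sign h_leg hv).
- move=> L L' L'' [hL rL] [hL' rL'] [hL'' rL''] [tau htau e].
  have [[y1 y3] [y1' y3']] := (sel0 _ hL, sel0 _ hL').
  have [w1 w2 w3] := tors_neq0 z1 z2 z3 nm htau.
  have p2 : prime 2 by [].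
  have vL := rep0 _ rL; have vL' := rep0 _ rL'; case: vL vL' => a1 a3 [b1 b3].
  have [x1 x3] : (tmul L L').1.1 != 0 /\ (tmul L L').2 != 0.
    by split; apply: sqfpart_neq0; rewrite mulf_neq0.
  (* A product of odd classes is odd, so no nontrivial torsion class can lead to the odd [L''].
     Exponents then add modulo 2, since [sqfpart] preserves the parity of valuations. *)
  have tau1 : tau = (1, 1, 1).
    apply: (tors_vodd2_inj z1 z2 z3 he1 he2 on htau (mem_head _ _)).
    have := vt _ _ x1 x3 htau; rewrite -e (rep0 _ rL'') /= !vodd_sqfpart ?mulf_neq0 // !voddM // a1 a3 b1 b3 /=.
    by rewrite /vodd2 => -[<- <-].
  have vx q (a b : int) : prime q -> a != 0 -> b != 0 -> (logn q `|sqfpart (sqfpart (a * b) * 1)|)%:R =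
      (logn q `|a|)%:R + (logn q `|b|)%:R :> 'F_2.
    move=> pq na nb; have nab : a * b != 0 by rewrite mulf_neq0.
    rewrite mulr1 sqfpartK // (natr_F2 (logn q `|a|)) (natr_F2 (logn q `|b|)) (natr_F2 (logn q `|sqfpart _|)).
    by rewrite -!/(vodd q _) vodd_sqfpart // voddM // bit_addb.
  rewrite e tau1 /xz add_col_mx; congr col_mx; apply/colP => i; rewrite !mxE /=; exact: vx.
Qed.
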